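(* Let $G$ be a quasi-reductive supergroup, $\mathfrak g=\mathrm{Lie}(G)$, let $x\in\mathfrak g_{\bar 1}$ and let $\frac12[x,x]=s+f$ be the Jordan decomposition in $\mathfrak g_{\bar 0}$ ($s$ semisimple, $f$ nilpotent). (1) The element $x$ is neat if and only if $att(x)=\{0\}$. In that case (when $f\ne 0$), for any $\mathfrak{sl}_2$-triple $(e,h,f)$ with $[s,h]=0$, the component $x_{-1}$ of $x$ in its $\mathrm{ad}_h$-eigenvector decomposition is $G_{\bar 0}$-conjugate to $x$. (2) The element $x$ is balanced if and only if it is strongly balanced.
   Context: Base field $\Bbbk$: algebraically closed of characteristic $0$. An algebraic supergroup $G$ is given by a Harish-Chandra pair $(G_{\bar 0},\mathfrak g)$: $\mathfrak g$ is a finite-dimensional Lie superalgebra, $G_{\bar 0}$ is an affine algebraic group with $\mathrm{Lie}(G_{\bar 0})=\mathfrak g_{\bar 0}$, and the adjoint action of $\mathfrak g_{\bar 0}$ on $\mathfrak g_{\bar 1}$ integrates to $G_{\bar 0}$. $\mathrm{Rep}(G)$ is the category of finite-dimensional $\mathfrak g$-modules (superspaces) on which the $\mathfrak g_{\bar 0}$-action integrates to $G_{\bar 0}$. $G$ is quasi-reductive if $G_{\bar 0}$ is reductive (its finite-dimensional rational representations form a semisimple category). Jordan decomposition in $\mathfrak g_{\bar 0}$ is the one of a reductive Lie algebra, with central elements semisimple. An odd nilpotent operator on a finite-dimensional superspace is neat if all its Jordan blocks have odd size, and balanced if each Jordan block has size $1$ or even size. Let $x\in\mathfrak g_{\bar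 1}$ and let $\frac12[x,x]=s+f$ be the Jordan decomposition, with $s$ semisimple and $f$ nilpotent. The element $x$ is neat if $s=0$ and $x|_M$ is a neat operator for every $M\in\mathrm{Rep}(G)$; $x$ is balanced if $x|_{M^s}$ is a balanced operator for every $M\in\mathrm{Rep}(G)$, where $M^s=\mathrm{Ker}(s|_M)$ (on which $x$ is nilpotent). $x$ is homological if $[x,x]$ is semisimple, i.e. $f=0$. Attractors. If $f\neq0$, choose an $\mathfrak{sl}_2$-triple $(e,h,f)$ in $\mathfrak g_{\bar 0}$ ($[h,e]=2e$, $[h,f]=-2f$, $[e,f]=h$) with $[s,h]=0$. Since $[f,x]=0$, one can write $x=x_0+x_{-1}+\dots+x_{-k}$ with $[h,x_i]=ix_i$ (the $\mathrm{ad}_h$-eigenvector decomposition). The element $x_0$ is called an attractor of $x$; $att(x)$ is the set of all attractors of $x$ (over all choices of the triple). If $f=0$, then $att(x):=\{x\}$. The element $x$ is strongly balanced if either $x$ is homological, or $f\neq 0$ and there exists an $\mathfrak{sl}_2$-triple $(e,h,f)$ in $\mathfrak g_{\bar 0}$, whose third member is the nilpotent part $f$ of $\frac12[x,x]$ and which satisfies $[s,h]=0$, such that $x_{-1}=0$ in the $\mathrm{ad}_h$-eigenvector decomposition $x=x_0+x_{-1}+\dots+x_{-k}$, $[h,x_i]=ix_i$. *)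

(* Defs.v *)
From HB Require Import structures.
From mathcomp Require Import all_boot all_order all_algebra all_fingroup.
From mathcomp Require Import mpoly.

Set Implicit Arguments.
Unset Strict Implicit.
Unset Printing Implicit Defensive.

Import GRing.Theory.
Local Open Scope ring_scope.

(* A Z/2-grading of V is a family p : bool -> {vspace V}, where [false] is the
   even and [true] the odd parity, so that parities add by (+). *)
Definition is_grading (k : fieldType) (V : vectType k)
    (p : bool -> {vspace V}) : Prop :=
  (p false + p true)%VS = fullv /\ (p false :&: p true)%VS = 0%VS.

Record lieSuperalgebra (k : fieldType) := LieSuperalgebra {
  lie_carrier :> vectType k;
  part : bool -> {vspace lie_carrier};
  bracket : {linear lie_carrier -> 'End(lie_carrier)};
  part_grading : is_grading part;
  bracket_parity : forall a b u v, u \in part a -> v \in part b ->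
    bracket u v \in part (a (+) b);
  bracket_anti : forall a b u v, u \in part a -> v \in part b ->
    bracket u v = - ((-1) ^+ (a && b) *: bracket v u);
  bracket_jacobi : forall a b u v w, u \in part a -> v \in part b ->
    bracket u (bracket v w) =
      bracket (bracket u v) w + (-1) ^+ (a && b) *: bracket v (bracket u w)
}.

(* An affine algebraic group over an algebraically closed field: a group
   structure on a Zariski closed subset of k^n for which the product and the
   inverse are polynomial maps. *)
Record affineGroup (k : closedFieldType) := AffineGroup {
  points :> groupType;
  adim : nat;
  coord : points -> 'I_adim -> k;
  equations : {mpoly k[adim]} -> Prop;
  coord_inj : forall a b, coord a =1 coord b -> a = b;
  coord_closed : forall v : 'I_adim -> k,
    (exists a, coord a =1 v) <-> (forall p, equations p -> p.@[v] = 0);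
  coord_mul : forall i, exists p : {mpoly k[adim + adim]}, forall a b,
    coord (a * b)%g i =
      p.@[fun j => match split j with
                   | inl j1 => coord a j1
                   | inr j2 => coord b j2
                   end];
  coord_inv : forall i, exists p : {mpoly k[adim]}, forall a,
    coord (a^-1)%g i = p.@[coord a]
}.

Section AffineGroups.
Variables (k : closedFieldType) (G : affineGroup k).

Definition regular (f : G -> k) : Prop :=
  exists p : {mpoly k[adim G]}, forall a, f a = p.@[coord a].

(* Lie(G) is the space of point derivations at 1 of the coordinate ring k[G].
   Here they are defined on all functions, but only their values on regular
   functions are meaningful. *)
Definition point_derivation (d : (G -> k) -> k) : Prop :=
  (forall c f1 f2, regular f1 -> regular f2 ->
     d (fun a => c * f1 a + f2 a) = c * d f1 + d f2) /\
  (forall f1 f2, regular f1 -> regular f2 ->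
     d (fun a => f1 a * f2 a) = f1 1%g * d f2 + d f1 * f2 1%g).

(* (d1 (x) d2) \o Delta, with Delta the comultiplication of k[G]. *)
Definition convolution (d1 d2 : (G -> k) -> k) : (G -> k) -> k :=
  fun f => d1 (fun a => d2 (fun b => f (a * b)%g)).

Definition rational_rep (V : vectType k) (rho : G -> 'End(V)) : Prop :=
  [/\ rho 1%g = \1%VF,
      forall a b, rho (a * b)%g = (rho a \o rho b)%VF &
      forall (phi : {linear V -> k^o}) (v : V),
        regular (fun a => phi (rho a v))].

(* u is the value at the point derivation d of the differential of rho. *)
Definition is_differential (V : vectType k) (rho : G -> 'End(V))
    (d : (G -> k) -> k) (u : 'End(V)) : Prop :=
  forall (phi : {linear V -> k^o}) (v : V),
    phi (u v) = d (fun a => phi (rho a v)).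

Definition reductive : Prop :=
  forall (V : vectType k) (rho : G -> 'End(V)), rational_rep rho ->
  forall U : {vspace V}, (forall a, (rho a @: U <= U)%VS) ->
  exists W : {vspace V},
    [/\ forall a, (rho a @: W <= W)%VS,
        (U + W)%VS = fullv & (U :&: W)%VS = 0%VS].

End AffineGroups.

(* An algebraic supergroup, as a Harish-Chandra pair. The map [tangent]
   identifies the even part of the Lie superalgebra with Lie(G_0); its values
   on other elements are irrelevant. [Ad] is the adjoint action of G_0 on the
   whole Lie superalgebra: the usual one on the even part, and an action
   integrating the adjoint action of the even part on the odd part. *)
Record supergroup (k : closedFieldType) := Supergroup {
  even_group : affineGroup k;
  lie : lieSuperalgebra k;
  tangent : lie -> (even_group -> k) -> k;
  Ad : even_group -> 'End(lie);
  tangent_derivation : forall u, u \in part lie false ->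
    point_derivation (tangent u);
  tangent_linear : forall c u v f,
    u \in part lie false -> v \in part lie false -> regular f ->
    tangent (c *: u + v) f = c * tangent u f + tangent v f;
  tangent_inj : forall u, u \in part lie false ->
    (forall f, regular f -> tangent u f = 0) -> u = 0;
  tangent_surj : forall d, point_derivation d ->
    exists2 u, u \in part lie false & forall f, regular f -> tangent u f = d f;
  tangent_bracket : forall u v f,
    u \in part lie false -> v \in part lie false -> regular f ->
    tangent (bracket lie u v) f =
      convolution (tangent u) (tangent v) f -
      convolution (tangent v) (tangent u) f;
  Ad_rational : rational_rep Ad;
  Ad_parity : forall a b u, u \in part lie b -> Ad a u \in part lie b;
  Ad_bracket : forall a u v,
    Ad a (bracket lie u v) = bracket lie (Ad a u) (Ad a v);
  Ad_even : forall a u f, u \in part lie false -> regular f ->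
    tangent (Ad a u) f = tangent u (fun b => f (a * b * a^-1)%g);
  Ad_differential : forall u, u \in part lie false ->
    is_differential Ad (tangent u) (bracket lie u)
}.

Definition quasi_reductive (k : closedFieldType) (G : supergroup k) : Prop :=
  reductive (even_group G).

Record superModule (k : fieldType) (g : lieSuperalgebra k) := SuperModule {
  mod_carrier :> vectType k;
  mod_part : bool -> {vspace mod_carrier};
  act : {linear g -> 'End(mod_carrier)};
  mod_grading : is_grading mod_part;
  act_parity : forall a b u m, u \in part g a -> m \in mod_part b ->
    act u m \in mod_part (a (+) b);
  act_bracket : forall a b u v m, u \in part g a -> v \in part g b ->
    act (bracket g u v) m =
      act u (act v m) - (-1) ^+ (a && b) *: act v (act u m)
}.

(* M belongs to Rep(G). The last condition, compatibility of the actions of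
   G_0 and of the Lie superalgebra, follows from the others if G_0 is
   connected. *)
Definition in_Rep (k : closedFieldType) (G : supergroup k)
    (M : superModule (lie G)) : Prop :=
  exists rho : even_group G -> 'End(M),
    [/\ rational_rep rho,
        forall a b m, m \in mod_part M b -> rho a m \in mod_part M b,
        forall u, u \in part (lie G) false ->
          is_differential rho (tangent u) (act M u) &
        forall a u m, rho a (act M u m) = act M (Ad a u) (rho a m)].

(* A Jordan basis of the subspace U for the nilpotent operator u on U: each
   pair (v, n) in c gives a Jordan block of size n > 0, spanned by the chain
   v, u v, ..., u^(n-1) v with u^n v = 0. *)
Definition jordan_basis (k : fieldType) (V : vectType k) (u : 'End(V))
    (U : {vspace V}) (c : seq (V * nat)) : Prop :=
  (forall p, p \in c -> (0 < p.2)%N /\ iter p.2 u p.1 = 0) /\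
  basis_of U (flatten [seq traject u p.1 p.2 | p <- c]).

Definition neat_operator (k : fieldType) (V : vectType k) (u : 'End(V))
    (U : {vspace V}) : Prop :=
  exists2 c, jordan_basis u U c & forall p, p \in c -> odd p.2.

Definition balanced_operator (k : fieldType) (V : vectType k) (u : 'End(V))
    (U : {vspace V}) : Prop :=
  exists2 c, jordan_basis u U c &
    forall p, p \in c -> p.2 = 1%N \/ ~~ odd p.2.

Section JordanDecomposition.
Variables (k : fieldType) (g : lieSuperalgebra k).

Definition semisimple_element (u : g) : Prop :=
  u \in part g false /\
  exists2 b : seq g, basis_of (part g false) b &
    forall v, v \in b -> exists c : k, bracket g u v = c *: v.

Definition derived_even : {vspace g} :=
  <<[seq bracket g u v | u <- vbasis (part g false),
                         v <- vbasis (part g false)]>>%VS.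

Definition nilpotent_element (u : g) : Prop :=
  u \in derived_even /\
  exists n, forall v, v \in part g false -> iter n (bracket g u) v = 0.

(* The even part is meant to be reductive: the derived algebra is then the
   complement of the centre, and central elements are semisimple while 0 is
   the only central nilpotent element. *)
Definition jordan_decomposition (u s f : g) : Prop :=
  [/\ u = s + f, semisimple_element s, nilpotent_element f &
      bracket g s f = 0].

Definition sl2_triple (e h f : g) : Prop :=
  [/\ e \in part g false, h \in part g false & f \in part g false] /\
  [/\ bracket g h e = 2%:R *: e, bracket g h f = - (2%:R *: f) &
      bracket g e f = h].

(* The component x_{-i} is xs`_i, which is 0 for i >= size xs. *)
Definition ad_decomposition (h x : g) (xs : seq g) : Prop :=
  x = \sum_(i < size xs) xs`_i /\
  forall i : nat, bracket g h xs`_i = - (i%:R *: xs`_i).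

End JordanDecomposition.

(* In what follows s and f are the semisimple and nilpotent parts of
   [x, x] / 2, for an odd element x. *)
Section OddElements.
Variables (k : closedFieldType) (G : supergroup k).
Implicit Types s f x : lie G.

Definition homological x : Prop := semisimple_element (bracket (lie G) x x).

Definition neat s x : Prop :=
  s = 0 /\
  forall M : superModule (lie G), in_Rep M -> neat_operator (act M x) fullv.

Definition balanced s x : Prop :=
  forall M : superModule (lie G), in_Rep M ->
    balanced_operator (act M x) (lker (act M s)).

(* y belongs to att(x) *)
Definition attractor s f x (y : lie G) : Prop :=
  (f = 0 /\ y = x) \/
  (f <> 0 /\ exists e h xs,
     [/\ sl2_triple e h f, bracket (lie G) s h = 0,
         ad_decomposition h x xs & y = xs`_0]).

Definition strongly_balanced s f x : Prop :=
  homological x \/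
  (f <> 0 /\ exists e h xs,
     [/\ sl2_triple e h f, bracket (lie G) s h = 0,
         ad_decomposition h x xs & xs`_1 = 0]).

End OddElements.

(* Main.v *)
(* Let (e, h, f) be a triple with [s, h] = 0. On a module M, or on Ker s in
   general, x squares to f and maps the lowest weight vectors (the kernel of f)
   of weight -i into the sum of those of weights <= -i, with leading terms x_0
   and x_(-1). Counting Jordan blocks as quotients of Ker x by images of powers
   of x, an even block exists as soon as x_0 does not kill Ker f, and blocks of
   odd size > 1 are governed by the exactness of x_(-1) modulo x_0.

   An x_0 killing Ker f kills M, because x_0 commutes with the triple; and an
   odd element acting by zero on all of Rep(G) is zero, as the adjoint module
   and extensions of the trivial module by invariants in g_1 show. When
   x_0 = 0, one has [x_(-1), [e, x_(-1)]] = h, which allows the components of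
   x of weight < -1 to be removed one after the other by exponentials of even
   elements of negative weight commuting with f.

   If x is balanced on the adjoint module, exactness there yields an even z of
   weight -1, commuting with s and f, with [x_0, z] = - 3 x_(-1), and x_(-1)
   vanishes after replacing h by h + z / 3.

   Reductivity of G_0 enters through complete reducibility over g_0, which
   gives the semisimplicity of ad s on g and, via the Killing form, the
   existence of triples. *)

From HB Require Import structures.
From mathcomp Require Import all_boot all_order all_algebra all_fingroup.
From mathcomp Require Import mpoly ring zify.
From Stdlib Require Import Classical FunctionalExtensionality.
Require Import Defs.

Set Implicit Arguments.
Unset Strict Implicit.
Unset Printing Implicit Defensive.

Import GRing.Theory.
Local Open Scope ring_scope.

(** All comparisons of weights pass through the filtration Ker f ∩ Im f^j, called [low j]. It is the
    span of the lowest weight vectors of weight at most -j, but it depends on f alone: it links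
    images of even powers of x, hence Jordan blocks, with weights, and it survives a change of
    triple with the same f. Leading terms are read off by one principle: a vector of weight -i in
    [low j] with i < j is zero. In weights 0, -1, -2 the equation [x, x] = 2(s + f) gives [x_0, x_0]
    = 2s, [x_0, x_(-1)] = 0 and f = [x_0, x_(-2)] + [x_(-1), x_(-1)]/2. The middle one lets
    exactness be applied to the vector x_(-1) of the adjoint module; it returns t with
    [x_(-1), x_(-1)] = [x_0, t], so f = [x_0, v] with v = x_(-2) + t/2, and z is built from v,
    x_(-1) and their brackets with e. Two obstacles: G_0 may be disconnected, so its reductivity
    says nothing immediate about g_0; and an exponential must be a point of G_0, a group known only
    through its equations. *)

Definition lin_closed (K : fieldType) (V : lmodType K) (P : V -> Prop) :=
  P 0 /\ forall c u v, P u -> P v -> P (c *: u + v).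

Section LinClosed.
Variables (K : fieldType) (V : lmodType K) (P : V -> Prop).
Hypothesis Pl : lin_closed P.

Lemma lin_closed0 : P 0. Proof. by case: Pl. Qed.

Lemma lin_closedZ c u : P u -> P (c *: u).
Proof. by move=> Pu; rewrite -[_ *: _]addr0; apply: Pl.2 => //; case: Pl. Qed.

Lemma lin_closedD u v : P u -> P v -> P (u + v).
Proof. by move=> Pu Pv; rewrite -[u]scale1r; apply: Pl.2. Qed.

Lemma lin_closedN u : P u -> P (- u).
Proof. by rewrite -scaleN1r; apply: lin_closedZ. Qed.

Lemma lin_closedB u v : P u -> P v -> P (u - v).
Proof. by move=> Pu Pv; apply/lin_closedD/lin_closedN. Qed.

Lemma lin_closed_sum I (r : seq I) (Q : pred I) (F : I -> V) :
  (forall i, Q i -> P (F i)) -> P (\sum_(i <- r | Q i) F i).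
Proof. by move=> PF; elim/big_ind: _ => //; [case: Pl | apply: lin_closedD]. Qed.

End LinClosed.

Lemma lin_closed_vspace (K : fieldType) (V : vectType K) (U : {vspace V}) :
  lin_closed (fun v => v \in U).
Proof. by split=> [|c u v uU vU]; rewrite ?mem0v // memvD ?memvZ. Qed.

Lemma lin_closed_and (K : fieldType) (V : lmodType K) (P Q : V -> Prop) :
  lin_closed P -> lin_closed Q -> lin_closed (fun v => P v /\ Q v).
Proof.
move=> [P0 PD] [Q0 QD]; split=> // c u v [Pu Qu] [Pv Qv].
by split; [apply: PD | apply: QD].
Qed.

(** A subspace contained in [P] grows by any vector of [P] outside it, and the dimension bounds the
    process. Radicals, centres and orthogonals given by a property thus become subspaces. *)
Lemma vspace_of_pred (K : fieldType) (V : vectType K) (P : V -> Prop) :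
  lin_closed P -> exists U : {vspace V}, forall v, v \in U <-> P v.
Proof.
move=> Pl.
suff H n : forall U : {vspace V}, (\dim {:V} - \dim U <= n)%N ->
    (forall v, v \in U -> P v) ->
    exists U : {vspace V}, forall v, v \in U <-> P v.
  apply: (H _ 0%VS (leqnn _)) => v; rewrite memv0 => /eqP->.
  exact: lin_closed0.
elim: n => [|n IHn] U dU UP;
  case: (classic (exists2 v, P v & v \notin U)) => [[v Pv vU]|nU].
- suff: v \in U by rewrite (negPf vU).
  have /eqP -> : U == fullv by rewrite eqEdim subvf -subn_eq0 -leqn0.
  exact: memvf.
- exists U => v; split; first exact: UP.
  by move=> Pv; apply/negPn/negP => vU; case: nU; exists v.
- apply: (IHn (U + <[v]>)%VS) => [|w /memv_addP [u uU [w' /vlineP [c ->] ->]]].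
    have UD : (U :&: <[v]> = 0)%VS.
      apply/eqP; rewrite -subv0; apply/subvP=> w /memv_capP [wU /vlineP [c Dw]].
      rewrite memv0 Dw; case: (eqVneq c 0) => [->|c0]; first by rewrite scale0r.
      case/negP: vU; rewrite -[v]scale1r -(mulVf c0) -scalerA -Dw memvZ //.
    have v0 : v != 0 by apply: contraNneq vU => ->; apply: mem0v.
    rewrite dimv_disjoint_sum // dim_vline v0.
    by move: dU; lia.
  by apply: lin_closedD => //; [apply: UP | apply: lin_closedZ].
exists U => v; split; first exact: UP.
by move=> Pv; apply/negPn/negP => vU; case: nU; exists v.
Qed.

Lemma memv_separate (K : fieldType) (V : vectType K) (U : {vspace V}) v :
  v \notin U -> exists phi : {linear V -> K^o},
    (forall u, u \in U -> phi u = 0) /\ phi v <> 0.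
Proof.
move=> vU; pose p : 'End(V) := \1%VF - projv U.
have Dp w : p w = w - projv U w by rewrite !lfun_simp.
have pv0 : p v != 0.
  by apply: contra vU; rewrite Dp subr_eq0 => /eqP ->; apply: memv_proj.
pose b := vbasis (@fullv _ V).
have [i bi] : exists i, vector.coord b i (p v) != 0.
  apply/existsP; apply: contraNT pv0; rewrite negb_exists => /forallP b0.
  rewrite (coord_vbasis (memvf (p v))) big1 // => i _.
  by move: (b0 i); rewrite negbK => /eqP ->; rewrite scale0r.
exists [the {linear V -> K^o} of (vector.coord b i : {scalar V}) \o p]; split=> [u uU|].
  by rewrite /= Dp projv_id // subrr linear0.
exact/eqP.
Qed.

Lemma eq_by_functionals (K : fieldType) (V : vectType K) (u v : V) :
  (forall phi : {linear V -> K^o}, phi u = phi v) -> u = v.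
Proof.
move=> E; apply/eqP; rewrite -subr_eq0 -memv0; apply/negPn/negP => /memv_separate.
by case=> phi [_ []]; rewrite linearB E subrr.
Qed.

(** Applying [H] minus the last eigenvalue removes the last summand and rescales the others by
    nonzero factors. *)
Lemma lin_closed_components (K : fieldType) (V : vectType K) (H : 'End(V))
    (P : V -> Prop) (a : nat -> K) n (v : nat -> V) :
  lin_closed P -> (forall w, P w -> P (H w)) -> injective a ->
  (forall i, H (v i) = a i *: v i) ->
  P (\sum_(i < n) v i) -> forall i, (i < n)%N -> P (v i).
Proof.
move=> Pl PH a_inj; elim: n v => [|n IHn] v Hv Pv i //; rewrite ltnS => le_in.
have Pi j : (j < n)%N -> P (v j).
  move=> jn; suff: P ((a j - a n) *: v j).
    have nz : a j - a n != 0.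
      by rewrite subr_eq0; apply/eqP => /a_inj E; rewrite E ltnn in jn.
    by move/(lin_closedZ Pl (a j - a n)^-1); rewrite scalerA mulVf ?scale1r.
  apply: (IHn (fun j => (a j - a n) *: v j)) jn => [l|].
    by rewrite linearZ /= Hv !scalerA mulrC.
  have -> : \sum_(l < n) (a l - a n) *: v l =
            H (\sum_(l < n.+1) v l) - a n *: \sum_(l < n.+1) v l.
    rewrite linear_sum scaler_sumr -sumrB big_ord_recr /=.
    rewrite [H (v n)]Hv subrr addr0; apply: eq_bigr => l _.
    by rewrite Hv -scalerBl.
  by apply: lin_closedB => //; [apply: PH | apply: lin_closedZ].
case: ltngtP le_in => // [/Pi//|-> _].
have -> : v n = \sum_(i < n.+1) v i - \sum_(i < n) v i.
  by rewrite big_ord_recr /= addrAC subrr add0r.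
apply: lin_closedB => //; apply: lin_closed_sum => // j _.
exact: Pi (ltn_ord j).
Qed.

(** * Nilpotency from trace conditions *)

Section Triangular.
Variable k : closedFieldType.

Lemma trigonalizable n (x : 'M[k]_n) :
  exists2 P : 'M_n, P \in unitmx & is_trig_mx (P *m x *m invmx P).
Proof.
elim: n x => [|n IHn] x.
  by exists 1%:M; [exact: unitmx1 | rewrite [_ *m _]flatmx0 mx0_is_trig].
have /closed_rootP [a] : size (char_poly x) != 1%N by rewrite size_char_poly.
rewrite -eigenvalue_root_char => /eigenvalueP [v vx v0].
(* The first row of [row_ebase v] is [v] up to a nonzero factor: a basis of row vectors starting
   with an eigenvector, in which [x] is lower block triangular. *)
pose Q : 'M_n.+1 := row_ebase v.
have uQ : Q \in unitmx by apply: row_ebase_unit.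
have [c c0 Dc] : exists2 c : k, c != 0 & row 0 Q = c *: v.
  have := mulmx_ebase v; have -> : \rank v = 1%N by apply/eqP; rewrite rank_rV v0.
  set d := col_ebase v => Dv.
  have {}Dv : d 0 0 *: row 0 Q = v.
    rewrite -[RHS]Dv [X in X *m _ *m _]mx11_scalar mul_scalar_mx -scalemxAl.
    rewrite rowE; apply: (congr1 (fun w => d 0 0 *: (w *m Q))).
    by apply/rowP=> j; rewrite !mxE /=; case: (j) => [[]].
  have d0 : d 0 0 != 0.
    by apply: contraNneq v0 => d0; rewrite -Dv d0 scale0r.
  exists (d 0 0)^-1; first by rewrite invr_eq0.
  by rewrite -Dv scalerA mulVf // scale1r.
pose T : 'M_(1 + n) := Q *m x *m invmx Q.
have rT : row 0 T = a *: delta_mx 0 0.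
  rewrite /T !row_mul Dc -!scalemxAl vx -scalemxAl scalerA mulrC -scalerA.
  congr (_ *: _); rewrite scalemxAl -Dc -row_mul mulmxV //.
  by apply/rowP=> j; rewrite !mxE /= eq_sym.
have Turs : ursubmx T = 0.
  apply/rowP=> j; rewrite !mxE; have /rowP/(_ (rshift 1 j)) := rT.
  rewrite !mxE lshift0 => ->.
  by rewrite /= mulr0.
have [P uP tP] := IHn (drsubmx T).
pose P' : 'M_(1 + n) := block_mx 1%:M 0 0 P.
have uP' : P' \in unitmx.
  by rewrite unitmxE det_ublock det1 mul1r -unitmxE.
have iP' : invmx P' = block_mx 1%:M 0 0 (invmx P).
  apply: (can_inj (mulKmx uP')); rewrite mulmxV // mulmx_block.
  rewrite !mulmx0 !mul0mx !mulmx1 addr0 add0r mulmxV // addr0 add0r.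
  by rewrite -[RHS]scalar_mx_block.
have uPQ : P' *m Q \in unitmx by rewrite unitmx_mul uP' uQ.
exists (P' *m Q); first by [].
have -> : invmx (P' *m Q) = invmx Q *m invmx P'.
  apply: (can_inj (mulKmx uPQ)); rewrite mulmxV //.
  by rewrite mulmxA mulmxK // mulmxV.
suff: is_trig_mx (P' *m T *m invmx P').
  by rewrite /T !mulmxA.
rewrite -(submxK T) Turs iP' /P' !mulmx_block.
rewrite !(mulmx0, mul0mx, mulmx1, mul1mx, addr0, add0r).
by rewrite is_trig_block_mx // eqxx mx11_is_trig.
Qed.

Lemma mulmx_trig_diag n (A B : 'M[k]_n) i :
  is_trig_mx A -> is_trig_mx B -> (A *m B) i i = A i i * B i i.
Proof.
move=> /is_trig_mxP tA /is_trig_mxP tB; rewrite mxE (bigD1 i) //= big1 ?addr0 //.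
move=> j ji; case: (ltngtP i j) => [ij|ij|ij].
- by rewrite tA ?mul0r.
- by rewrite (tB j i) ?mulr0.
by case/eqP: ji; apply: val_inj.
Qed.

Lemma mulmx_trig n (A B : 'M[k]_n) :
  is_trig_mx A -> is_trig_mx B -> is_trig_mx (A *m B).
Proof.
move=> /is_trig_mxP tA /is_trig_mxP tB; apply/is_trig_mxP=> i j ij.
rewrite mxE big1 // => l _; case: (ltnP i l) => il; first by rewrite tA ?mul0r.
by rewrite (tB l j) ?mulr0 // (leq_ltn_trans il).
Qed.

Lemma horner_mx_trig n (A : 'M[k]_n.+1) p : is_trig_mx A ->
  is_trig_mx (horner_mx A p) /\ forall i, horner_mx A p i i = p.[A i i].
Proof.
move=> tA; elim/poly_ind: p => [|p c [IHt IHd]].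
  by rewrite rmorph0 mx0_is_trig; split=> // i; rewrite mxE horner0.
rewrite rmorphD rmorphM /= horner_mx_X horner_mx_C; split.
  apply/is_trig_mxP=> i j ij; rewrite mxE (is_trig_mxP (mulmx_trig IHt tA)) //.
  by rewrite (is_trig_mxP (scalar_mx_is_trig _ c)) ?addr0.
move=> i; rewrite mxE mulmx_trig_diag // IHd !hornerE; congr (_ + _).
by rewrite mxE eqxx mulr1n.
Qed.

Lemma eigenvalue_list n (x : 'M[k]_n.+1) :
  exists lam : 'I_n.+1 -> k,
    char_poly x = \prod_i ('X - (lam i)%:P) /\
    forall p, \tr (horner_mx x p) = \sum_i p.[lam i].
Proof.
have [P uP tT] := trigonalizable x; set T := P *m x *m invmx P in tT.
have Tp p : horner_mx T p = P *m horner_mx x p *m invmx P.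
  by rewrite /T horner_mx_uconj.
exists (fun i => T i i); split.
  rewrite -char_poly_trig // /char_poly.
  have -> : char_poly_mx T = map_mx polyC P *m char_poly_mx x *m map_mx polyC (invmx P).
    rewrite /char_poly_mx mulmxBr mulmxBl /T !map_mxM; congr (_ - _).
    by rewrite scalar_mxC -mulmxA -map_mxM mulmxV // map_mx1 mulmx1.
  rewrite !det_mulmx mulrAC -det_mulmx -map_mxM mulmxV // map_mx1 det1 mul1r //.
move=> p; transitivity (\tr (horner_mx T p)).
  by rewrite Tp mxtrace_mulC mulmxA mulVmx // mul1mx.
by apply: eq_bigr => i _; have [_ ->] := horner_mx_trig p tT.
Qed.

Lemma nilpotent_of_eigenvalues n (x : 'M[k]_n.+1) :
  (forall lam (v : 'rV_n.+1), v *m x = lam *: v -> v != 0 -> lam = 0) -> x ^+ n.+1 = 0.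
Proof.
move=> Hx; have [lam [Dx _]] := eigenvalue_list x.
have lam0 i : lam i = 0.
  have : eigenvalue x (lam i).
    rewrite eigenvalue_root_char Dx rootE horner_prod (bigD1 i) //=.
    by rewrite hornerXsubC subrr mul0r.
  by case/eigenvalueP=> v Dv v0; apply: Hx Dv v0.
have := Cayley_Hamilton x; rewrite Dx (eq_bigr (fun=> 'X)); last first.
  by move=> i _; rewrite lam0 subr0.
by rewrite prodr_const card_ord rmorphXn /= horner_mx_X.
Qed.

End Triangular.

(** * Congruences modulo powers of distinct linear factors *)

Section PowersOfLinearFactors.
Variable K : fieldType.

Lemma coprime_power_prod (s : seq K) b N : b \notin s ->
  coprimep (('X - b%:P) ^+ N) (\prod_(a <- s) ('X - a%:P) ^+ N).
Proof.
move=> bs; apply/coprimep_expl; rewrite coprimep_sym coprimep_XsubC rootE horner_prod.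
rewrite prodf_seq_neq0; apply/allP => a a_s /=.
rewrite horner_exp expf_neq0 // hornerXsubC subr_eq0.
by apply: contraNneq bs => ->.
Qed.

(* The polynomials are prescribed modulo powers of distinct linear factors. *)
Lemma crt_powers (s : seq K) (F : K -> K) N : uniq s ->
  exists q : {poly K}, forall a, a \in s ->
    ('X - a%:P) ^+ N %| q - (F a)%:P.
Proof.
elim: s => [|b s IHs] /=; first by exists 0.
case/andP=> bs us; have [q Hq] := IHs us.
pose m := \prod_(a <- s) ('X - a%:P) ^+ N.
have cop : coprimep (('X - b%:P) ^+ N) m by apply: coprime_power_prod.
have /Bezout_eq1_coprimepP [[u v] /= uv1] := cop.
exists (q + v * m * ((F b)%:P - q)) => a; rewrite inE => /orP [/eqP ->|a_s].
  have -> : q + v * m * ((F b)%:P - q) - (F b)%:P =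
            u * ('X - b%:P) ^+ N * (q - (F b)%:P).
    by rewrite -[v * m](addKr (u * ('X - b%:P) ^+ N)) uv1; ring.
  by rewrite dvdp_mulr // dvdp_mull.
rewrite addrAC dvdp_add ?Hq // dvdp_mulr // dvdp_mull //.
by rewrite /m (big_rem a a_s) /= dvdp_mulr.
Qed.

Lemma dvd_prod_powers (s : seq K) N (p : {poly K}) : uniq s ->
  (forall a, a \in s -> ('X - a%:P) ^+ N %| p) ->
  \prod_(a <- s) ('X - a%:P) ^+ N %| p.
Proof.
elim: s => [|b s IHs] /=; first by rewrite big_nil dvd1p.
case/andP=> bs us Hp; rewrite big_cons Gauss_dvdp ?Hp ?mem_head //=.
  by apply: IHs => // a a_s; rewrite Hp // inE a_s orbT.
exact: coprime_power_prod.
Qed.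

(** The exponent [size s] bounds every multiplicity. With [s] the list of eigenvalues, the
    characteristic polynomial divides a product over the distinct ones. *)
Lemma prod_XsubC_dvd_powers (s : seq K) :
  \prod_(a <- s) ('X - a%:P) %| \prod_(a <- undup s) ('X - a%:P) ^+ size s.
Proof.
elim: s => [|b s IHs] /=; first by rewrite !big_nil.
have E (t : seq K) : \prod_(a <- t) ('X - a%:P) ^+ (size s).+1 =
    (\prod_(a <- t) ('X - a%:P)) * \prod_(a <- t) ('X - a%:P) ^+ size s.
  by rewrite -big_split; apply: eq_bigr => a _; rewrite exprS.
rewrite big_cons; case: ifP => bs; rewrite ?big_cons E.
  by apply: dvdp_mul => //; rewrite (big_rem b) ?mem_undup //= dvdp_mulr.
rewrite exprS -mulrA dvdp_mul // mulrCA dvdp_mull // dvdp_mull //.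
Qed.

End PowersOfLinearFactors.

Section Cartan.
Variable k : closedFieldType.
Hypothesis char_k : [pchar k] =i pred0.

Lemma natr_neq0 n : (0 < n)%N -> n%:R != 0 :> k.
Proof. by rewrite (iffLR (pcharf0P k) char_k) lt0n. Qed.

Lemma intr_inj0 (m : int) : m%:~R = 0 :> k -> m = 0.
Proof.
case: m => n m0; last first.
  have : n.+1%:R == 0 :> k by rewrite -oppr_eq0; apply/eqP.
  by rewrite (iffLR (pcharf0P k) char_k).
have : n%:R == 0 :> k by apply/eqP.
by rewrite (iffLR (pcharf0P k) char_k) => /eqP ->.
Qed.

(* A linear functional on the rational span of the [lam i], scaled to take
   integral values. *)
Lemma integral_functional n (lam : 'I_n -> k) j : lam j != 0 ->
  exists phi : 'I_n -> int, phi j != 0 /\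
    forall c : 'I_n -> int, \sum_i (c i)%:~R * lam i = 0 ->
      \sum_i c i * phi i = 0.
Proof.
move=> lamj.
(* The rational relations between the [lam i], with denominators cleared so that they make sense in
   [k]. The j-th unit vector is not one of them, and a functional killing the relations but not this
   vector provides [phi]. *)
pose P (v : 'rV[rat]_n) := exists2 d : int, d != 0 & exists c : 'I_n -> int,
  (forall i, d%:~R * v 0 i = (c i)%:~R) /\ \sum_i (c i)%:~R * lam i = 0.
have Pl : lin_closed P.
  split.
    exists 1 => //; exists (fun=> 0); split=> [i|]; first by rewrite mxE mulr0.
    by rewrite big1 // => i _; rewrite mul0r.
  move=> a u v [d1 d10 [c1 [E1 R1]]] [d2 d20 [c2 [E2 R2]]].
  exists (denq a * d1 * d2); first by rewrite !mulf_neq0 ?denq_neq0.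
  exists (fun i => numq a * d2 * c1 i + denq a * d1 * c2 i); split=> [i|].
    have Da : (denq a)%:~R * a = (numq a)%:~R.
      by rewrite mulrC -{1}(divq_num_den a) mulfVK ?intr_eq0 ?denq_neq0.
    rewrite !mxE rmorphD !rmorphM /= -E1 -E2 -Da; ring.
  rewrite (eq_bigr (fun i => (numq a * d2)%:~R * ((c1 i)%:~R * lam i) +
                          (denq a * d1)%:~R * ((c2 i)%:~R * lam i))).
    by rewrite big_split /= -!mulr_sumr R1 R2 !mulr0 addr0.
  by move=> i _; rewrite rmorphD !rmorphM /=; ring.
have [U UP] := vspace_of_pred Pl.
have ejU : delta_mx 0 j \notin U.
  apply/negP => /UP [d d0 [c [Ec Rc]]].
  have Dc i : c i = d * (i == j)%:Z.
    apply/eqP; rewrite -(eqr_int rat) -Ec !mxE eqxx /= intrM.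
    by case: (i == j).
  case/negP: d0; apply/eqP; apply: intr_inj0.
  apply: (mulIf lamj); rewrite mul0r -Rc (bigD1 j) //= Dc eqxx mulr1.
  by rewrite big1 ?addr0 // => i /negPf ij; rewrite Dc ij mulr0 mul0r.
have [psi [psiU psij]] := memv_separate ejU.
pose q i : rat := psi (delta_mx 0 i).
pose D : int := \prod_i denq (q i).
have D0 : D%:~R != 0 :> rat.
  by rewrite intr_eq0; apply/prodf_neq0 => i _; apply: denq_neq0.
have DZ i : exists m : int, m%:~R = D%:~R * q i.
  exists (numq (q i) * \prod_(l | l != i) denq (q l)).
  have -> : D = denq (q i) * \prod_(l | l != i) denq (q l) by rewrite /D (bigD1 i).
  rewrite -{3}(divq_num_den (q i)) !intrM mulrAC.
  congr (_ * _); rewrite [RHS]mulrC mulfVK ?intr_eq0 ?denq_neq0 //.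
pose phi i := numq (D%:~R * q i).
have phiE i : (phi i)%:~R = D%:~R * q i.
  by rewrite /phi; case: (DZ i) => m <-; rewrite numq_int.
exists phi; split.
  apply/eqP => phij; apply: psij; apply: (mulfI D0).
  by rewrite -/(q j) -phiE phij mulr0.
move=> c Rc; apply/eqP; rewrite -(intr_eq0 rat) rmorph_sum /=.
rewrite (eq_bigr (fun i => D%:~R * ((c i)%:~R * q i))); last first.
  by move=> i _; rewrite rmorphM /= phiE mulrCA.
rewrite -mulr_sumr mulf_eq0 (negPf D0) /=.
have cU : (\row_i (c i)%:~R : 'rV[rat]_n) \in U.
  by apply/UP; exists 1 => //; exists c; split=> // i; rewrite mxE mul1r.
suff -> : \sum_i (c i)%:~R * q i = psi (\row_i (c i)%:~R) by rewrite psiU.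
rewrite (row_sum_delta (\row_i _)) linear_sum; apply: eq_bigr => i _.
by rewrite linearZ mxE.
Qed.

End Cartan.

(** * Polynomials in an endomorphism *)

Section PolyAction.
Variables (K : fieldType) (V : vectType K) (D : 'End(V)).
Implicit Types (p q : {poly K}) (u v w : V).

Definition poly_act (p : {poly K}) (v : V) :=
  \sum_(i < size p) p`_i *: iter i D v.

Lemma poly_actE n p v : (size p <= n)%N ->
  poly_act p v = \sum_(i < n) p`_i *: iter i D v.
Proof.
move=> pn; rewrite /poly_act -!(big_mkord xpredT (fun i => p`_i *: iter i D v)).
rewrite (big_cat_nat (n := size p) _ pn) //= [X in _ = _ + X]big1_seq ?addr0 //.
move=> i /andP [_]; rewrite mem_index_iota => /andP [pi _].
by rewrite nth_default // scale0r.
Qed.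

Lemma iter_lfunP n c u v : iter n D (c *: u + v) = c *: iter n D u + iter n D v.
Proof. by elim: n => //= n ->; rewrite linearP. Qed.

Lemma poly_act_linear p c u v :
  poly_act p (c *: u + v) = c *: poly_act p u + poly_act p v.
Proof.
rewrite /poly_act scaler_sumr -big_split; apply: eq_bigr => i _ /=.
by rewrite iter_lfunP scalerDr !scalerA mulrC.
Qed.

Lemma poly_act0 p : poly_act p 0 = 0.
Proof.
by have := poly_act_linear p (-1) 0 0; rewrite scaler0 addr0 scaleN1r addNr.
Qed.

Lemma poly_actB p q v : poly_act (p - q) v = poly_act p v - poly_act q v.
Proof.
pose n := maxn (size p) (size q).
rewrite !(@poly_actE n) ?leq_maxl ?leq_maxr //; last first.
  by rewrite (leq_trans (size_polyD _ _)) // size_polyN.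
by rewrite -sumrB; apply: eq_bigr => i _; rewrite coefB scalerBl.
Qed.

Lemma poly_actC c v : poly_act c%:P v = c *: v.
Proof. by rewrite (@poly_actE 1) ?size_polyC_leq1 // big_ord1 coefC. Qed.

Lemma poly_actMX p v : poly_act (p * 'X) v = poly_act p (D v).
Proof.
rewrite (@poly_actE (size p).+1) ?(leq_trans (size_polyMleq _ _)) ?size_polyX ?addn2 //.
rewrite big_ord_recl coefMX scale0r add0r; apply: eq_bigr => i _.
by rewrite coefMX -iterSr.
Qed.

Lemma poly_act_comm p v : poly_act p (D v) = D (poly_act p v).
Proof.
by rewrite /poly_act linear_sum; apply: eq_bigr => i _; rewrite -iterSr linearZ.
Qed.

Lemma poly_actMXsubC p c v :
  poly_act (p * ('X - c%:P)) v = poly_act p (D v - c *: v).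
Proof.
have -> : D v - c *: v = (- c) *: v + D v by rewrite scaleNr addrC.
rewrite mulrBr poly_actB poly_actMX poly_act_linear addrC; congr (_ + _).
have -> : p * c%:P = c *: p by rewrite mulrC mul_polyC.
rewrite (@poly_actE (size p)) ?size_scale_leq // scaleNr; congr (- _).
by rewrite scaler_sumr; apply: eq_bigr => i _; rewrite coefZ scalerA.
Qed.

(** On a generalized eigenvector a polynomial acts by its residue modulo a power of the linear
    factor, so constant residues give scalars even where [D] is not diagonalizable. *)
Lemma poly_act_dvd p c m d v :
  iter m (fun w => D w - c *: w) v = 0 -> ('X - c%:P) ^+ m %| p - d%:P ->
  poly_act p v = d *: v.
Proof.
move=> Dv /dvdpP [r Dp]; apply/eqP; rewrite -subr_eq0 -poly_actC -poly_actB Dp.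
apply/eqP; elim: m r v Dv {Dp} => [|m IHm] r v Dv.
  by rewrite /= in Dv; rewrite Dv poly_act0.
by rewrite exprSr mulrA poly_actMXsubC IHm -?iterSr.
Qed.

Lemma poly_act_closed (P : V -> Prop) p v :
  lin_closed P -> (forall w, P w -> P (D w)) -> P v -> P (poly_act p v).
Proof.
move=> Pl PD Pv; apply: lin_closed_sum => // i _; apply: lin_closedZ => //.
by elim: (i : nat) => //= j; apply: PD.
Qed.

End PolyAction.

(** * Replicas and Cartan's criterion *)

Section Replica.
Variable k : closedFieldType.
Hypothesis char_k : [pchar k] =i pred0.

(** Left multiplication by [x - al%:M] and right multiplication by [x - be%:M] commute, and the
    iterated operator is their difference: each term of its power [i + j] contains i factors of the
    first kind or j of the second. *)
Lemma iter_commutator_shift n (x : 'M[k]_n.+1) al be i j (c : 'M_n.+1) :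
  (x - al%:M) ^+ i * c = 0 -> c * (x - be%:M) ^+ j = 0 ->
  iter (i + j) (fun w => (x * w - w * x) - (al - be) *: w) c = 0.
Proof.
have DT w : (x * w - w * x) - (al - be) *: w = (x - al%:M) * w - w * (x - be%:M).
  rewrite mulrBl mulrBr [al%:M * w]mul_scalar_mx [w * be%:M]mul_mx_scalar scalerBl.
  by rewrite !opprD !opprK addrACA.
pose T w := (x - al%:M) * w - w * (x - be%:M).
have -> : iter (i + j) (fun w => (x * w - w * x) - (al - be) *: w) c = iter (i + j) T c.
  by apply: eq_iter.
have TB1 u v : T (u - v) = T u - T v.
  rewrite /T (mulrBr (x - _)) (mulrBl _ u v) !opprB [RHS]addrACA [LHS]addrACA.
  by congr (_ + _); rewrite addrC.
have TB m u v : iter m T (u - v) = iter m T u - iter m T v.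
  by elim: m u v => //= m IHm u v; rewrite IHm TB1.
have T0 m : iter m T 0 = 0 by have := TB m 0 0; rewrite !subrr.
have [m Em] : exists m, (i + j)%N = m by exists (i + j)%N.
rewrite Em; elim: m i j Em c => [|m IHm] i j Em c ic jc.
  by move/eqP: Em; rewrite addn_eq0 => /andP [/eqP i0 _]; move: ic; rewrite i0 mul1r.
rewrite iterSr [T c]/T TB.
have -> : iter m T ((x - al%:M) * c) = 0.
  case: i => [|i] in Em ic *; last first.
    apply: (IHm i j); first by case: Em.
      by rewrite mulrA -exprSr.
    by rewrite -mulrA jc mulr0.
  by rewrite expr0 mul1r in ic; rewrite ic mulr0 T0.
have -> : iter m T (c * (x - be%:M)) = 0.
  case: j => [|j] in Em jc *; last first.
    apply: (IHm i j); first by rewrite addnS in Em; case: Em.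
      by rewrite mulrA ic mul0r.
    by rewrite -mulrA -exprS.
  by rewrite expr0 mulr1 in jc; rewrite jc mul0r T0.
by rewrite subr0.
Qed.


(* The replica of x attached to a Q-linear functional on its eigenvalues. *)
Lemma replica n (x : 'M[k]_n.+1) (lam : 'I_n.+1 -> k) (phi : 'I_n.+1 -> int) :
  char_poly x = \prod_i ('X - (lam i)%:P) ->
  (forall c : 'I_n.+1 -> int, \sum_i (c i)%:~R * lam i = 0 ->
      \sum_i c i * phi i = 0) ->
  exists q : {poly k}, (forall i, q.[lam i] = (phi i)%:~R) /\
    let D : 'End('M[k]_n.+1) := linfun (mulmx x) - linfun (mulmxr x) in
    exists Q : {poly k}, forall b,
      horner_mx x q * b - b * horner_mx x q = poly_act D (Q * 'X) b.
Proof.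
move=> Dx Hphi.
(* So [phi] depends only on the eigenvalue, and its differences only on the differences of
   eigenvalues. *)
have phi2 i j l m : lam i - lam j = lam l - lam m -> phi i - phi j = phi l - phi m.
  move=> E; pose d (i j : 'I_n.+1) : int := (i == j)%:Z.
  have S1 (R : nzRingType) (F : 'I_n.+1 -> R) i0 : \sum_i (d i i0)%:~R * F i = F i0.
    rewrite (bigD1 i0) //= big1 /d ?eqxx ?mul1r ?addr0 // => i1 /negPf ->.
    by rewrite mul0r.
  apply/eqP; rewrite -subr_eq0; apply/eqP.
  pose c i0 := d i0 i - d i0 j - (d i0 l - d i0 m).
  have SE (R : nzRingType) (F : 'I_n.+1 -> R) :
      \sum_i (c i)%:~R * F i = F i - F j - (F l - F m).
    rewrite -!(S1 R F) -!sumrB; apply: eq_bigr => i0 _.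
    by rewrite !rmorphB /= !mulrBl.
  rewrite -(SE _ phi) -[RHS](Hphi c); last by rewrite SE E subrr.
  by apply: eq_bigr => i0 _; rewrite intz.
pose s := undup [seq lam i | i : 'I_n.+1].
pose idx a := odflt ord0 [pick i | lam i == a].
have idxE i : lam (idx (lam i)) = lam i.
  by rewrite /idx; case: pickP => [j /eqP //|/(_ i)]; rewrite eqxx.
pose N := n.+1.
have [q Hq] := crt_powers (fun a => (phi (idx a))%:~R) N (undup_uniq [seq lam i | i : 'I_n.+1]).
have sl i : s`_i \in s -> lam (idx s`_i) = s`_i.
  by rewrite mem_undup => /imageP [j _ ->]; rewrite idxE.
have Hq0 := Hq; have {}Hq i : ('X - (lam i)%:P) ^+ N %| q - ((phi i)%:~R)%:P.
  have -> : phi i = phi (idx (lam i)).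
    by apply: (subIr (phi i)); apply: phi2; rewrite idxE.
  by apply: Hq; rewrite mem_undup; apply: image_f.
pose s2 := [seq lam p.1 - lam p.2 | p : 'I_n.+1 * 'I_n.+1].
pose idx2 a := odflt (ord0, ord0) [pick p : 'I_n.+1 * 'I_n.+1 | lam p.1 - lam p.2 == a].
(* The exponent is doubled because, on a block between two generalized eigenspaces, the commutator
   with [x] minus its eigenvalue is only known to be nilpotent of order [N + N]. *)
have [Q HQ] := crt_powers (fun a => (phi (idx2 a).1 - phi (idx2 a).2)%:~R)
   (N + N) (undup_uniq s2).
have {}HQ i j : ('X - (lam i - lam j)%:P) ^+ (N + N) %| Q - ((phi i - phi j)%:~R)%:P.
  have -> : phi i - phi j = phi (idx2 (lam i - lam j)).1 - phi (idx2 (lam i - lam j)).2.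
    apply: phi2; rewrite /idx2; case: pickP => [p /eqP //|/(_ (i, j))].
    by rewrite eqxx.
  by apply: HQ; rewrite mem_undup; apply/imageP; exists (i, j).
exists q; split.
  move=> i; apply/eqP; rewrite -subr_eq0 -[X in _ - X](hornerC _ (lam i)) -hornerN -hornerD.
  rewrite -/(root _ _) root_factor_theorem; apply: dvdp_trans (Hq i).
  by rewrite -[X in X %| _]expr1 dvdp_exp2l.
move=> D; have DE b : D b = x * b - b * x.
  by rewrite /D add_lfunE opp_lfunE !lfunE.
(* At the difference 0 of an eigenvalue with itself the residue is 0, so [Q] has no constant term:
   commutators with the replica are commutators with [x]. *)
have /dvdpP [Q' DQ'] : 'X %| Q.
  have := HQ ord0 ord0; rewrite !subrr subr0 polyC0 subr0; apply: dvdp_trans.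
  by rewrite -[X in X %| _]expr1 dvdp_exp2l.
exists Q' => b; rewrite -DQ'.
have char0 p : (forall a, a \in s -> ('X - a%:P) ^+ N %| p) -> horner_mx x p = 0.
  move=> Hp; have /dvdpP [r ->] : char_poly x %| p; last first.
    by rewrite rmorphM /= Cayley_Hamilton mulr0.
  apply: dvdp_trans (dvd_prod_powers (undup_uniq _) Hp).
  have -> : char_poly x = \prod_(a <- [seq lam i | i : 'I_n.+1]) ('X - a%:P).
    by rewrite Dx big_image.
  have := prod_XsubC_dvd_powers [seq lam i | i : 'I_n.+1].
  by rewrite size_image card_ord.
(* The matrices [horner_mx x (e i)] are the projections onto the generalized eigenspaces. *)
have [e He] := fin_all_exists (fun i : 'I_(size s) =>
  crt_powers (fun a => (a == s`_i)%:R) N (undup_uniq [seq lam i | i : 'I_n.+1])).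
have e1 : \sum_i horner_mx x (e i) = 1.
  apply/eqP; rewrite -subr_eq0 -rmorph_sum -(rmorph1 (horner_mx x)) -rmorphB.
  apply/eqP/char0 => a sa.
  have -> : \sum_i e i - 1 = \sum_i (e i - ((a == s`_i)%:R)%:P).
    rewrite sumrB; congr (_ - _); pose j := Ordinal (etrans (index_mem a s) sa).
    rewrite (bigD1 j) //= nth_index // eqxx big1 ?addr0 // => i ij.
    case: eqP => // E; case/eqP: ij; apply: val_inj; rewrite /= E index_uniq //.
    exact: undup_uniq.
  apply: (big_ind (fun p => ('X - a%:P) ^+ N %| p)) => [|p1 p2|i _].
  - exact: dvdp0.
  - exact: dvdp_add.
  - exact: He.
have ek (i : 'I_(size s)) : (x - (s`_i)%:M) ^+ N * horner_mx x (e i) = 0.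
  have <- : horner_mx x ('X - (s`_i)%:P) = x - (s`_i)%:M.
    by rewrite rmorphB /= horner_mx_X horner_mx_C.
  rewrite -rmorphXn -rmorphM; apply: char0 => a sa.
  case: (eqVneq a s`_i) => [->|ai]; first by rewrite dvdp_mulr.
  by rewrite dvdp_mull //; have := He i a sa; rewrite (negPf ai) polyC0 subr0.
have ekr (i : 'I_(size s)) : horner_mx x (e i) * (x - (s`_i)%:M) ^+ N = 0.
  rewrite -[RHS](ek i); apply: commrX; apply: commrB; last exact: comm_mx_scalar.
  exact/commr_sym/comm_mx_horner.
have qe (i : 'I_(size s)) : horner_mx x ((q - (phi (idx s`_i))%:~R%:P) * e i) = 0.
  apply: char0 => a sa.
  case: (eqVneq a s`_i) => [->|ai]; first by rewrite dvdp_mulr // Hq0 // mem_nth.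
  by rewrite dvdp_mull //; have := He i a sa; rewrite (negPf ai) polyC0 subr0.
have ykl (i : 'I_(size s)) :
    horner_mx x q * horner_mx x (e i) = (phi (idx s`_i))%:~R *: horner_mx x (e i).
  apply/eqP; rewrite -subr_eq0 -(qe i) rmorphM rmorphB /= horner_mx_C mulrBl.
  by rewrite [_%:M * _]mul_scalar_mx.
have ykr (i : 'I_(size s)) :
    horner_mx x (e i) * horner_mx x q = (phi (idx s`_i))%:~R *: horner_mx x (e i).
  by rewrite -ykl; apply: comm_horner_mx2.
have Z (i j : 'I_(size s)) : let c := horner_mx x (e i) * b * horner_mx x (e j) in
    horner_mx x q * c - c * horner_mx x q = poly_act D Q c.
  move=> c; set l := idx s`_i; set m := idx s`_j.
  have Dl : s`_i = lam l by rewrite sl // mem_nth.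
  have Dm : s`_j = lam m by rewrite sl // mem_nth.
  rewrite (@poly_act_dvd _ _ _ _ (lam l - lam m) (N + N) (phi l - phi m)%:~R); last 2 first.
  - rewrite -[RHS](@iter_commutator_shift _ x (lam l) (lam m) N N c).
    + by apply: eq_iter => w; rewrite DE.
    + by rewrite /c !mulrA -Dl ek !mul0r.
    by rewrite -Dm /c -!mulrA ekr !mulr0.
  - exact: HQ.
  rewrite rmorphB /= scalerBl; congr (_ - _).
    by rewrite /c !mulrA ykl -/l -!scalerAl.
  by rewrite /c -!mulrA ykr -/m -!scalerAr.
have -> : b = \sum_i \sum_j horner_mx x (e i) * b * horner_mx x (e j).
  rewrite -{1}(mul1r b) -{1}(mulr1 (1 * b)) -e1 !mulr_suml; apply: eq_bigr => i _.
  by rewrite mulr_sumr.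
have actD : {morph poly_act D Q : u v / u + v}.
  by move=> u v; rewrite -{1}(scale1r u) poly_act_linear scale1r.
rewrite (big_morph _ actD (poly_act0 _ _)) mulr_sumr mulr_suml -sumrB.
apply: eq_bigr => i _; rewrite (big_morph _ actD (poly_act0 _ _)).
by rewrite mulr_sumr mulr_suml -sumrB; apply: eq_bigr => j _; apply: Z.
Qed.

(** Cartan's criterion. For the replica y of [x] attached to phi, each [y, b i] lies in [x, L], so
    the trace of x y, which is the sum of the phi_i lam_i, vanishes. Applying phi to this relation
    makes the sum of the phi_i^2 zero, whereas phi is chosen nonzero at a supposed nonzero
    eigenvalue. *)
Theorem cartan_nilpotent n (x : 'M[k]_n.+1) (L : 'M[k]_n.+1 -> Prop)
    (I : Type) (r : seq I) (a b : I -> 'M[k]_n.+1) :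
  lin_closed L -> (forall l, L l -> L (x * l - l * x)) -> (forall i, L (b i)) ->
  x = \sum_(i <- r) (a i * b i - b i * a i) ->
  (forall i l, L l -> \tr (a i * (x * l - l * x)) = 0) -> x ^+ n.+1 = 0.
Proof.
move=> Ll LD Lb Dx trL; have [lam [Cx trx]] := eigenvalue_list x.
suff lam0 i : lam i = 0.
  have := Cayley_Hamilton x; rewrite Cx (eq_bigr (fun=> 'X)) => [|i _].
    by rewrite prodr_const card_ord rmorphXn /= horner_mx_X.
  by rewrite lam0 subr0.
apply/eqP; apply: contraT => lami.
have [phi [phii Hphi]] := integral_functional char_k lami.
have [q [Hq [Q HQ]]] := replica Cx Hphi.
set D := (linfun _ - _) in HQ; have DE l : D l = x * l - l * x.
  by rewrite /D add_lfunE opp_lfunE !lfunE.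
set y := horner_mx x q in HQ.
have tr0 : \tr (x * y) = 0.
  rewrite {1}Dx mulr_suml linear_sum big1 // => j _.
  have : \tr (a j * (y * b j - b j * y)) = 0.
    rewrite HQ poly_actMX poly_act_comm DE; apply: trL.
    by apply: poly_act_closed => // w Lw; rewrite DE; apply: LD.
  rewrite mulrBr mulrBl !raddfB /= => /eqP; rewrite subr_eq0 => /eqP E.
  apply/eqP; rewrite subr_eq0 -!mulrA -E; apply/eqP.
  transitivity (\tr ((a j *m y) *m b j)); first by rewrite -mulmxA.
  by rewrite mxtrace_mulC.
have : \sum_i (phi i)%:~R * lam i = 0.
  have xy : x * y = horner_mx x ('X * q) by rewrite rmorphM /= horner_mx_X.
  rewrite -[RHS]tr0 xy trx.
  have Hl l : ('X * q).[lam l] = (phi l)%:~R * lam l.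
    by rewrite hornerM hornerX Hq mulrC.
  by apply: eq_bigr => l _; rewrite Hl.
move/Hphi/eqP; rewrite Num.Theory.psumr_eq0 => [/allP /(_ i)|l _]; last first.
  by rewrite -expr2 Num.Theory.sqr_ge0.
by rewrite mem_index_enum mulf_eq0 orbb (negPf phii) => /(_ isT).
Qed.

End Replica.

(** * Nilpotency and traces of products *)

Section NilpotentTraces.
Variable k : closedFieldType.
Hypothesis char_k : [pchar k] =i pred0.
Variable n : nat.
Implicit Types A B C x : 'M[k]_n.+1.

Lemma nilpotent_eigenvalue N x (a : k) (v : 'rV_n.+1) :
  x ^+ N = 0 -> v *m x = a *: v -> v != 0 -> a = 0.
Proof.
move=> xN va v0; have : v *m (x ^+ N) = a ^+ N *: v.
  elim: N {xN} => [|N IHN]; first by rewrite mulmx1 scale1r.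
  by rewrite exprSr mulmxA IHN -scalemxAl va scalerA exprSr.
rewrite xN mulmx0 => /esym/eqP; rewrite scaler_eq0 (negPf v0) orbF.
by rewrite expf_eq0 => /andP [_ /eqP].
Qed.

Lemma eigenvalue_of_list x (lam : 'I_n.+1 -> k) i :
  char_poly x = \prod_i ('X - (lam i)%:P) ->
  exists2 v : 'rV_n.+1, v *m x = lam i *: v & v != 0.
Proof.
move=> Dx; have : eigenvalue x (lam i).
  rewrite eigenvalue_root_char Dx rootE horner_prod (bigD1 i) //=.
  by rewrite hornerXsubC subrr mul0r.
by case/eigenvalueP=> v; exists v.
Qed.

Lemma nilpotent_trace N x : x ^+ N = 0 -> \tr x = 0.
Proof.
move=> xN; have [lam [Dx trx]] := eigenvalue_list x.
rewrite -[x in \tr x](horner_mx_X x) trx big1 // => i _; rewrite hornerX.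
by have [v vx v0] := eigenvalue_of_list i Dx; exact: nilpotent_eigenvalue xN vx v0.
Qed.

(** A polynomial equal to 1 at one nonzero eigenvalue and to 0 at the others isolates in the trace
    this eigenvalue times its multiplicity, which is nonzero in characteristic 0. *)
Lemma nilpotent_of_traces x :
  (forall p, \tr (x * horner_mx x p) = 0) -> x ^+ n.+1 = 0.
Proof.
move=> trp; have [lam [Dx trx]] := eigenvalue_list x.
apply: nilpotent_of_eigenvalues => a v va v0; apply/eqP; apply: contraT => a0.
have [i Di] : exists i, lam i = a.
  have : eigenvalue x a by apply/eigenvalueP; exists v.
  rewrite eigenvalue_root_char Dx rootE horner_prod => /prodf_eq0 [i _].
  by rewrite hornerXsubC subr_eq0 => /eqP ->; exists i.
have [q Hq] := crt_powers (fun b => (b == a)%:R) 1 (undup_uniq [seq lam i | i : 'I_n.+1]).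
have {}Hq j : q.[lam j] = (lam j == a)%:R.
  have /Hq : lam j \in undup [seq lam i | i : 'I_n.+1].
    by rewrite mem_undup; apply: image_f.
  rewrite expr1 -root_factor_theorem rootE hornerD hornerN hornerC subr_eq0.
  by move/eqP.
have := trp q; have -> : x * horner_mx x q = horner_mx x ('X * q).
  by rewrite rmorphM /= horner_mx_X.
rewrite trx => /eqP; have E j : ('X * q).[lam j] = a *+ (lam j == a).
  by rewrite hornerM hornerX Hq; case: eqP => [->|_]; rewrite ?mulr1 ?mulr0.
rewrite (eq_bigr (fun j => a *+ (lam j == a))) => [|j _]; last exact: E.
rewrite sumrMnr -mulr_natr mulf_eq0 (negPf a0) /= => /negPn.
by rewrite natr_neq0 // (bigD1 i) //= Di eqxx.
Qed.

(* Jacobson's lemma, in trace form. *)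
Lemma trace_mul_nilpotent N A B (C := A * B - B * A) :
  A ^+ N = 0 -> A * C = C * A -> \tr (A * B) = 0.
Proof.
move=> AN AC.
have trC (D E : 'M[k]_n.+1) : \tr (D * E) = \tr (E * D).
  exact: mxtrace_mulC.
(* [A] commutes with [C], so [A, B] p(C) = [A, B p(C)] has trace zero. *)
have CN : C ^+ n.+1 = 0.
  apply: nilpotent_of_traces => p; set q := horner_mx C p.
  have Aq : A * q = q * A by apply: comm_mx_horner.
  rewrite {1}/C mulrBl linearB /= -[B * A * q]mulrA Aq mulrA [X in _ - X]trC.
  by rewrite mulrA subrr.
have comm i : B * A ^+ i.+1 = A ^+ i.+1 * B - (A ^+ i * C) *+ i.+1.
  elim: i => [|i IHi].
    by rewrite !expr1 expr0 mul1r mulr1n /C subKr.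
  have BA : B * A = A * B - C by rewrite /C subKr.
  have AiC : A ^+ i.+1 * C = A ^+ i * C * A by rewrite exprSr -mulrA AC mulrA.
  rewrite [in LHS]exprSr mulrA IHi mulrBl -(mulrA _ B A) BA mulrBr mulrA -exprSr.
  by rewrite mulrnAl -AiC -addrA -opprD -mulrS.
rewrite trC; apply: (@nilpotent_trace n.+1).
apply: nilpotent_of_eigenvalues => a v va v0.
have vN : v *m A ^+ N = 0 by rewrite AN mulmx0.
have [i vi vSi] : exists2 i, v *m A ^+ i != 0 & v *m A ^+ i.+1 = 0.
  elim: N vN {AN} => [|N IHN] vN; first by rewrite mulmx1 in vN; rewrite vN eqxx in v0.
  by case: (eqVneq (v *m A ^+ N) 0) => [/IHN //|nz]; exists N.
(* The formula [comm], applied to the eigenvector [v] of [B * A] with [v *m A ^+ i.+1 = 0], makes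
   the last nonzero [v *m A ^+ i] an eigenvector of the nilpotent [C]; the factor [i.+1] is the one
   in [comm]. *)
have E : (v *m A ^+ i) *m C = (- (i.+1%:R)^-1 * a) *: (v *m A ^+ i).
  have i0 := natr_neq0 char_k (ltn0Sn i).
  apply: (scalerI i0); rewrite scalerA mulrA mulrN mulfV // mulN1r.
  have : v *m (B * A ^+ i.+1) = a *: (v *m A ^+ i).
    by rewrite exprS mulrA mulmxA va -scalemxAl.
  rewrite comm mulmxBr [v *m (_ * B)]mulmxA vSi mul0mx sub0r scaleNr => <-.
  by rewrite opprK -[in RHS]scaler_nat -scalemxAr mulmxA.
have := nilpotent_eigenvalue CN E vi => /eqP.
by rewrite mulNr oppr_eq0 mulf_eq0 invr_eq0 (negPf (natr_neq0 char_k (ltn0Sn i))) => /eqP.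
Qed.

End NilpotentTraces.

(** * Jacobson-Morozov in a Lie algebra with complemented ideals *)

Section LieAlgebra.
Variable k : closedFieldType.
Hypothesis char_k : [pchar k] =i pred0.
Variables (L : vectType k) (ad : L -> 'End(L)).
Hypothesis ad_linear : forall c u v, ad (c *: u + v) = c *: ad u + ad v.
Hypothesis ad_anti : forall u v, ad u v = - ad v u.
Hypothesis ad_jacobi : forall u v w,
  ad u (ad v w) = ad (ad u v) w + ad v (ad u w).

Definition ideal (Z : {vspace L}) := forall u v, v \in Z -> ad u v \in Z.

Definition in_derived (u : L) :=
  exists s : seq (L * L), u = \sum_(p <- s) ad p.1 p.2.

Lemma ad0 : ad 0 = 0.
Proof. by have := ad_linear (-1) 0 0; rewrite scaler0 addr0 scaleN1r addNr. Qed.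

Lemma adD u v : ad (u + v) = ad u + ad v.
Proof. by rewrite -[u]scale1r ad_linear !scale1r. Qed.

Lemma adZ c u : ad (c *: u) = c *: ad u.
Proof. by rewrite -[c *: u]addr0 ad_linear ad0 addr0. Qed.

Lemma in_derived_closed : lin_closed in_derived.
Proof.
split; first by exists [::]; rewrite big_nil.
move=> c u v [s ->] [t ->]; exists ([seq (c *: p.1, p.2) | p <- s] ++ t).
rewrite big_cat big_map scaler_sumr; congr (_ + _); apply: eq_bigr => p _ /=.
by rewrite adZ scale_lfunE.
Qed.

(* The subspace [U] of [W] plays the role of the quotient W / U in the usual
   statement of Engel's theorem. *)
Lemma engel (K U W : {vspace L}) :
  (forall u v, u \in K -> v \in K -> ad u v \in K) ->
  (forall u, u \in K -> exists n, forall v, iter n (ad u) v = 0) ->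
  (forall u v, u \in K -> v \in U -> ad u v \in U) ->
  (forall u v, u \in K -> v \in W -> ad u v \in W) ->
  (U <= W)%VS -> ~~ (W <= U)%VS ->
  exists v, [/\ v \in W, v \notin U & forall u, u \in K -> ad u v \in U].
Proof.
move=> Kbr Knil.
pose P (M : {vspace L}) := forall U W : {vspace L},
  (forall u v, u \in M -> v \in U -> ad u v \in U) ->
  (forall u v, u \in M -> v \in W -> ad u v \in W) ->
  (U <= W)%VS -> ~~ (W <= U)%VS ->
  exists v, [/\ v \in W, v \notin U & forall u, u \in M -> ad u v \in U].
(* Subalgebras with the property [P] grow one dimension at a time: [P M], applied to [M] inside [K],
   yields an element outside [M] that normalizes it. *)
suff H j : (j <= \dim K)%N -> exists M : {vspace L}, [/\ (M <= K)%VS, \dim M = j,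
    forall u v, u \in M -> v \in M -> ad u v \in M & P M].
  have [M [MK dM _ PM]] := H _ (leqnn _).
  have <- : M = K by apply/eqP; rewrite eqEdim MK dM leqnn.
  exact: PM.
elim: j => [_|j IHj jK].
  exists 0%VS; split; rewrite ?sub0v ?dimv0 //.
    by move=> u v; rewrite !memv0 => /eqP -> /eqP ->; rewrite linear0.
  move=> {}U {}W _ _ _ /subvPn [v vW vU]; exists v; split=> // u.
  by rewrite memv0 => /eqP ->; rewrite ad0 lfunE mem0v.
have [M [MK dM Mbr PM]] := IHj (ltnW jK).
have [z [zK zM Mz]] : exists v, [/\ v \in K, v \notin M &
    forall u, u \in M -> ad u v \in M].
  apply: PM => // [u v /(subvP MK)|]; first exact: Kbr.
  by apply/negP => /dimvS; rewrite dM leqNgt jK.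
pose M' := (M + <[z]>)%VS.
have M'P u : u \in M' -> exists m c, m \in M /\ u = c *: z + m.
  by case/memv_addP=> m mM [_ /vlineP [c ->] ->]; exists m, c; rewrite addrC.
have zM' : z \in M' by apply: (subvP (addvSr _ _)); apply: memv_line.
have sMM' m : m \in M -> m \in M' by apply: (subvP (addvSl _ _)).
exists M'; split.
- by rewrite subv_add MK -memvE.
- rewrite dimv_disjoint_sum ?dM ?dim_vline.
    by rewrite (_ : z != 0) ?addn1 //; apply: contraNneq zM => ->; rewrite mem0v.
  apply/eqP; rewrite -subv0; apply/subvP=> w /memv_capP [wM /vlineP [c Dw]].
  rewrite memv0 Dw; case: (eqVneq c 0) => [->|c0]; first by rewrite scale0r.
  by case/negP: zM; rewrite -[z]scale1r -(mulVf c0) -scalerA -Dw memvZ.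
- move=> u v /M'P [m [c [mM ->]]] /M'P [m' [c' [mM' ->]]].
  rewrite ad_linear add_lfunE scale_lfunE !linearP /=.
  have -> : ad z z = 0.
    have /eqP := ad_anti z z; rewrite -addr_eq0 -mulr2n -scaler_nat scaler_eq0.
    by rewrite (negPf (natr_neq0 char_k _)) //= => /eqP.
  rewrite !scaler0 add0r; apply: memvD; first apply: memvZ.
    by rewrite ad_anti memvN sMM' ?Mz.
  by apply: sMM'; rewrite memvD ?memvZ ?Mz ?Mbr.
move=> {}U {}W M'U M'W UW WU.
(* As [z] normalizes [M], it preserves the vectors that [M] sends into [U]; the last iterate of [v0]
   outside [U] is then sent into [U] by [z] as well. *)
pose Q v := v \in W /\ forall u, u \in M -> ad u v \in U.
have [v0 [v0W v0U Mv0]] : exists v, [/\ v \in W, v \notin U &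
    forall u, u \in M -> ad u v \in U].
  by apply: PM => // u v uM; [apply: M'U | apply: M'W]; apply: sMM'.
have Qz v : Q v -> Q (ad z v).
  move=> [vW Mv]; split; first exact: M'W.
  move=> u uM; rewrite ad_jacobi memvD ?Mv ?Mz // M'U //; exact: Mv.
have [N zN] := Knil z zK.
have [i vi vSi] : exists2 i, iter i (ad z) v0 \notin U & iter i.+1 (ad z) v0 \in U.
  have : iter N (ad z) v0 \in U by rewrite zN mem0v.
  elim: N {zN} => [|N IHN] vN; first by rewrite /= in vN; rewrite vN in v0U.
  by case: (boolP (iter N (ad z) v0 \in U)) => [/IHN //|nz]; exists N.
have [viW Mvi] : Q (iter i (ad z) v0).
  by elim: (i) => //= l; apply: Qz.
exists (iter i (ad z) v0); split=> // u /M'P [m [c [mM ->]]].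
rewrite ad_linear add_lfunE scale_lfunE; apply: memvD; last exact: Mvi.
exact: memvZ.
Qed.

Section Killing.
Variables (n : nat) (e : n.+1.-tuple L).
Hypothesis e_basis : basis_of fullv e.

Let crd (v : L) : 'rV[k]_n.+1 := \row_j vector.coord e j v.
Let mx (T : 'End(L)) : 'M[k]_n.+1 := \matrix_(i, j) vector.coord e j (T e`_i).

Let crd_mx (T : 'End(L)) v : crd (T v) = crd v *m mx T.
Proof.
apply/rowP=> j; rewrite !mxE [in LHS](coord_basis e_basis (memvf v)) !linear_sum.
by apply: eq_bigr => i _; rewrite !mxE !linearZ.
Qed.

Let crd_inj v : crd v = 0 -> v = 0.
Proof.
move=> v0; rewrite (coord_basis e_basis (memvf v)) big1 // => i _.
by have /rowP/(_ i) := v0; rewrite !mxE => ->; rewrite scale0r.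
Qed.

(** Coordinates are row vectors, which reverses products; the sign restores a Lie algebra
    homomorphism. *)
Let A u := - mx (ad u).

Let A_linear c u v : A (c *: u + v) = c *: A u + A v.
Proof.
by apply/matrixP=> i j; rewrite !mxE ad_linear add_lfunE scale_lfunE linearP /= opprD mulrN.
Qed.

Let A_ad u v : A (ad u v) = A u * A v - A v * A u.
Proof.
have mxM (T S : 'End(L)) : mx T * mx S = mx (S \o T)%VF.
  apply/row_matrixP => i; rewrite row_mul.
  have rowE' (R : 'End(L)) : row i (mx R) = crd (R e`_i) by apply/rowP=> j; rewrite !mxE.
  by rewrite !rowE' -crd_mx comp_lfunE.
rewrite /A mulrNN mulrNN !mxM; apply/matrixP=> i j; rewrite !mxE !comp_lfunE.
by rewrite (ad_jacobi u v) linearD /= opprD addrCA subrr addr0.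
Qed.

Let A_iter u v N : crd (iter N (ad u) v) = (-1) ^+ N *: (crd v *m (A u) ^+ N).
Proof.
elim: N => [|N IHN]; first by rewrite mulmx1 scale1r.
have -> : A u ^+ N.+1 = A u ^+ N *m A u by rewrite exprSr.
rewrite iterS crd_mx IHN -scalemxAl mulmxA [A u in RHS]/A mulmxN exprSr.
by rewrite mulrN1 scaleNr scalerN opprK.
Qed.

Let A_nil u : (exists N, forall v, iter N (ad u) v = 0) <-> exists N, A u ^+ N = 0.
Proof.
split=> [[N uN]|[N uN]]; exists N.
  apply/row_matrixP => i; rewrite rowE row0.
  have E : crd e`_i = 'e_i.
    by apply/rowP=> j; rewrite !mxE coord_free ?(basis_free e_basis) // eq_sym.
  have := A_iter u e`_i N; rewrite uN E => /eqP.
  have -> : crd 0 = 0 by apply/rowP=> j; rewrite !mxE linear0.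
  by rewrite eq_sym scaler_eq0 signr_eq0 => /eqP.
by move=> v; apply: crd_inj; rewrite A_iter uN mulmx0 scaler0.
Qed.

Let kappa u v := \tr (A u * A v).

Let trC (D E : 'M[k]_n.+1) : \tr (D * E) = \tr (E * D).
Proof. exact: mxtrace_mulC. Qed.

Let kappaC u v : kappa u v = kappa v u.
Proof. exact: trC. Qed.

Let kappa_inv u v w : kappa (ad u v) w = kappa u (ad v w).
Proof.
rewrite /kappa !A_ad mulrBl mulrBr !linearB /=; congr (_ - _); first by rewrite mulrA.
by rewrite -mulrA trC mulrA.
Qed.

Let kappa_linear u c v w : kappa u (c *: v + w) = c * kappa u v + kappa u w.
Proof. by rewrite /kappa A_linear mulrDr -scalerAr linearP. Qed.

Let kappa0 u : kappa u 0 = 0.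
Proof.
have := kappa_linear u (-1) 0 0.
by rewrite scaler0 addr0 mulN1r addNr.
Qed.

Let kappa_invN u v w : kappa (ad u v) w = - kappa v (ad u w).
Proof.
rewrite ad_anti kappaC -scaleN1r -[_ *: _]addr0 kappa_linear kappa0 addr0 mulN1r.
by rewrite kappaC kappa_inv.
Qed.

Hypothesis complement : forall Z : {vspace L}, ideal Z ->
  exists W : {vspace L}, [/\ ideal W, (Z + W)%VS = fullv & (Z :&: W)%VS = 0%VS].

(** The derived elements orthogonal to everything form an ideal [R] of nilpotent elements, by
    Cartan's criterion; if [R] is nonzero, so is its centre [Z], by Engel's theorem. An ideal
    complementary to the abelian ideal [Z] contains all brackets, hence [Z] itself, which is
    absurd. *)
Let kappa_nondegenerate u :
  in_derived u -> (forall v, kappa u v = 0) -> u = 0.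
Proof.
have Pl : lin_closed (fun u => in_derived u /\ forall v, kappa u v = 0).
  apply: lin_closed_and; first exact: in_derived_closed.
  split=> [v|c {}u w ku kw v]; rewrite kappaC.
    by rewrite kappa0.
  by rewrite kappa_linear !(kappaC v) ku kw mulr0 addr0.
have [R RP] := vspace_of_pred Pl.
have Rideal : ideal R.
  move=> w v /RP [_ kv]; apply/RP; split; first by exists [:: (w, v)]; rewrite big_seq1.
  by move=> z; rewrite kappa_invN kv oppr0.
have Rnil v : v \in R -> exists N, forall w, iter N (ad v) w = 0.
  case/RP=> [[s Dv] kv]; apply/A_nil; exists n.+1.
  apply: (@cartan_nilpotent k char_k n (A v) (fun M => exists w, M = A w) _ s
      (fun p => A p.1) (fun p => A p.2)).
  - split; first by exists 0; apply/matrixP=> i j; rewrite !mxE ad0 lfunE linear0 oppr0.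
    by move=> c M N [w ->] [z ->]; exists (c *: w + z); rewrite A_linear.
  - by move=> _ [w ->]; exists (ad v w); rewrite A_ad.
  - by move=> p; exists p.2.
  - rewrite Dv; elim/big_rec2: _ => [|p M w _ IH].
      by apply/matrixP=> i j; rewrite !mxE ad0 lfunE linear0 oppr0.
    by rewrite -[ad p.1 p.2]scale1r A_linear scale1r A_ad IH.
  move=> p _ [w ->]; rewrite -A_ad -/(kappa _ _) kappaC kappa_inv; exact: kv.
move=> Du ku; apply/eqP; apply: contraT => u0.
have uR : u \in R by apply/RP.
have [||||||v [vR v0 Rv]] := @engel R 0%VS R.
- by move=> x y xR yR; apply: Rideal.
- exact: Rnil.
- by move=> x y _; rewrite !memv0 => /eqP ->; rewrite linear0.
- by move=> x y _; apply: Rideal.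
- exact: sub0v.
- by apply: contra u0 => /subvP/(_ _ uR); rewrite memv0.
have Zl : lin_closed (fun z => z \in R /\ forall x, x \in R -> ad x z = 0).
  apply: lin_closed_and; first exact: lin_closed_vspace.
  split=> [x _|c x y Hx Hy z zR]; first by rewrite linear0.
  by rewrite linearP /= Hx // Hy // scaler0 addr0.
have [Z ZP] := vspace_of_pred Zl.
have Zid : ideal Z.
  move=> x z /ZP [zR Rz]; apply/ZP; split; first exact: Rideal.
  move=> y yR; rewrite ad_jacobi (Rz y) // linear0 addr0 Rz //.
  by rewrite ad_anti memvN; apply: Rideal.
have [W [Wid ZW ZW0]] := complement Zid.
have DW x y : ad x y \in W.
  have /memv_addP [z zZ [w wW ->]] : x \in (Z + W)%VS by rewrite ZW memvf.
  have /memv_addP [z' z'Z [w' w'W ->]] : y \in (Z + W)%VS by rewrite ZW memvf.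
  have ZW0' a b : a \in Z -> b \in W -> ad a b = 0.
    move=> aZ bW; apply/eqP; rewrite -memv0 -ZW0 memv_cap Wid // andbT.
    by rewrite ad_anti memvN Zid.
  rewrite adD add_lfunE !linearD /=.
  have /ZP [zR Rz] := zZ; have /ZP [_ Rz'] := z'Z.
  rewrite Rz' // ZW0' // (ad_anti w z') ZW0' // oppr0 !add0r.
  exact: Wid.
have vZ : v \in Z.
  by apply/ZP; split=> // x xR; apply/eqP; rewrite -memv0; apply: Rv.
case/negP: v0; rewrite -ZW0 memv_cap vZ /=.
have /RP [[s ->] _] := vR.
by apply: memv_suml.
Qed.

(** The image of the square of ad f is the set [J] of derived elements orthogonal to its kernel: one
    inclusion is the invariance of the form, and nondegeneracy bounds the dimension of [J] by the
    rank. Jacobson's lemma puts [f] in [J]. *)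
Lemma ad_square_surj f : in_derived f -> (exists N, forall v, iter N (ad f) v = 0) ->
  exists z, ad f (ad f z) = f.
Proof.
move=> Df /A_nil [N fN].
pose F2 := (ad f \o ad f)%VF.
have F2E v : F2 v = ad f (ad f v) by rewrite comp_lfunE.
have kf z : F2 z = 0 -> kappa f z = 0.
  rewrite F2E => fz; apply: (@trace_mul_nilpotent k char_k n N) => //.
  rewrite -A_ad; apply/eqP; rewrite -subr_eq0 -A_ad fz.
  by apply/eqP/matrixP=> i j; rewrite !mxE ad0 lfunE linear0 oppr0.
have Jl : lin_closed (fun d => in_derived d /\ forall z, F2 z = 0 -> kappa d z = 0).
  apply: lin_closed_and; first exact: in_derived_closed.
  split=> [z _|c d d' kd kd' z Fz]; rewrite kappaC.
    by rewrite kappa0.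
  by rewrite kappa_linear !(kappaC z) kd // kd' // mulr0 addr0.
have [J JP] := vspace_of_pred Jl.
have IJ : (limg F2 <= J)%VS.
  apply/subvP=> w /memv_imgP [v _ ->]; apply/JP; split.
    by exists [:: (f, ad f v)]; rewrite big_seq1 F2E.
  by move=> z Fz; rewrite F2E !kappa_invN opprK -F2E Fz kappa0.
pose C := ((lker F2)^C)%VS; pose b := vbasis C.
pose Phi d : 'rV[k]_(\dim C) := \row_j kappa (b`_j) d.
have Phi_linear : linear Phi.
  by move=> c u v; apply/rowP=> j; rewrite !mxE kappa_linear.
pose Phi_lin := GRing.isLinear.Build k L 'rV[k]_(\dim C) _ Phi Phi_linear.
pose PhiL : {linear L -> 'rV[k]_(\dim C)} := HB.pack Phi Phi_lin.
have Jker : (J :&: lker (linfun PhiL) = 0)%VS.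
  apply/eqP; rewrite -subv0; apply/subvP=> d; rewrite memv_cap memv_ker lfunE /=.
  case/andP=> /JP [Dd kd] /eqP Pd; rewrite memv0; apply/eqP.
  apply: kappa_nondegenerate => // v.
  have /memv_addP [z zK [c cC ->]] : v \in (lker F2 + C)%VS.
    by rewrite addv_complf memvf.
  rewrite -[z]scale1r kappa_linear kd ?mulr0 ?add0r; last first.
    by apply/eqP; rewrite -memv_ker.
  rewrite (coord_vbasis cC); elim/big_rec: _ => [|i w _ IH]; first exact: kappa0.
  rewrite kappa_linear IH addr0; have /rowP/(_ i) := Pd.
  by rewrite !mxE kappaC => ->; rewrite mulr0.
have dJ : (\dim J <= \dim (limg F2))%N.
  rewrite -(limg_dim_eq Jker); apply: leq_trans (dimvS (subvf _)) _.
  rewrite dimvf /dim /= mul1n.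
  have := limg_ker_dim F2 fullv; rewrite capfv dimv_compl => <-.
  by rewrite addKn.
have fJ : f \in J by apply/JP; split.
have : f \in limg F2.
  by have /eqP -> : limg F2 == J by rewrite eqEdim IJ.
by case/memv_imgP=> z _ Ez; exists z; rewrite -F2E -Ez.
Qed.

End Killing.

Theorem jacobson_morozov_square f :
  (forall Z : {vspace L}, ideal Z ->
     exists W : {vspace L}, [/\ ideal W, (Z + W)%VS = fullv & (Z :&: W)%VS = 0%VS]) ->
  in_derived f -> (exists N, forall v, iter N (ad f) v = 0) ->
  exists z, ad f (ad f z) = f.
Proof.
move=> complement; case Dn: (\dim {:L}) => [|n].
  move=> _ _; exists 0; have : f \in fullv by apply: memvf.
  have /eqP -> : (fullv : {vspace L}) == 0%VS by rewrite -dimv_eq0 Dn.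
  by rewrite memv0 => /eqP ->; rewrite !linear0.
pose e := tcast Dn (vbasis {:L}).
have eB : basis_of fullv e by rewrite val_tcast vbasisP.
exact: (ad_square_surj eB complement).
Qed.

End LieAlgebra.

(** * Lowest weight vectors *)

Section Weights.
Variable k : closedFieldType.
Hypothesis char_k : [pchar k] =i pred0.

Lemma natr_eq_nat (m n : nat) : (m%:R == n%:R :> k) = (m == n).
Proof.
wlog le_mn: m n / (m <= n)%N => [W|].
  by case/orP: (leq_total m n) => /W // E; rewrite eq_sym E eq_sym.
rewrite eq_sym -subr_eq0 -natrB // (iffLR (pcharf0P k) char_k) subn_eq0.
by rewrite eqn_leq le_mn.
Qed.

Variable V : vectType k.

(** The powers of [N] are eigenvectors of the commutator with [H], for the distinct eigenvalues i c;
    finite dimension leaves room for finitely many nonzero ones. *)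
Lemma weight_nilpotent (H N : 'End(V)) (c : k) :
  c != 0 -> (forall v, H (N v) = N (H v) + c *: N v) ->
  exists n, forall v, iter n N v = 0.
Proof.
move=> c0 HN; pose p i : 'End(V) := iter i (comp_lfun N) \1%VF.
have pE i v : p i v = iter i N v.
  by elim: i => [|i IHi] /=; rewrite ?id_lfunE // comp_lfunE IHi.
have HNi i v : H (iter i N v) - iter i N (H v) = (i%:R * c) *: iter i N v.
  elim: i => [|i IHi] /=; first by rewrite subrr mul0r scale0r.
  rewrite HN addrAC -linearB /= IHi linearZ /= -scalerDl -{2}(mul1r c) -mulrDl.
  by rewrite natr1.
pose D (T : 'End(V)) := (H \o T)%VF - (T \o H)%VF.
have D_linear : linear D.
  move=> a T S; apply/lfunP=> v.
  rewrite /D !add_lfunE !opp_lfunE scale_lfunE !comp_lfunE !add_lfunE !opp_lfunE.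
  rewrite !scale_lfunE !comp_lfunE linearD linearZ /= scalerBr opprD.
  by rewrite addrACA.
pose Dl : {linear 'End(V) -> 'End(V)} :=
  HB.pack D (GRing.isLinear.Build k 'End(V) 'End(V) _ D D_linear).
have DpE i : linfun Dl (p i) = (i%:R * c) *: p i.
  rewrite lfunE /=; apply/lfunP=> v; rewrite /D add_lfunE opp_lfunE !comp_lfunE.
  by rewrite scale_lfunE !pE HNi.
pose d := \dim {:'End(V)}; pose X := [tuple p i | i < d.+1].
have nX : ~~ free X.
  apply/negP; rewrite /free size_tuple => /eqP E.
  by have := dimvS (subvf <<X>>); rewrite E ltnn.
have [a aX [j aj]] : exists2 a : 'I_d.+1 -> k,
    \sum_i a i *: X`_i = 0 & exists j, a j != 0.
  apply: NNPP => Na; case/negP: nX; apply/freeP => a aX i.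
  by apply/eqP; apply: contraT => ai; case: Na; exists a => //; exists i.
pose b i := a (inord i).
have : b j *: p j = 0.
  apply: (@lin_closed_components _ _ (linfun Dl) (fun w => w = 0)
    (fun i => i%:R * c) d.+1 (fun i => b i *: p i)) => //.
  - by split=> // e u v -> ->; rewrite scaler0 addr0.
  - by move=> w ->; rewrite linear0.
  - by move=> i l /(mulIf c0)/eqP; rewrite natr_eq_nat => /eqP.
  - by move=> i; rewrite linearZ [X in _ *: X = _]DpE !scalerA mulrC.
  rewrite -[RHS]aX; apply: eq_bigr => i _.
  by rewrite /b inord_val (nth_map ord0) ?size_enum_ord // nth_ord_enum.
rewrite /b inord_val => /eqP; rewrite scaler_eq0 (negPf aj) /= => /eqP pj.
by exists j => v; rewrite -pE pj zero_lfunE.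
Qed.

End Weights.

Section LoweringOperator.
Variable k : closedFieldType.
Hypothesis char_k : [pchar k] =i pred0.
Variables (V : vectType k) (U : {vspace V}) (Z H F : 'End(V)) (N : nat).
Hypothesis ZU : forall v, v \in U -> Z v \in U.
Hypothesis HU : forall v, v \in U -> H v \in U.
Hypothesis FU : forall v, v \in U -> F v \in U.
Hypothesis HF : forall v, v \in U -> H (F v) = F (H v) - 2%:R *: F v.
Hypothesis ZF : forall v, v \in U -> Z (F v) = F (Z v) + H v.
Hypothesis FN : forall v, v \in U -> iter N F v = 0.

(** In a representation of sl_2 this is the span of the lowest weight vectors of weight at most -j;
    stated through images of [F], it does not involve [H]. Until [Raising], [Z] is tied to the other
    operators by [Z, F] = H alone, since [morozov] uses these lemmas before a raising operator is
    known. *)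
Definition low j w := [/\ w \in U, F w = 0 & exists2 v, v \in U & w = iter j F v].

Lemma low_closed j : lin_closed (low j).
Proof.
split; first by split; rewrite ?mem0v ?linear0 //; exists 0; rewrite ?mem0v //;
  elim: j => //= j <-; rewrite linear0.
move=> c u v [uU Fu [u' u'U Du]] [vU Fv [v' v'U Dv]]; split.
- by rewrite memvD ?memvZ.
- by rewrite linearP /= Fu Fv scaler0 addr0.
by exists (c *: u' + v'); rewrite ?memvD ?memvZ // iter_lfunP Du Dv.
Qed.

Lemma low0 w : w \in U -> F w = 0 -> low 0 w.
Proof. by move=> wU Fw; split=> //; exists w. Qed.

Lemma iterFU j v : v \in U -> iter j F v \in U.
Proof. by move=> vU; elim: j => //= j; apply: FU. Qed.

Lemma low_le i j w : (i <= j)%N -> low j w -> low i w.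
Proof.
move=> ij [wU Fw [v vU Dw]]; split=> //; exists (iter (j - i) F v).
  exact: iterFU.
by rewrite -iterD subnKC.
Qed.

Lemma low_vanish j w : (N <= j)%N -> low j w -> w = 0.
Proof.
by move=> Nj [_ _ [v vU ->]]; rewrite -(subnKC Nj) iterD FN // iterFU.
Qed.

Lemma lower_iter m v : v \in U ->
  Z (iter m.+1 F v) =
  iter m.+1 F (Z v) + m.+1%:R *: (H (iter m F v) + m%:R *: iter m F v).
Proof.
move=> vU; elim: m => [|m IHm]; first by rewrite /= ZF // scale0r addr0 scale1r.
have vmU := iterFU m vU; have vmSU := iterFU m.+1 vU.
rewrite iterS ZF // IHm linearD linearZ linearD /= linearZ /= -addrA; congr (_ + _).
have -> : F (H (iter m F v)) = H (F (iter m F v)) + 2%:R *: F (iter m F v).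
  by rewrite HF // subrK.
set w := H (F _); set b := F (iter m F v).
rewrite !scalerDr !scalerA -[_ + _ *: b]addrA -scalerDl addrAC -[X in _ + X + _]scale1r.
rewrite -scalerDl natr1 -!natrM -natrD; congr (_ + _%:R *: _); lia.
Qed.

(** With w = F^j v, apply [Z] to F^(j+1) v = 0: the formula of [lower_iter] leaves (j+1)(H w + j w)
    = - F^(j+1) (Z v). *)
Lemma low_shift j w : low j w -> low j.+1 (H w + j%:R *: w).
Proof.
case=> wU Fw [v vU Dw].
have FHw : F (H w) = 0.
  by have := HF wU; rewrite Fw linear0 => /esym/eqP; rewrite scaler0 subr0 => /eqP.
split; first by rewrite memvD ?memvZ ?HU.
  by rewrite linearD linearZ /= FHw Fw scaler0 addr0.
exists (- (j.+1%:R)^-1 *: Z v); first by rewrite memvZ ?ZU.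
have := lower_iter j vU; rewrite -Dw iterS -Dw Fw linear0 => /eqP.
rewrite eq_sym addrC addr_eq0 => /eqP E.
have j0 := natr_neq0 char_k (ltn0Sn j).
apply: (scalerI j0); rewrite E -[_ *: Z v]addr0 iter_lfunP.
have -> : iter j.+1 F 0 = 0 by elim: (j.+1) => //= i ->; rewrite linear0.
by rewrite addr0 scalerA mulrN mulfV // scaleN1r.
Qed.

(** On an eigenvector [H + l] is the scalar [c + l], and [low_shift] gains one step whenever this is
    invertible. Going beyond the nilpotency order of [F], only the weights -l with j <= l survive in
    [low j]. *)
Lemma low_raise i j c u :
  low j u -> H u = c *: u -> (forall l, (j <= l < i)%N -> c != - l%:R) -> low i u.
Proof.
move=> lu Hu Hc; case: (leqP i j) => [ij|]; first exact: low_le lu.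
elim: i Hc => // i IHi Hc; rewrite ltnS => ji.
have {}IHi : low i u.
  move: ji; rewrite leq_eqVlt => /orP [/eqP <- //|ji]; apply: IHi => // l /andP [jl li].
  by apply: Hc; rewrite jl ltnW.
have := low_shift IHi; rewrite Hu -scalerDl.
have nz : c + i%:R != 0 by rewrite addr_eq0 Hc // ji ltnSn.
by move/(lin_closedZ (low_closed _) (c + i%:R)^-1); rewrite scalerA mulVf // scale1r.
Qed.

Lemma weight_low i u : u \in U -> F u = 0 -> H u = - i%:R *: u -> low i u.
Proof.
move=> uU Fu Hu; apply: (low_raise (low0 uU Fu) Hu) => l /andP [_ li].
by rewrite eqr_opp (natr_eq_nat char_k) gtn_eqF.
Qed.

Lemma low_weight_eq0 j c u :
  low j u -> H u = c *: u -> (forall l, (j <= l)%N -> c != - l%:R) -> u = 0.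
Proof.
move=> lu Hu Hc; apply: (low_vanish (leqnn N)); apply: (low_raise lu Hu).
by move=> l /andP [jl _]; apply: Hc.
Qed.

Definition weight_sequence (ws : nat -> V) :=
  forall i, low i (ws i) /\ H (ws i) = - i%:R *: ws i.

(** [H + m] sends [low m] into [low m.+1], where induction diagonalizes [H] with weights below -m
    and so inverts [H + m]. *)
Lemma low_decompose m w : low m w -> exists ws : nat -> V,
  [/\ weight_sequence ws, forall i, (i < m)%N -> ws i = 0 &
      w = \sum_(i < N) ws i].
Proof.
have [d dm] : exists d, (N <= m + d)%N by exists N; apply: leq_addl.
elim: d m w dm => [|d IHd] m w dm lw.
  rewrite addn0 in dm; exists (fun=> 0); split=> //.
    by move=> i; rewrite linear0 scaler0; split=> //; apply: lin_closed0 (low_closed i).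
  by rewrite big1 // (low_vanish dm lw).
case: (leqP N m) => [Nm|mN].
  by apply: (IHd _ _ _ lw); rewrite (leq_trans Nm) ?leq_addr.
have [|us [usP us0 Dus]] := IHd m.+1 _ _ (low_shift lw); first by rewrite addSnnS.
(* The inverse of [H + m] on weight -i. At [i = m] it takes the default value 0, which is harmless
   because [us m] is 0. *)
pose c i : k := (m%:R - i%:R)^-1.
pose w' := \sum_(i < N) c i *: us i.
have Hw' : H w' + m%:R *: w' = H w + m%:R *: w.
  rewrite Dus linear_sum scaler_sumr -big_split; apply: eq_bigr => i _ /=.
  case: (leqP i m) => im; first by rewrite us0 // !(linear0, scaler0) addr0.
  rewrite linearZ /= (usP i).2 !scalerA -scalerDl mulrC -mulrDl addrC mulfV ?scale1r //.
  by rewrite subr_eq0 (natr_eq_nat char_k) ltn_eqF.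
have lw' : low m w'.
  apply: (lin_closed_sum (low_closed m)) => i _; case: (leqP i m) => im.
    by rewrite us0 // scaler0; apply: lin_closed0 (low_closed m).
  apply: (lin_closedZ (low_closed m)); exact: low_le (ltnW im) (usP i).1.
exists (fun i => if i == m then w - w' else c i *: us i); split=> [i|i im|].
- case: eqP => [->|_].
    split; first by apply: (lin_closedB (low_closed m)).
    apply/eqP; rewrite scaleNr -addr_eq0; apply/eqP.
    by rewrite linearB scalerBr /= addrACA -opprD Hw' subrr.
  by rewrite linearZ /= (usP i).2 !scalerA mulrC; split=> //;
    apply: (lin_closedZ (low_closed i)); case: (usP i).
- by rewrite (ltn_eqF im) us0 ?scaler0 // ltnW.
rewrite (bigD1 (Ordinal mN)) //= eqxx.
rewrite (eq_bigr (fun i : 'I_N => c i *: us i)) => [|i /negPf]; last first.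
  by rewrite -val_eqE /= => ->.
rewrite /w' (bigD1 (Ordinal mN)) //= us0 // scaler0 add0r subrK //.
Qed.

Lemma ker_decompose u : u \in U -> F u = 0 ->
  exists2 ws : nat -> V, weight_sequence ws & u = \sum_(i < N) ws i.
Proof. by move=> uU /(low0 uU)/low_decompose [ws [? _ ?]]; exists ws. Qed.

Lemma ker_weight_surj c t : (forall i, c != - i%:R) ->
  t \in U -> F t = 0 -> exists2 u, low 0 u & H u - c *: u = t.
Proof.
move=> c_nat tU Ft; have [ws wsP ->] := ker_decompose tU Ft.
exists (\sum_(i < N) (- i%:R - c)^-1 *: ws i).
  apply: (lin_closed_sum (low_closed 0)) => i _.
  by apply: (lin_closedZ (low_closed 0)); apply: low_le (wsP i).1.
rewrite linear_sum scaler_sumr -sumrB; apply: eq_bigr => i _.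
rewrite linearZ /= (wsP i).2 !scalerA [_ * - _]mulrC -scalerBl -mulrBl mulfV ?scale1r //.
by rewrite subr_eq0 eq_sym c_nat.
Qed.

Lemma low_H j w : low j w -> low j (H w).
Proof.
move=> lw; rewrite -[H w](addrK (j%:R *: w)).
apply: (lin_closedB (low_closed j)); last exact: (lin_closedZ (low_closed j)).
exact: low_le (leqnSn j) (low_shift lw).
Qed.

Lemma low_component j i w r : (i < j)%N -> low j (w + r) -> low j r ->
  H w = - i%:R *: w -> w = 0.
Proof.
move=> ij lwr lr Hw; apply: (low_weight_eq0 (j := j) _ Hw) => [|l jl].
  by rewrite -(addrK r w); apply: (lin_closedB (low_closed j)).
by rewrite eqr_opp (natr_eq_nat char_k) ltn_eqF // (leq_trans ij).
Qed.

Section Raising.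
Hypothesis HZ : forall v, v \in U -> H (Z v) = Z (H v) + 2%:R *: Z v.

Lemma iterZU j v : v \in U -> iter j Z v \in U.
Proof. by move=> vU; elim: j => //= j; apply: ZU. Qed.

Lemma lower_raised i u a : u \in U -> F u = 0 -> H u = - i%:R *: u ->
  F (iter a.+1 Z u) = (a.+1%:R * (i%:R - a%:R)) *: iter a Z u.
Proof.
move=> uU Fu Hu.
have HZa b : H (iter b Z u) = (2%:R * b%:R - i%:R) *: iter b Z u.
  elim: b => [|b IHb]; first by rewrite /= Hu mulr0 sub0r.
  rewrite iterS HZ ?iterZU // IHb linearZ /= -scalerDl; congr (_ *: _).
  by rewrite -natr1; ring.
have FZ v : v \in U -> F (Z v) = Z (F v) - H v by move=> vU; rewrite ZF // addrK.
elim: a => [|a IHa].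
  by rewrite /= FZ // Fu linear0 sub0r Hu scaleNr opprK subr0 mul1r.
rewrite iterS FZ ?iterZU // IHa HZa linearZ /= -scalerBl; congr (_ *: _).
by rewrite -!natr1; ring.
Qed.

Lemma lower_raise_iter i u m : u \in U -> F u = 0 -> H u = - i%:R *: u ->
  (m <= i)%N -> exists2 c, c != 0 & iter m F (iter m Z u) = c *: u.
Proof.
move=> uU Fu Hu; elim: m => [|m IHm] mi.
  by exists 1; rewrite ?oner_eq0 // scale1r.
have [c c0 Dc] := IHm (ltnW mi).
exists (m.+1%:R * (i%:R - m%:R) * c).
  by rewrite !mulf_neq0 ?natr_neq0 // subr_eq0 natr_eq_nat // gtn_eqF.
rewrite iterSr (lower_raised _ uU Fu Hu).
rewrite -[X in iter m F X]addr0 iter_lfunP Dc.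
have -> : iter m F 0 = 0 by elim: (m) => //= l ->; rewrite linear0.
by rewrite addr0 scalerA.
Qed.

(* [U] is generated by lowest weight vectors. *)
Lemma intertwiner_eq0 (T : 'End(V)) :
  (forall v, v \in U -> T (Z v) = Z (T v)) ->
  (forall v, v \in U -> F v = 0 -> T v = 0) -> forall v, v \in U -> T v = 0.
Proof.
move=> TZ TK v vU; have := FN vU; elim: N v vU => [|m IHm] v vU Fv.
  by move: Fv => /= ->; rewrite linear0.
have lu : low m (iter m F v) by split; [exact: iterFU | | exists v].
have [ws [wsP ws0 Dw]] := low_decompose lu.
(* A lowest weight vector w of weight -i with m <= i is a nonzero multiple of F^m Z^m w, and [T]
   kills Z^m w. Subtracting such vectors from [v] makes F^m v vanish. *)
have Hc i : exists t, [/\ t \in U, T t = 0 & iter m F t = ws i].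
  have [[wU Fw _] Hw] := wsP i.
  case: (leqP m i) => mi; last first.
    by exists 0; rewrite mem0v linear0 ws0 //; split=> //;
      elim: (m) => //= l ->; rewrite linear0.
  have [c c0 Dc] := lower_raise_iter wU Fw Hw mi.
  exists (c^-1 *: iter m Z (ws i)); split; first by rewrite memvZ ?iterZU.
    have -> : T (c^-1 *: iter m Z (ws i)) = c^-1 *: iter m Z (T (ws i)).
      rewrite linearZ /=; congr (_ *: _); elim: (m) => //= l IHl.
      by rewrite TZ ?iterZU // IHl.
    by rewrite TK //; elim: (m) => [|l IHl]; rewrite /= ?scaler0 // -linearZ IHl linear0.
  rewrite -[X in iter m F X]addr0 iter_lfunP Dc.
  have -> : iter m F 0 = 0 by elim: (m) => //= l ->; rewrite linear0.
  by rewrite addr0 scalerA mulVf // scale1r.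
have [t Ht] := fin_all_exists (fun i : 'I_N => Hc i).
pose t' := \sum_i t i.
have t'U : t' \in U by apply: memv_suml => i _; case: (Ht i).
have Ft' : iter m F (v - t') = 0.
  have -> : v - t' = -1 *: t' + v by rewrite scaleN1r addrC.
  rewrite iter_lfunP Dw /t' scaleN1r.
  have iterS I (r : seq I) (G : I -> V) : iter m F (\sum_(i <- r) G i) = \sum_(i <- r) iter m F (G i).
    elim: (m) => //= l ->; exact: linear_sum.
  rewrite iterS addrC -sumrB big1 // => i _.
  by case: (Ht i) => _ _ ->; rewrite subrr.
have Tt' : T t' = 0 by rewrite linear_sum big1 // => i _; case: (Ht i).
by rewrite -(subrK t' v) linearD /= Tt' addr0 IHm // memvB.
Qed.

End Raising.

End LoweringOperator.

(** * Jordan bases and odd square roots of a lowering operator *)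

Section JordanBasis.
Variables (k : fieldType) (V : vectType k) (u : 'End(V)).
Implicit Types (U : {vspace V}) (c : seq (V * nat)).

Definition chains c := flatten [seq traject u p.1 p.2 | p <- c].

Definition chain_tails c : seq (V * nat) :=
  [seq (u p.1, p.2.-1) | p <- c & (1 < p.2)%N].

Lemma chains_cons p c : chains (p :: c) = traject u p.1 p.2 ++ chains c.
Proof. by []. Qed.

Lemma perm_chain_tails c : all (fun p => 0 < p.2)%N c ->
  perm_eq (chains c) (map fst c ++ chains (chain_tails c)).
Proof.
elim: c => //= -[v [|n]] c IHc //= /IHc Pc.
rewrite chains_cons /= perm_cons; case: n => [|n] /=; first by [].
have -> : chain_tails ((v, n.+2) :: c) = (u v, n.+1) :: chain_tails c by [].
rewrite chains_cons.
apply: (perm_trans (y := traject u (u v) n.+1 ++ (map fst c ++ chains (chain_tails c)))).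
  by rewrite -cat_cons perm_cat2l.
by rewrite perm_catCA.
Qed.

Lemma span_chain_tails c : all (fun p => iter p.2 u p.1 == 0) c ->
  <<map u (chains c)>>%VS = <<chains (chain_tails c)>>%VS.
Proof.
elim: c => //= -[v n] c IHc /= /andP [/eqP vn /IHc {}IHc].
rewrite chains_cons map_cat span_cat IHc /=.
have -> : map u (traject u v n) = traject u (u v) n.
  by elim: n v {vn} => //= n IHn v; rewrite IHn.
case: n vn => [|n] vn; first by rewrite span_nil add0v.
rewrite trajectSr -iterSr vn -cats1 span_cat span_seq1.
rewrite (_ : <[0]> = 0)%VS // addv0.
case: n {vn} => [|n]; first by rewrite span_nil add0v.
have -> : chain_tails ((v, n.+2) :: c) = (u v, n.+1) :: chain_tails c by [].
by rewrite chains_cons span_cat.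
Qed.

Lemma jordan_basis_tails U c :
  jordan_basis u U c -> jordan_basis u (u @: U) (chain_tails c).
Proof.
case=> [Hc /andP [/eqP Sc Fc]]; rewrite -/(chains c) in Sc Fc; split.
  move=> q /mapP [p]; rewrite mem_filter => /andP [p1 /Hc [p0 Ep] -> /=].
  by rewrite -iterSr prednK // -ltnS prednK.
have pos : all (fun p => 0 < p.2)%N c by apply/allP=> p /Hc [].
have nul : all (fun p => iter p.2 u p.1 == 0) c by apply/allP=> p /Hc [_ /eqP].
rewrite /basis_of -/(chains _) -span_chain_tails // -limg_span Sc eqxx /=.
by move: Fc; rewrite (perm_free (perm_chain_tails pos)); apply: catr_free.
Qed.

Lemma size_jordan_basis U c : jordan_basis u U c -> size c = \dim (U :&: lker u).
Proof.
move=> Jc; have [Hc Bc] := Jc; have [_ Bt] := jordan_basis_tails Jc.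
have pos : all (fun p => 0 < p.2)%N c by apply/allP=> p /Hc [].
have dB W X : basis_of W X -> \dim W = size X.
  by move=> B; rewrite -(span_basis B); apply/eqP; apply: basis_free B.
have := limg_ker_dim u U; rewrite (dB _ _ _ _ Bc) (dB _ _ _ _ Bt) -/(chains _) -/(chains c).
rewrite (perm_size (perm_chain_tails pos)) size_cat size_map.
by move/addIn.
Qed.

Definition imgs r U := iter r (lfun_img u) U.

Lemma memv_imgs r U w :
  reflect (exists2 v, v \in U & w = iter r u v) (w \in imgs r U).
Proof.
apply: (iffP idP).
  elim: r w => [|r IHr] w; first by exists w.
  by case/memv_imgP=> w' /IHr [v vU ->] ->; exists v.
by case=> v vU ->; elim: r => //= r; apply: memv_img.
Qed.

Lemma jordan_basis_iter U c r : jordan_basis u U c ->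
  exists2 cr, jordan_basis u (imgs r U) cr &
    forall P : pred nat, count (fun p => P p.2) cr =
      count (fun p => (r < p.2)%N && P (p.2 - r)%N) c.
Proof.
move=> Jc; have [Hc _] := Jc.
elim: r => [|r [cr Jr Cr]].
  exists c => // P; apply: eq_in_count => p /Hc [p0 _] /=.
  by rewrite p0 subn0.
exists (chain_tails cr); first exact: jordan_basis_tails.
move=> P; rewrite /chain_tails count_map count_filter /=.
have -> : count (predI (fun p : V * nat => P p.2.-1) (fun p => (1 < p.2)%N)) cr =
          count (fun p => P p.2.-1 && (1 < p.2)%N) cr by [].
rewrite (Cr (fun n => P n.-1 && (1 < n)%N)); apply: eq_count => p /=.
by rewrite subnS; case: (P _); rewrite ?andbF //= andbT; lia.
Qed.

(** The blocks of size above r are counted by the dimension of the kernel of [u] in the image of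
    u^r; none has size r + 1 exactly when two consecutive counts agree. *)
Lemma no_jordan_block U c r :
  (forall v, v \in U -> u v \in U) -> jordan_basis u U c ->
  (forall p, p \in c -> p.2 <> r.+1) <->
  (forall w, w \in imgs r U -> u w = 0 -> w \in imgs r.+1 U).
Proof.
move=> uU Jc; have [Hc _] := Jc.
have D j : \dim (imgs j U :&: lker u) = count (fun p => j < p.2)%N c.
  have [cj Jj Cj] := jordan_basis_iter j Jc.
  rewrite -(size_jordan_basis Jj) -(count_predT cj) (Cj xpredT).
  by apply: eq_count => p; rewrite andbT.
have sub : (imgs r.+1 U :&: lker u <= imgs r U :&: lker u)%VS.
  rewrite subv_cap capvSr andbT; apply: subv_trans (capvSl _ _) _.
  apply/subvP=> w /memv_imgs [v vU ->]; apply/memv_imgs; exists (u v); rewrite ?uU //.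
  by rewrite iterSr.
have cnt : count (fun p => r < p.2)%N c =
    (count (fun p => p.2 == r.+1) c + count (fun p => r.+1 < p.2)%N c)%N.
  rewrite -count_predUI -[LHS]addn0; congr (_ + _)%N.
    by apply: eq_count => p /=; lia.
  by apply/esym/eqP; rewrite -leqn0 leqNgt -has_count; apply/hasP => -[p _ /=]; lia.
split=> [no w wr uw|H p pc pr].
  have : (imgs r U :&: lker u <= imgs r.+1 U :&: lker u)%VS.
    rewrite -(geq_leqif (dimv_leqif_sup sub)) !D cnt.
    suff -> : count (fun p => p.2 == r.+1) c = 0%N by [].
    by apply/eqP; rewrite -leqn0 leqNgt -has_count; apply/hasP => -[p /no pr /eqP].
  move/subvP/(_ w); rewrite !memv_cap memv_ker uw eqxx wr => /(_ isT).
  by case/andP.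
have : (imgs r U :&: lker u <= imgs r.+1 U :&: lker u)%VS.
  apply/subvP=> w; rewrite !memv_cap memv_ker => /andP [wr /eqP uw].
  by rewrite H // uw eqxx.
move/dimvS; rewrite !D cnt -{2}[count _ c]add0n leq_add2r leqn0 => /eqP c0.
have : has (fun p => p.2 == r.+1) c by apply/hasP; exists p => //; apply/eqP.
by rewrite has_count c0.
Qed.

Lemma lift_chains U c : (forall p, p \in c -> p.1 \in (u @: U)%VS) ->
  exists c1, [seq (u p.1, p.2) | p <- c1] = c /\ forall p, p \in c1 -> p.1 \in U.
Proof.
elim: c => [|[v n] c IHc] Hc; first by exists [::].
have [|c1 [Dc Hc1]] := IHc; first by move=> p pc; apply: Hc; rewrite inE pc orbT.
have /memv_imgP [w wU /= Dv] := Hc (v, n) (mem_head _ _).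
exists ((w, n) :: c1); split; first by rewrite /= Dc -Dv.
by move=> p; rewrite inE => /orP [/eqP -> //|/Hc1].
Qed.

Lemma jordan_basis_exists U N :
  (forall v, v \in U -> u v \in U) -> (forall v, v \in U -> iter N u v = 0) ->
  exists c, jordan_basis u U c.
Proof.
have [d] := ubnP (\dim U); elim: d U => // d IHd U; rewrite ltnS => dU uU uN.
case: (eqVneq U 0%VS) => [->|U0].
  by exists [::]; split=> //; apply: nil_basis.
have sub : (u @: U <= U)%VS by apply/subvP=> _ /memv_imgP [v vU ->]; apply: uU.
have ltU : (\dim (u @: U) < \dim U)%N.
  rewrite ltnNge; apply/negP => le; case/negP: U0; rewrite -subv0.
  have E : (u @: U)%VS = U by apply/eqP; rewrite eqEdim sub.
  have <- : imgs N U = U by elim: (N) => //= j ->.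
  by apply/subvP=> w /memv_imgs [v /uN vN ->]; rewrite vN mem0v.
have [||c' J'] := IHd (u @: U)%VS (leq_trans ltU dU).
- by move=> v /(subvP sub) vU; apply: memv_img.
- by move=> v /(subvP sub)/uN.
have [Hc' B'] := J'.
have [|c1 [Dc' c1U]] := @lift_chains U c'.
  move=> [v n] pc; apply: (basis_mem B'); apply/flattenP.
  exists (traject u v n); first by apply/mapP; exists (v, n).
  by have [/= n0 _] := Hc' _ pc; case: n n0 {pc} => // n _; rewrite mem_head.
pose S' := chains c'; pose S1 := chains [seq (p.1, p.2.+1) | p <- c1].
(* Each chain of u(U) is lengthened by a preimage of its generator. The last vectors [E] are
   independent in the kernel, and blocks of size 1 complete them to a basis of it. *)
pose E := [seq iter p.2 u p.1 | p <- c1].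
have posc1 p : p \in c1 -> (0 < p.2)%N /\ iter p.2.+1 u p.1 = 0.
  move=> pc; have := Hc' (u p.1, p.2); rewrite -Dc' iterSr; apply.
  by apply/mapP; exists p.
have S1_perm : perm_eq S1 (map fst c1 ++ S').
  rewrite /S1 /S' -Dc'; elim: (c1) => //= p c2 IH2.
  rewrite !chains_cons /= perm_cons.
  apply: (perm_trans (y := traject u (u p.1) p.2 ++ (map fst c2 ++
            chains [seq (u p0.1, p0.2) | p0 <- c2]))).
    by rewrite perm_cat2l.
  by rewrite perm_catCA.
have S'_perm : perm_eq S' (E ++ chains [seq (u p.1, p.2.-1) | p <- c1]).
  rewrite /S' -Dc' /E; have : forall p, p \in c1 -> (0 < p.2)%N by move=> p /posc1 [].
  elim: (c1) => //= -[v n] c2 IH2 pos.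
  have n0 : (0 < n)%N by apply: (pos (v, n)); apply: mem_head.
  have {}IH2 := IH2 (fun p pc => pos p (mem_behead (s := (v, n) :: c2) pc)).
  case: n n0 {pos} => // n _; rewrite /= !chains_cons -/(traject u (u v) n.+1).
  rewrite trajectSr -iterSr -cats1 -catA.
  set x := [:: _]; set t := traject _ _ _.
  apply: (perm_trans (y := x ++ (t ++ chains [seq (u p.1, p.2) | p <- c2]))).
    by rewrite perm_catCA.
  rewrite /= perm_cons.
  apply: (perm_trans (y := t ++ ([seq iter p.2 u p.1 | p <- c2] ++
            chains [seq (u p.1, p.2.-1) | p <- c2]))); first by rewrite perm_cat2l.
  by rewrite perm_catCA.
have ES' : {subset E <= S'} by move=> w wE; rewrite (perm_mem S'_perm) mem_cat wE.
have Efree : free E.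
  have := basis_free B'; rewrite -/(chains c') -/S' (perm_free S'_perm).
  exact: catl_free.
pose K := (U :&: lker u)%VS; pose Zb := vbasis (K :\: <<E>>).
exists ([seq (p.1, p.2.+1) | p <- c1] ++ [seq (z, 1%N) | z <- Zb]).
have chZ : chains [seq (z, 1%N) | z <- Zb] = Zb.
  by elim: (tval Zb) => //= z s IH; rewrite chains_cons /= IH.
have EK : (<<E>> <= K)%VS.
  apply/span_subvP=> w /mapP [p pc ->]; rewrite memv_cap memv_ker.
  rewrite -[u _]/(iter p.2.+1 u p.1) (posc1 p pc).2 eqxx andbT.
  by elim: (p.2) => [|j]; [exact: c1U | exact: uU].
split.
  move=> q; rewrite mem_cat => /orP [] /mapP [p pc -> /=]; first by have [] := posc1 _ pc.
  have /vbasis_mem := pc; move/(subvP (diffvSl _ _)); rewrite memv_cap memv_ker.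
  by case/andP=> _ /eqP.
rewrite map_cat flatten_cat -/(chains _) -/(chains _) chZ -/S1 basisEdim.
have S'S1 : (<<S'>> <= <<S1>>)%VS.
  by apply: sub_span => w wS; rewrite (perm_mem S1_perm) mem_cat wS orbT.
apply/andP; split.
  apply/subvP=> v vU; rewrite span_cat.
  pose S2 := chains c1.
  have S'E : S' = map u S2.
    rewrite /S' -Dc' /S2; elim: (c1) => //= p c2 IH2.
    rewrite !chains_cons map_cat IH2; congr (_ ++ _).
    by elim: (p.2) (p.1) => //= n IHn w; rewrite IHn.
  have S2S1 : (<<S2>> <= <<S1>>)%VS.
    apply: sub_span => w /flatten_mapP [p pc wp]; apply/flatten_mapP.
    exists (p.1, p.2.+1); first by apply/mapP; exists p.
    by rewrite trajectSr mem_rcons inE wp orbT.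
  have : u v \in (u @: <<S2>>)%VS.
    by rewrite limg_span -S'E (span_basis B') memv_img.
  case/memv_imgP=> v' v'S Dv'.
  have v'S1 := subvP S2S1 _ v'S.
  have v'U : v' \in U.
    move: v'S; apply: subvP; apply/span_subvP=> w /flatten_mapP [p pc].
    by move/trajectP=> [j _ ->]; elim: j => [|j]; [exact: c1U | exact: uU].
  rewrite -(subrK v' v); apply: memvD; last by apply: (subvP (addvSl _ _)).
  have : v - v' \in (K :\: <<E>> + K :&: <<E>>)%VS.
    by rewrite addv_diff_cap memv_cap memvB // memv_ker linearB /= Dv' subrr.
  rewrite addvC; apply: subvP; apply: addvS.
    apply: subv_trans (capvSr _ _) (subv_trans _ S'S1); exact: sub_span.
  by rewrite (span_basis (vbasisP _)).
rewrite size_cat (perm_size S1_perm) size_cat size_map size_tuple.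
have dS' : size S' = \dim (u @: U) by rewrite -(span_basis B'); apply/esym/eqP; apply: basis_free B'.
have dE : \dim <<E>> = size c1 by rewrite (eqP Efree) size_map.
have := dimv_cap_compl K <<E>>; rewrite (capv_idPr EK) dE.
have := limg_ker_dim u U; rewrite -/K dS'; lia.
Qed.

End JordanBasis.

Section JordanTypes.
Variables (k : fieldType) (V : vectType k) (u : 'End(V)) (U : {vspace V}) (N : nat).
Hypothesis uU : forall v, v \in U -> u v \in U.
Hypothesis uN : forall v, v \in U -> iter N u v = 0.

(** The excluded sizes are the 2j + 2, that is r = 2j + 1 in [no_jordan_block]. *)
Lemma neat_operatorP : neat_operator u U <->
  forall j w, w \in imgs u j.*2.+1 U -> u w = 0 -> w \in imgs u j.*2.+2 U.
Proof.
split=> [[c Jc Hc] j|H].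
  apply/(no_jordan_block _ uU Jc) => p /Hc op Dp.
  by rewrite Dp /= odd_double in op.
have [c Jc] := jordan_basis_exists uU uN; exists c => // p pc.
have := (no_jordan_block p.2.-1 uU Jc).2; case: Jc => /(_ p pc) [p0 _] _.
apply: contraPT => ep /(_ _ p pc) []; last by rewrite prednK.
have -> : p.2.-1 = (p.2./2.-1).*2.+1 by lia.
exact: H.
Qed.

(** Size 1 is allowed, so the excluded sizes are the 2j + 3, that is r = 2j + 2. *)
Lemma balanced_operatorP : balanced_operator u U <->
  forall j w, w \in imgs u j.*2.+2 U -> u w = 0 -> w \in imgs u j.*2.+3 U.
Proof.
split=> [[c Jc Hc] j|H].
  apply/(no_jordan_block _ uU Jc) => p /Hc [] Dp Ep; first by rewrite Ep in Dp.
  by rewrite Ep /= odd_double in Dp.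
have [c Jc] := jordan_basis_exists uU uN; exists c => // p pc.
have := (no_jordan_block p.2.-1 uU Jc).2; case: Jc => /(_ p pc) [p0 _] _ no.
case: (eqVneq p.2 1%N) => [|p1]; [by left | right].
apply/negP => op; have Dp : p.2.-1 = (p.2./2.-1).*2.+2 by lia.
by case: (no _ p pc); [rewrite Dp; apply: H | rewrite prednK].
Qed.

End JordanTypes.

(** * An operator X with X^2 = F on U, decomposed by weights *)

Section OddSquareRoot.
Variable k : closedFieldType.
Hypothesis char_k : [pchar k] =i pred0.
Variables (V : vectType k) (U : {vspace V}) (Z H F X : 'End(V)) (N : nat).
Variables (n : nat) (Xs : nat -> 'End(V)).
Hypothesis ZU : forall v, v \in U -> Z v \in U.
Hypothesis HU : forall v, v \in U -> H v \in U.
Hypothesis FU : forall v, v \in U -> F v \in U.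
Hypothesis HF : forall v, v \in U -> H (F v) = F (H v) - 2%:R *: F v.
Hypothesis ZF : forall v, v \in U -> Z (F v) = F (Z v) + H v.
Hypothesis FN : forall v, v \in U -> iter N F v = 0.
Hypothesis XU : forall v, v \in U -> X v \in U.
Hypothesis XX : forall v, v \in U -> X (X v) = F v.
Hypothesis XsU : forall i v, v \in U -> Xs i v \in U.
Hypothesis XsF : forall i v, v \in U -> F (Xs i v) = Xs i (F v).
Hypothesis HXs : forall i v, v \in U -> H (Xs i v) = Xs i (H v) - i%:R *: Xs i v.
Hypothesis Xsum : forall v, v \in U -> X v = \sum_(i < n.+2) Xs i v.

Let low := low U F.
Let low_closed j : lin_closed (low j).
Proof. exact: low_closed. Qed.
Let low_le i j w : (i <= j)%N -> low j w -> low i w.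
Proof. exact: low_le. Qed.

Let iterXX j v : v \in U -> iter j.*2 X v = iter j F v.
Proof.
by move=> vU; elim: j => //= j ->; rewrite XX // iterFU.
Qed.

Let iterXU j v : v \in U -> iter j X v \in U.
Proof. by move=> vU; elim: j => //= j; apply: XU. Qed.

Let XF v : v \in U -> F (X v) = X (F v).
Proof. by move=> vU; rewrite -!XX ?XU. Qed.

Lemma Xs_low i l w : low i w -> H w = - i%:R *: w ->
  low (i + l) (Xs l w) /\ H (Xs l w) = - (i + l)%:R *: Xs l w.
Proof.
move=> [wU Fw _] Hw.
have HX : H (Xs l w) = - (i + l)%:R *: Xs l w.
  by rewrite HXs // Hw linearZ /= -scalerBl natrD opprD.
split=> //; apply: (weight_low char_k ZU HU FU HF ZF) => //; first exact: XsU.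
by rewrite XsF // Fw linear0.
Qed.

Lemma Xs_low_le j l w : low j w -> low (j + l) (Xs l w).
Proof.
move=> lw; have [ws [wsP ws0 ->]] := low_decompose char_k ZU HU FU HF ZF FN lw.
rewrite linear_sum; apply: (lin_closed_sum (low_closed _)) => i _.
have [lwi Hwi] := wsP i; have [lX _] := Xs_low l lwi Hwi.
case: (leqP j i) => ij; first by apply: low_le lX; rewrite leq_add2r.
by rewrite ws0 // linear0; apply: lin_closed0 (low_closed _).
Qed.

Lemma X_low_tail a j w : low j w -> low (j + a) (\sum_(i < n.+2 | (a <= i)%N) Xs i w).
Proof.
move=> lw; apply: (lin_closed_sum (low_closed _)) => i ai.
by apply: low_le (Xs_low_le i lw); rewrite leq_add2l.
Qed.

Let Xsum1 v : v \in U -> X v = Xs 0 v + \sum_(i < n.+2 | (1 <= i)%N) Xs i v.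
Proof.
move=> vU; rewrite Xsum // (bigD1 ord0) //=; congr (_ + _).
by apply: eq_bigl => i; rewrite -val_eqE /= lt0n.
Qed.

Let Xsum2 v : v \in U ->
  X v = Xs 0 v + (Xs 1 v + \sum_(i < n.+2 | (2 <= i)%N) Xs i v).
Proof.
move=> vU; rewrite Xsum1 //; congr (_ + _).
rewrite (bigD1 (Ordinal (isT : (1 < n.+2)%N))) //=; congr (_ + _).
by apply: eq_bigl => i; rewrite -val_eqE /=; lia.
Qed.

(** As X^2 = F on [U], images of even powers of [X] are read in the filtration by weights: here
    block sizes become weights. *)
Let img_lowP j w : low j w <-> w \in imgs X j.*2 U /\ F w = 0.
Proof.
split=> [[wU Fw [v vU Dw]]|[/memv_imgs [v vU Dw] Fw]].
  by split=> //; apply/memv_imgs; exists v; rewrite ?iterXX.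
rewrite iterXX // in Dw; split=> //; last by exists v.
by rewrite Dw iterFU.
Qed.

(** If w in Ker F has weight -i, then X w is in X^(2i+1) U and killed by [X]; without even blocks it
    is in [low i.+1], so its term X_0 w, of weight -i, vanishes. Conversely, if X_0 kills Ker F,
    then [X] maps [low j] into [low j.+1]. *)
Lemma neat_low : (forall j w, w \in imgs X j.*2.+1 U -> X w = 0 -> w \in imgs X j.*2.+2 U) <->
  (forall w, w \in U -> F w = 0 -> Xs 0 w = 0).
Proof.
split=> [neat w wU Fw|X0 j w /memv_imgs [v vU Dw] Xw].
  have [ws wsP ->] := ker_decompose char_k ZU HU FU HF ZF FN wU Fw.
  rewrite linear_sum big1 // => i _; have [lw Hw] := wsP i.
  move: (ws i) lw Hw => {w wU Fw} w lw Hw; have [lX HX] := Xs_low 0 lw Hw.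
  have [wU Fw _] := lw; have /img_lowP [/memv_imgs [v vU Dw] _] := lw.
  have lXw : low i.+1 (X w).
    apply/img_lowP; rewrite XF // Fw linear0; split=> //; apply: neat; last by rewrite XX.
    by apply/memv_imgs; exists v; rewrite // Dw.
  rewrite addn0 in HX; rewrite Xsum1 // in lXw.
  apply: (low_component char_k ZU HU FU HF ZF FN (ltnSn i) lXw _ HX).
  by have := X_low_tail 1 lw; rewrite addn1.
have lw : low j (iter j.*2 X v).
  apply/img_lowP; split; first by apply/memv_imgs; exists v.
  by rewrite -XX ?iterXU // -[X (iter _ _ _)]/(iter j.*2.+1 X v) -Dw.
have wl : low j.+1 w.
  rewrite Dw iterS Xsum1 ?iterXU // X0 ?iterXU //; last by case: lw.
  by rewrite add0r; have := X_low_tail 1 lw; rewrite addn1.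
by have /img_lowP [] := wl.
Qed.

(** Write w = X u and u = u_j + r, with u in [low j], u_j of weight -j and r in [low j.+1]. The
    component of weight -j of w forces X_0 u_j = 0; as X_(-1) kills Ker F, X u_j is in [low j.+2],
    hence in X^(2j+4) U, while X r is in X^(2j+3) U. *)
Lemma balanced_of_low :
  (forall w, w \in U -> F w = 0 -> Xs 1 w = 0) ->
  forall j w, w \in imgs X j.*2.+2 U -> X w = 0 -> w \in imgs X j.*2.+3 U.
Proof.
move=> X1 j w /memv_imgs [v vU Dw] Xw.
pose u := iter j.*2 X (X v); have Du : w = X u by rewrite Dw /u -iterSr.
have lu : low j u.
  apply/img_lowP; split; first by apply/memv_imgs; exists (X v); rewrite ?XU.
  by rewrite -XX ?iterXU ?XU // -Du.
have wl : low j.+1 w.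
  apply/img_lowP; split; last by rewrite -XX ?Xw ?linear0 // Dw iterXU.
  by apply/memv_imgs; exists v.
have [ws [wsP ws0 Dus]] := low_decompose char_k ZU HU FU HF ZF FN lu.
have [lwj Hwj] := wsP j; have wjU : ws j \in U by case: lwj.
have lr : low j.+1 (u - ws j).
  case: (leqP N j) => Nj.
    have u0 : u = 0 by apply: (low_vanish FU FN Nj).
    have w0 : ws j = 0 by apply: (low_vanish FU FN Nj).
    by rewrite u0 w0 subrr; apply: lin_closed0 (low_closed _).
  rewrite Dus (bigD1 (Ordinal Nj)) //= addrAC subrr add0r.
  apply: (lin_closed_sum (low_closed _)) => i ij.
  case: (ltngtP i j) => [ilj|jli|E]; last by case/eqP: ij; apply: val_inj.
    by rewrite ws0 //; apply: lin_closed0 (low_closed _).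
  exact: low_le jli (wsP i).1.
have lXr : low j.+1 (X (u - ws j)).
  have rU : u - ws j \in U by case: lr.
  rewrite Xsum //; apply: (lin_closed_sum (low_closed _)) => i _.
  by apply: low_le (Xs_low_le i lr); rewrite leq_addr.
have X0w : Xs 0 (ws j) = 0.
  have [_ HX] := Xs_low 0 lwj Hwj; rewrite addn0 in HX.
  apply: (low_component (r := \sum_(i < n.+2 | (1 <= i)%N) Xs i (ws j))
            char_k ZU HU FU HF ZF FN (ltnSn j) _ _ HX).
    rewrite -Xsum1 //; have -> : X (ws j) = w - X (u - ws j).
      by rewrite Du -linearB /= subKr.
    exact: (lin_closedB (low_closed _)).
  by have := X_low_tail 1 lwj; rewrite addn1.
have : low j.+2 (X (ws j)).
  rewrite Xsum2 // X0w X1 //; last by case: lwj.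
  by rewrite !add0r; have := X_low_tail 2 lwj; rewrite addn2.
case/img_lowP=> /memv_imgs [v1 v1U Dv1] _.
have /img_lowP [/memv_imgs [v2 v2U Dv2] _] := lr.
apply/memv_imgs; exists (X v1 + v2); first by rewrite memvD ?XU.
have iterD m a b : iter m X (a + b) = iter m X a + iter m X b.
  by elim: m => //= m ->; rewrite linearD.
by rewrite iterD -iterSr -Dv1 iterS -Dv2 -linearD /= addrC subrK.
Qed.

(** X w is in [low i.+1] and killed by [X], so the absence of blocks of size 2i + 3 gives X w = X t
    with t in [low i.+1]. The conclusion is the component of weight -(i+1) of this equation. *)
Lemma balanced_low_exact i w :
  (forall j w, w \in imgs X j.*2.+2 U -> X w = 0 -> w \in imgs X j.*2.+3 U) ->
  w \in U -> F w = 0 -> H w = - i%:R *: w -> Xs 0 w = 0 ->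
  exists t, [/\ t \in U, F t = 0, H t = - i.+1%:R *: t & Xs 1 w = Xs 0 t].
Proof.
move=> bal wU Fw Hw X0w.
have lw : low i w by apply: (weight_low char_k ZU HU FU HF ZF).
have lXw : low i.+1 (X w).
  by rewrite Xsum1 // X0w add0r; have := X_low_tail 1 lw; rewrite addn1.
have /img_lowP [Xwi _] := lXw.
have /memv_imgs [v vU Dv] : X w \in imgs X i.*2.+3 U by apply: bal; rewrite ?XX.
rewrite iterS in Dv; set t := iter i.*2.+2 X v in Dv.
have tU : t \in U by apply: iterXU.
have lt : low i.+1 t.
  apply/img_lowP; split; first by apply/memv_imgs; exists v.
  by rewrite -XX // -Dv XX.
have [ws [wsP ws0 Dt]] := low_decompose char_k ZU HU FU HF ZF FN lt.
have [lti Hti] := wsP i.+1; have [tiU Fti _] := lti.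
exists (ws i.+1); split=> //; apply/eqP; rewrite -subr_eq0; apply/eqP.
have [_ HX1] := Xs_low 1 lw Hw; have [_ HX0] := Xs_low 0 lti Hti.
apply: (low_component (j := i.+2) (i := i.+1) (r := 0) char_k ZU HU FU HF ZF FN) => //.
- rewrite addr0.
  have lr : low i.+2 (t - ws i.+1).
    case: (leqP N i.+1) => Ni.
      have u0 : t = 0 by apply: (low_vanish FU FN Ni).
      have w0 : ws i.+1 = 0 by apply: (low_vanish FU FN Ni).
      by rewrite u0 w0 subrr; apply: lin_closed0 (low_closed _).
    rewrite Dt (bigD1 (Ordinal Ni)) //= addrAC subrr add0r.
    apply: (lin_closed_sum (low_closed _)) => l lj.
    case: (ltngtP l i.+1) => [ilj|jli|E]; last by case/eqP: lj; apply: val_inj.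
      by rewrite ws0 //; apply: lin_closed0 (low_closed _).
    exact: low_le jli (wsP l).1.
  have E1 : X w = Xs 1 w + \sum_(i < n.+2 | (2 <= i)%N) Xs i w.
    by rewrite Xsum2 // X0w add0r.
  have E2 : X t = Xs 0 (ws i.+1) + (Xs 0 (t - ws i.+1) + \sum_(i < n.+2 | (1 <= i)%N) Xs i t).
    by rewrite Xsum1 // linearB /= addrA [Xs 0 (ws _) + _]addrCA subrr addr0.
  have -> : Xs 1 w - Xs 0 (ws i.+1) =
      (Xs 0 (t - ws i.+1) + \sum_(i < n.+2 | (1 <= i)%N) Xs i t) -
      \sum_(i < n.+2 | (2 <= i)%N) Xs i w.
    apply/eqP; rewrite subr_eq addrAC -subr_eq opprK -E1 addrC -E2.
    by rewrite Dv.
  apply: (lin_closedB (low_closed _)).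
    apply: (lin_closedD (low_closed _)).
      by have := Xs_low_le 0 lr; rewrite addn0.
    by have := X_low_tail 1 lt; rewrite addn1.
  by have := X_low_tail 2 lw; rewrite addn2.
- exact: lin_closed0 (low_closed _).
by rewrite linearB /= HX1 HX0 addn0 addn1 scalerBr.
Qed.

End OddSquareRoot.

(** * Complete reducibility over the even part *)

Section RegularFunctions.
Variables (k : closedFieldType) (G : affineGroup k).
Implicit Types f : G -> k.

Lemma regular_cst (c : k) : regular (fun _ : G => c).
Proof. by exists c%:MP => a; rewrite mevalC. Qed.

Lemma regularD f1 f2 : regular f1 -> regular f2 -> regular (fun a => f1 a + f2 a).
Proof. by case=> p Hp [q Hq]; exists (p + q) => a; rewrite mevalD Hp Hq. Qed.

Lemma regularM f1 f2 : regular f1 -> regular f2 -> regular (fun a => f1 a * f2 a).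
Proof. by case=> p Hp [q Hq]; exists (p * q) => a; rewrite mevalM Hp Hq. Qed.

Lemma regular_sum I (r : seq I) (F : I -> G -> k) :
  (forall i, regular (F i)) -> regular (fun a => \sum_(i <- r) F i a).
Proof.
move=> HF; elim: r => [|i r IHr].
  have -> : (fun a => \sum_(i <- [::]) F i a) = (fun _ : G => 0).
    by apply: functional_extensionality => a; rewrite big_nil.
  exact: regular_cst.
have -> : (fun a => \sum_(j <- i :: r) F j a) = (fun a => F i a + \sum_(j <- r) F j a).
  by apply: functional_extensionality => a; rewrite big_cons.
exact: regularD.
Qed.

Lemma regular_coord i : regular (fun a : G => coord a i).
Proof. by exists 'X_i => a; rewrite mevalXU. Qed.

Variable d : (G -> k) -> k.
Hypothesis d_der : point_derivation d.

Lemma der0 : d (fun=> 0) = 0.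
Proof.
have E := d_der.1 (-1) _ _ (regular_cst 0) (regular_cst 0).
have E0 : (fun _ : G => -1 * 0 + 0 : k) = fun=> 0.
  by apply: functional_extensionality => a; rewrite mulr0 addr0.
by rewrite E0 mulN1r addNr in E.
Qed.

Lemma derD f1 f2 : regular f1 -> regular f2 ->
  d (fun a => f1 a + f2 a) = d f1 + d f2.
Proof.
move=> r1 r2; rewrite -[d f1]mul1r -d_der.1 //; congr (d _).
by apply: functional_extensionality => a; rewrite mul1r.
Qed.

Lemma derZ c f : regular f -> d (fun a => c * f a) = c * d f.
Proof.
move=> rf; rewrite -[RHS]addr0 -[in RHS]der0 -d_der.1 //; last exact: regular_cst.
by congr (d _); apply: functional_extensionality => a; rewrite addr0.
Qed.

Lemma der_sum I (r : seq I) (F : I -> G -> k) :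
  (forall i, regular (F i)) ->
  d (fun a => \sum_(i <- r) F i a) = \sum_(i <- r) d (F i).
Proof.
move=> HF; elim: r => [|i r IHr].
  rewrite big_nil -[RHS]der0; congr (d _).
  by apply: functional_extensionality => a; rewrite big_nil.
rewrite big_cons -IHr -derD //; last exact: regular_sum.
by congr (d _); apply: functional_extensionality => a; rewrite big_cons.
Qed.

Lemma der_cst c : d (fun=> c) = 0.
Proof.
have r1 : regular (fun _ : G => 1 : k) by apply: regular_cst.
suff d1 : d (fun=> 1) = 0.
  have := derZ c r1; rewrite d1 mulr0 => <-; congr (d _).
  by apply: functional_extensionality => a; rewrite mulr1.
have E := d_der.2 _ _ r1 r1; rewrite /= in E.
have E0 : (fun _ : G => 1 * 1 : k) = fun=> 1.
  by apply: functional_extensionality => a; rewrite mulr1.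
rewrite E0 mul1r mulr1 in E; apply: (addrI (d (fun=> 1))).
by rewrite -E addr0.
Qed.

End RegularFunctions.

Section Eigenvectors.
Import passmx.
Variables (k : closedFieldType) (V : vectType k) (T : 'End(V)).

Lemma eigenvector_exists (W : {vspace V}) :
  (forall v, v \in W -> T v \in W) -> W != 0%VS ->
  exists2 v, v \in W & v != 0 /\ exists c, T v = c *: v.
Proof.
move=> TW W0; pose T' : 'End(subvs_of W) := (linfun (vsproj W) \o T \o linfun vsval)%VF.
have T'E w : vsval (T' w) = T (vsval w).
  by rewrite !comp_lfunE !lfunE /= vsprojK // TW // subvsP.
pose e := vbasis {:subvs_of W}; have eB : basis_of fullv e := vbasisP _.
have dW : \dim {:subvs_of W} = \dim W by rewrite dimvf.
have /closed_rootP [a] : size (char_poly (mxof e e T')) != 1%N.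
  by rewrite size_char_poly eqSS dW dimv_eq0.
rewrite -eigenvalue_root_char => /eigenvalueP [v va v0].
exists (vsval (vecof e v)); first exact: subvsP.
split; last by exists a; rewrite -T'E (hom_vecof e eB) va !linearZ.
by rewrite -[0](linear0 (@vsval _ _ W)) (inj_eq (@subvs_inj _ _ W)) (vecof_eq0 eB).
Qed.

End Eigenvectors.

Section Representations.
Variable k : closedFieldType.
Variable G : supergroup k.
Hypothesis G_qred : quasi_reductive G.
Local Notation g := (lie G).
Local Notation g0 := (part g false).
Local Notation br := (bracket g).

Section Module.
Variables (M : superModule g) (rho : even_group G -> 'End(M)).
Hypothesis rho_rat : rational_rep rho.
Hypothesis rho_diff : forall u, u \in g0 -> is_differential rho (tangent u) (act M u).
Hypothesis rho_act : forall a u m, rho a (act M u m) = act M (Ad a u) (rho a m).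

Lemma act_even_bracket u v b m : u \in g0 -> v \in part g b ->
  act M (br u v) m = act M u (act M v m) - act M v (act M u m).
Proof. by move=> ug vg; rewrite (act_bracket m ug vg) expr0 scale1r. Qed.

Definition even_stable (U : {vspace M}) :=
  forall u m, u \in g0 -> m \in U -> act M u m \in U.

(** A functional vanishing on [U] gives matrix coefficients that are identically zero, hence have
    zero derivative. *)
Lemma group_stable_even_stable U : (forall a, (rho a @: U <= U)%VS) -> even_stable U.
Proof.
move=> GU u m ug mU; apply: contraT => /memv_separate [phi [phiU []]].
rewrite (rho_diff ug) -[RHS](der0 (tangent_derivation ug)); congr (tangent u _).
by apply: functional_extensionality => a; apply/phiU/(subvP (GU a))/memv_img.
Qed.

Lemma rho_inv a m : rho a (rho a^-1%g m) = m.
Proof. by case: rho_rat => r1 rM _; rewrite -comp_lfunE -rM mulgV r1 id_lfunE. Qed.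

Lemma Ad_inv (a : even_group G) u : Ad a (Ad a^-1%g u) = u.
Proof. by case: (Ad_rational G) => r1 rM _; rewrite -comp_lfunE -rM mulgV r1 id_lfunE. Qed.

Definition minimal_stable (X : {vspace M}) := [/\ even_stable X, X <> 0%VS &
  forall Y, even_stable Y -> (Y <= X)%VS -> Y = 0%VS \/ Y = X].

Lemma minimal_stable_exists W : even_stable W -> W <> 0%VS ->
  exists2 X, minimal_stable X & (X <= W)%VS.
Proof.
have [d] := ubnP (\dim W); elim: d W => // d IHd W; rewrite ltnS => dW sW W0.
case: (classic (minimal_stable W)) => [mW|nW]; first by exists W.
have [Y [sY YW Y0 YnW]] : exists Y, [/\ even_stable Y, (Y <= W)%VS, Y <> 0%VS & Y <> W].
  apply: NNPP => NY; apply: nW; split=> // Y sY YW.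
  apply: NNPP => /not_or_and [Y0 YnW]; apply: NY.
  by exists Y; split.
have [|X mX XY] := IHd Y _ sY Y0.
  apply: leq_trans dW; rewrite ltn_neqAle dimvS // andbT.
  by apply/eqP => E; apply: YnW; apply/eqP; rewrite eqEdim YW E leqnn.
by exists X => //; apply: subv_trans YW.
Qed.

Lemma rho_even_stable a U : even_stable U -> even_stable (rho a @: U).
Proof.
move=> sU u _ ug /memv_imgP [m mU ->].
rewrite -(Ad_inv a u) -rho_act memv_img // sU //; exact: Ad_parity.
Qed.

Lemma rho_minimal_stable a X : minimal_stable X -> minimal_stable (rho a @: X).
Proof.
have rK U b : (rho b @: (rho b^-1%g @: U))%VS = U.
  rewrite -limg_comp (_ : (rho b \o rho b^-1%g)%VF = \1%VF) ?lim1g //.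
  by apply/lfunP=> m; rewrite comp_lfunE rho_inv id_lfunE.
have rVK U b : (rho b^-1%g @: (rho b @: U))%VS = U.
  by have := rK U b^-1%g; rewrite invgK.
move=> [sX X0 mX]; split; first exact: rho_even_stable.
  by move=> E; apply: X0; rewrite -(rVK X a) E limg0.
move=> Y sY YX; case: (mX (rho a^-1%g @: Y)%VS).
- exact: rho_even_stable.
- by rewrite -(rVK X a) limgS.
- by move=> E; left; rewrite -(rK Y a) E limg0.
by move=> E; right; rewrite -E rK.
Qed.

(* Clifford's argument: the socle for the Lie algebra is stable under the whole
   group, so complete reducibility descends from G_0 to its Lie algebra even
   when G_0 is disconnected. *)
Lemma socle_full : exists s : seq {vspace M},
  (forall X, X \in s -> minimal_stable X) /\ (\sum_(X <- s) X)%VS = fullv.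
Proof.
pose P v := exists s : seq {vspace M},
  (forall X, X \in s -> minimal_stable X) /\ v \in (\sum_(X <- s) X)%VS.
have Pl : lin_closed P.
  split; first by exists [::]; rewrite big_nil mem0v.
  move=> c u v [s [Hs us]] [t [Ht vt]]; exists (s ++ t); split.
    by move=> X; rewrite mem_cat => /orP [/Hs|/Ht].
  by rewrite big_cat memv_add ?memvZ.
have [S SP] := vspace_of_pred Pl.
have GS a : (rho a @: S <= S)%VS.
  apply/subvP=> _ /memv_imgP [v /SP [s [Hs vs]] ->]; apply/SP.
  exists [seq (rho a @: X)%VS | X <- s]; split.
    by move=> _ /mapP [X /Hs mX ->]; apply: rho_minimal_stable.
  by rewrite big_map -limg_sum memv_img.
have [W [GW SW SW0]] := G_qred rho_rat GS.
have W0 : W = 0%VS.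
  apply: NNPP => /(minimal_stable_exists (group_stable_even_stable GW)) [X mX XW].
  have XS : (X <= S)%VS.
    by apply/subvP=> v vX; apply/SP; exists [:: X]; rewrite big_seq1; split=> // Y;
      rewrite inE => /eqP ->.
  have [_ X0 _] := mX; apply: X0; apply/eqP; rewrite -subv0 -SW0 subv_cap XS XW //.
rewrite W0 addv0 in SW.
have : exists s : seq {vspace M}, (forall X, X \in s -> minimal_stable X) /\
    (<<vbasis S>> <= \sum_(X <- s) X)%VS.
  suff H (r : seq M) : {subset r <= S} -> exists s : seq {vspace M},
      (forall X, X \in s -> minimal_stable X) /\ (<<r>> <= \sum_(X <- s) X)%VS.
    by apply: H => v; apply: vbasis_mem.
  elim: r => [|v r IHr] Hr.
    by exists [::]; rewrite big_nil span_nil; split.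
  have [|s [Hs rs]] := IHr; first by move=> w wr; rewrite Hr // inE wr orbT.
  have /SP [t [Ht vt]] : v \in S by apply: Hr; rewrite inE eqxx.
  exists (t ++ s); split; first by move=> X; rewrite mem_cat => /orP [/Ht|/Hs].
  by rewrite span_cons big_cat addvS // -memvE.
case=> s [Hs Ss]; exists s; split=> //; apply/eqP; rewrite eqEsubv subvf /=.
by rewrite -SW -(span_basis (vbasisP S)).
Qed.

Theorem even_complement U : even_stable U ->
  exists W, [/\ even_stable W, (U + W)%VS = fullv & (U :&: W)%VS = 0%VS].
Proof.
move=> sU; have [s [Hs Ss]] := socle_full.
suff H d : forall W, (\dim {:M} - \dim W <= d)%N -> even_stable W -> (U :&: W)%VS = 0%VS ->
    exists W, [/\ even_stable W, (U + W)%VS = fullv & (U :&: W)%VS = 0%VS].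
  apply: (H _ 0%VS (leqnn _)); last by rewrite capv0.
  by move=> u m _; rewrite !memv0 => /eqP ->; rewrite linear0.
elim: d => [|d IHd] W dW sW UW0;
  case: (eqVneq (U + W)%VS fullv) => [UW|UW]; try by exists W.
  case/eqP: UW; apply/eqP; rewrite eqEsubv subvf /=; apply: subv_trans (addvSr _ _).
  by have /eqP -> : W == fullv by rewrite eqEdim subvf; move: dW; lia.
have [X Xs XUW] : exists2 X, X \in s & ~~ (X <= U + W)%VS.
  apply/hasP; rewrite has_predC; apply: contra UW => /allP Hall.
  rewrite eqEsubv subvf -Ss /= big_seq.
  by elim/big_ind: _ => [|Y Y' YU YU'|Y /Hall //]; rewrite ?sub0v ?subv_add ?YU.
have [sX X0 mX] := Hs _ Xs.
have XUW0 : (X :&: (U + W) = 0)%VS.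
  case: (mX (X :&: (U + W))%VS (_ : even_stable _) (capvSl _ _)) => //.
    move=> u m ug /memv_capP [mX' /memv_addP [m1 m1U [m2 m2W E]]].
    rewrite memv_cap sX //= E linearD memv_add ?sU ?sW //.
  by move=> E; case/negP: XUW; rewrite -E capvSr.
apply: (IHd (W + X)%VS).
- have WX0 : (W :&: X = 0)%VS.
    apply/eqP; rewrite -subv0 -XUW0 subv_cap capvSr /=.
    by apply: subv_trans (capvSl _ _) (addvSr _ _).
  rewrite dimv_disjoint_sum //; have : \dim X != 0%N by rewrite dimv_eq0; apply/eqP.
  by move: dW; lia.
- move=> u m ug /memv_addP [m1 m1W [m2 m2X ->]].
  by rewrite linearD memv_add ?sW ?sX.
apply/eqP; rewrite -subv0; apply/subvP=> v /memv_capP [vU /memv_addP [w wW [x xX Dv]]].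
have x0 : x = 0.
  apply/eqP; rewrite -memv0 -XUW0 memv_cap xX /=.
  have -> : x = v - w by rewrite Dv addrC addKr.
  by apply: memv_add => //; rewrite memvN.
by rewrite -UW0 memv_cap vU Dv x0 addr0.
Qed.

Lemma even_complement_of (A U : {vspace M}) :
  even_stable A -> (U <= A)%VS -> even_stable U ->
  exists W, [/\ even_stable W, (U + W)%VS = A & (U :&: W)%VS = 0%VS].
Proof.
move=> sA UA sU; have [W [sW UW UW0]] := even_complement sU.
exists (W :&: A)%VS; split.
- by move=> u m ug /memv_capP [mW mA]; rewrite memv_cap sW ?sA.
- by rewrite vspace_modl // UW capfv.
by apply/eqP; rewrite -subv0 -UW0 capvS // capvSl.
Qed.

(** [semisimple_element] speaks of the even part only. The span [E] of the eigenvectors of s in M is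
    g_0-stable, since eigenvectors of ad s shift eigenvalues, and a nonzero stable complement would
    contain another eigenvector. So s is diagonalizable on M, whence Ker s^2 = Ker s. *)
Lemma semisimple_act s : semisimple_element s ->
  forall m, act M s (act M s m) = 0 -> act M s m = 0.
Proof.
case=> sg [b bB bs].
pose eig (v : M) := exists c, act M s v = c *: v.
pose P v := exists2 r : seq M, v = \sum_(w <- r) w & forall w, w \in r -> eig w.
have Pl : lin_closed P.
  split; first by exists [::]; rewrite ?big_nil.
  move=> c u v [r -> Hr] [t -> Ht]; exists ([seq c *: w | w <- r] ++ t).
    by rewrite big_cat big_map scaler_sumr.
  move=> w; rewrite mem_cat => /orP [/mapP [w' /Hr [d Dw] ->]|/Ht //].
  by exists d; rewrite linearZ /= Dw !scalerA mulrC.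
have [E EP] := vspace_of_pred Pl.
have sE : even_stable E.
  move=> u m ug /EP [r -> Hr]; rewrite linear_sum big_seq; apply: memv_suml => w /Hr [c Dw].
  have bB' : basis_of g0 (in_tuple b) by [].
  rewrite (coord_basis bB' ug) linear_sum /= sum_lfunE; apply: memv_suml => i _.
  rewrite linearZ /= scale_lfunE memvZ //; set v := b`_i.
  have vb : v \in b by apply: mem_nth.
  have [d Dv] := bs v vb; have vg := basis_mem bB vb.
  apply/EP; exists [:: act M v w]; rewrite ?big_seq1 // => w'; rewrite inE => /eqP ->.
  exists (d + c); have := act_even_bracket w sg vg.
  rewrite Dv linearZ /= scale_lfunE Dw linearZ /= => /eqP.
  by rewrite eq_sym subr_eq -scalerDl => /eqP.
have [W [sW EW EW0]] := even_complement sE.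
have W0 : W = 0%VS.
  apply: NNPP => /eqP /(eigenvector_exists (T := act M s)) [m|w wW [w0 Hw]].
    exact: sW.
  case/eqP: w0; apply/eqP; rewrite -memv0 -EW0 memv_cap wW andbT; apply/EP.
  by exists [:: w]; rewrite ?big_seq1 // => w'; rewrite inE => /eqP ->.
rewrite W0 addv0 in EW.
move=> m smm.
have full : (lker (act M s) + limg (act M s) = fullv)%VS.
  apply/eqP; rewrite eqEsubv subvf /=; apply/subvP=> v _.
  have /EP [r -> Hr] : v \in E by rewrite EW memvf.
  rewrite big_seq; apply: memv_suml => w /Hr [c Dw].
  case: (eqVneq c 0) => [c0|c0].
    by apply: (subvP (addvSl _ _)); rewrite memv_ker Dw c0 scale0r.
  apply: (subvP (addvSr _ _)).
  have := memv_img (act M s) (memvf (c^-1 *: w)).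
  by rewrite linearZ /= Dw scalerA mulVf // scale1r.
have cap0 : (lker (act M s) :&: limg (act M s) = 0)%VS.
  apply/eqP; rewrite -dimv_eq0 -(eqn_add2l (\dim (lker (act M s) + limg (act M s))%VS)).
  by rewrite dimv_sum_cap full addn0 -(limg_ker_dim (act M s) fullv) capfv.
apply/eqP; rewrite -memv0 -cap0 memv_cap memv_ker smm eqxx /=.
by rewrite memv_img ?memvf.
Qed.

End Module.
End Representations.

(** * Faithfulness on the odd part *)

Section Grading.
Variables (k : fieldType) (g : lieSuperalgebra k).

Lemma part_disjoint (u : g) : u \in part g false -> u \in part g true -> u = 0.
Proof.
by move=> u0 u1; apply/eqP; rewrite -memv0 -(part_grading g).2 memv_cap u0 u1.
Qed.

Definition parity_proj (b : bool) : 'End(g) := daddv_pi (part g b) (part g (~~ b)).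

Let part_cap b : (part g b :&: part g (~~ b) = 0)%VS.
Proof. by case: b; [rewrite capvC|]; exact: (part_grading g).2. Qed.

Let part_sum b : (part g b + part g (~~ b) = fullv)%VS.
Proof. by case: b; [rewrite addvC|]; exact: (part_grading g).1. Qed.

Lemma parity_proj_mem b u : parity_proj b u \in part g b.
Proof. exact: memv_pi. Qed.

Lemma parity_projD b u : parity_proj b u + parity_proj (~~ b) u = u.
Proof.
rewrite /parity_proj negbK; apply: daddv_pi_add; first exact: part_cap.
by rewrite part_sum memvf.
Qed.

Lemma parity_proj_id b u : u \in part g b -> parity_proj b u = u.
Proof. exact: daddv_pi_id (part_cap b). Qed.

Lemma parity_proj_eq0 b u : u \in part g (~~ b) -> parity_proj b u = 0.
Proof.
move=> ub; apply: (addIr u); rewrite add0r.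
by have := parity_projD b u; rewrite [parity_proj (~~ b) u]parity_proj_id.
Qed.

Lemma adjoint_act_bracket a b (u v m : g) : u \in part g a -> v \in part g b ->
  bracket g (bracket g u v) m =
  bracket g u (bracket g v m) - (-1) ^+ (a && b) *: bracket g v (bracket g u m).
Proof. by move=> ua vb; rewrite (bracket_jacobi m ua vb) addrK. Qed.

Definition adjoint_module : superModule g :=
  @SuperModule k g g (part g) (bracket g) (part_grading g) (@bracket_parity k g)
    adjoint_act_bracket.

End Grading.

Section FaithfulModules.
Variable k : closedFieldType.
Variable G : supergroup k.
Hypothesis G_qred : quasi_reductive G.
Local Notation g := (lie G).
Local Notation br := (bracket g).

Lemma adjoint_in_Rep : in_Rep (adjoint_module g).
Proof.
exists (@Ad k G); split; first exact: Ad_rational.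
- exact: Ad_parity.
- exact: Ad_differential.
by move=> a u m; apply: Ad_bracket.
Qed.

Section TrivialExtension.
(* [pi] stands for a projection of g onto a subspace of g_1 on which the even
   part acts by zero; the module is a nontrivial extension of the trivial
   module by the image of [pi]. *)
Variable pi : 'End(g).
Hypothesis pi_odd : forall u, pi u \in part g true.
Hypothesis pi_even : forall u, u \in part g false -> pi u = 0.
Hypothesis pi_idem : forall u, pi (pi u) = pi u.
Hypothesis pi_Ad : forall a u, pi (Ad a u) = Ad a (pi u).
Hypothesis pi_ad : forall u v, u \in part g false -> br u (pi v) = 0.
Hypothesis pi_br : forall u v, u \in part g false -> pi (br u v) = 0.

Local Notation E := (k^o * g)%type.

Let ext_fun (u : g) (p : E) : E := (0, p.1 *: pi u).

Let ext_fun_linear u : linear (ext_fun u).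
Proof.
move=> c p q; rewrite /ext_fun /=; apply: injective_projections => /=.
  by rewrite scaler0 addr0.
by rewrite scalerDl scalerA.
Qed.

Let ext_lin u : {linear E -> E} :=
  HB.pack (ext_fun u) (GRing.isLinear.Build k E E _ (ext_fun u) (ext_fun_linear u)).

Let ext_act_fun (u : g) : 'End(E) := linfun (ext_lin u).

Let ext_act_linear : linear ext_act_fun.
Proof.
move=> c u v; apply/lfunP=> p; rewrite add_lfunE scale_lfunE !lfunE /= /ext_fun.
apply: injective_projections => /=; first by rewrite scaler0 addr0.
by rewrite linearP scalerDr !scalerA mulrC.
Qed.

Definition ext_act : {linear g -> 'End(E)} :=
  HB.pack ext_act_fun (GRing.isLinear.Build k g 'End(E) _ ext_act_fun ext_act_linear).

Lemma ext_actE u p : ext_act u p = (0, p.1 *: pi u) :> E.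
Proof. by rewrite /= lfunE. Qed.

Definition ext_part (b : bool) : {vspace E} :=
  ((linfun (snd : E -> g) @^-1: part g b) :&:
   (if b then lker (linfun (fst : E -> k^o)) else fullv))%VS.

Lemma ext_partE b (p : E) : (p \in ext_part b) = (p.2 \in part g b) && (b ==> (p.1 == 0)).
Proof.
rewrite memv_cap -memv_preim lfunE /=; congr (_ && _).
by case: b => /=; rewrite ?memv_ker ?lfunE ?memvf.
Qed.

Lemma ext_grading : is_grading ext_part.
Proof.
split; apply/eqP; rewrite eqEsubv ?subvf ?sub0v ?andbT /=; apply/subvP=> -[c w] _p.
  have -> : (c, w) = ((c, parity_proj g false w) + (0, parity_proj g true w) : E).
    by apply: injective_projections; rewrite /= ?addr0 // (parity_projD false).
  by apply: memv_add; rewrite ext_partE /= parity_proj_mem ?eqxx.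
move: _p; rewrite memv_cap !ext_partE /= andbT => /and3P [w0 w1 /eqP c0].
by rewrite memv0 c0 (part_disjoint w0 w1).
Qed.

Lemma ext_act_parity a b u (m : E) : u \in part g a -> m \in ext_part b ->
  ext_act u m \in ext_part (a (+) b).
Proof.
rewrite !ext_partE ext_actE /= eqxx implybT andbT => ua /andP [_].
case: a ua => [|/pi_even ->] ua; last by rewrite scaler0 mem0v.
by case: b => [/eqP ->|_]; rewrite ?scale0r ?mem0v // memvZ.
Qed.

Lemma ext_act_bracket a b u v (m : E) : u \in part g a -> v \in part g b ->
  ext_act (br u v) m =
  ext_act u (ext_act v m) - (-1) ^+ (a && b) *: ext_act v (ext_act u m).
Proof.
move=> ua vb; rewrite !ext_actE /= !scale0r scaler0 subr0.
suff -> : pi (br u v) = 0 by rewrite scaler0.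
case: a ua => ua; last exact: pi_br.
case: b vb => vb; first exact: pi_even (bracket_parity ua vb).
by rewrite (bracket_anti ua vb) linearN linearZ /= pi_br // scaler0 oppr0.
Qed.

Definition extension_module : superModule g :=
  @SuperModule k g E ext_part ext_act ext_grading ext_act_parity ext_act_bracket.

(** Only the image of [pi] takes part in the extension; the kernel of [pi] is a trivial summand,
    where G_0 acts by the identity. *)
Let ext_odd_rho a : 'End(g) := (Ad a \o pi + (\1 - pi))%VF.

Let ext_rho_fun (a : even_group G) (p : E) : E := (p.1, ext_odd_rho a p.2).

Let ext_rho_linear a : linear (ext_rho_fun a).
Proof. by move=> c p q; apply: injective_projections => //=; rewrite linearP. Qed.

Let ext_rho_lin a : {linear E -> E} :=
  HB.pack (ext_rho_fun a) (GRing.isLinear.Build k E E _ (ext_rho_fun a) (ext_rho_linear a)).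

Definition ext_rho a : 'End(E) := linfun (ext_rho_lin a).

Lemma ext_rhoE a p : ext_rho a p = (p.1, Ad a (pi p.2) + (p.2 - pi p.2)) :> E.
Proof.
rewrite lfunE /= /ext_rho_fun /ext_odd_rho !add_lfunE opp_lfunE comp_lfunE.
by rewrite id_lfunE.
Qed.

Let pi_compl w : pi (w - pi w) = 0.
Proof. by rewrite linearB /= pi_idem subrr. Qed.

Lemma extension_in_Rep : in_Rep extension_module.
Proof.
have [Ad1 AdM Adreg] := Ad_rational G.
have reg (phi : {linear E -> k^o}) (p : E) :
  [/\ exists psi : {linear g -> k^o}, (forall w, psi w = phi (0, w)) &
      forall a, phi (ext_rho a p) = phi (p.1, p.2 - pi p.2) + phi (0, Ad a (pi p.2))].
  split.
    pose psi (w : g) : k^o := phi ((0, w) : E).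
    have psi_linear : linear psi.
      move=> c v w; rewrite /psi -linearP; congr (phi _).
      by apply: injective_projections; rewrite //= scaler0 addr0.
    pose psi' : {linear g -> k^o} :=
      HB.pack psi (GRing.isLinear.Build k g k^o _ psi psi_linear).
    by exists psi'.
  move=> a; rewrite -linearD ext_rhoE; congr (phi _).
  by apply: injective_projections; rewrite /= ?addr0 // addrC.
exists ext_rho; split.
- split.
  + apply/lfunP=> p; rewrite id_lfunE ext_rhoE Ad1 id_lfunE addrC subrK.
    by case: p.
  + move=> a b; apply/lfunP=> p; rewrite comp_lfunE !ext_rhoE /=.
    congr (_, _); rewrite linearD /= pi_compl addr0 pi_Ad pi_idem AdM comp_lfunE.
    by congr (_ + _); rewrite addrAC subrr add0r.
  + move=> phi p; have [[psi Hpsi] Hphi] := reg phi p.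
    have -> : (fun a => phi (ext_rho a p)) =
        (fun a => phi (p.1, p.2 - pi p.2) + psi (Ad a (pi p.2))).
      by apply: functional_extensionality => a; rewrite Hphi Hpsi.
    by apply: regularD; [apply: regular_cst | apply: Adreg].
- move=> a b p; rewrite !ext_partE ext_rhoE /= => /andP [pb ->]; rewrite andbT.
  case: b pb => pb; first by rewrite memvD ?memvB // Ad_parity.
  by rewrite pi_even // linear0 add0r subr0.
- move=> u ug phi p; have [[psi Hpsi] Hphi] := reg phi p.
  rewrite /= ext_actE pi_even // scaler0 -[(0, 0)]/(0 : E) linear0.
  have -> : (fun a => phi (ext_rho a p)) =
      (fun a => phi (p.1, p.2 - pi p.2) + psi (Ad a (pi p.2))).
    by apply: functional_extensionality => a; rewrite Hphi Hpsi.
  have td := tangent_derivation ug.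
  rewrite (derD td) ?(der_cst td) ?add0r; [|exact: regular_cst|exact: Adreg].
  by rewrite -(Ad_differential ug) pi_ad // linear0.
move=> a u p.
have actE v (q : E) : act extension_module v q = (0, q.1 *: pi v) := ext_actE v q.
rewrite !actE !ext_rhoE /=.
by congr (_, _); rewrite ![pi (_ *: _)]linearZ /= pi_idem subrr addr0 pi_Ad linearZ.
Qed.

End TrivialExtension.

(** Acting by zero on g only puts y in the space [Z] of odd vectors killed by g_0. With [pi] the
    projection to [Z] along a G_0-stable complement, y sends (1, 0) to (0, y) in the extension. A
    disconnected G_0 may act on [Z] nontrivially, so the extension carries Ad. *)
Theorem faithful_odd (y : g) : y \in part g true ->
  (forall M : superModule g, in_Rep M -> act M y = 0) -> y = 0.
Proof.
move=> y1 act0; have [Ad1 AdM Adreg] := Ad_rational G.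
pose P z := z \in part g true /\ forall u, u \in part g false -> br u z = 0.
have Pl : lin_closed P.
  apply: lin_closed_and; first exact: lin_closed_vspace.
  split=> [u _|c z z' Hz Hz' u ug]; first by rewrite linear0.
  by rewrite linearP /= Hz // Hz' // scaler0 addr0.
have [Z ZP] := vspace_of_pred Pl.
have AdZ a z : z \in Z -> Ad a z \in Z.
  move=> /ZP [z1 Hz]; apply/ZP; split; first exact: Ad_parity.
  move=> u ug; have -> : u = Ad a (Ad a^-1%g u).
    by rewrite -comp_lfunE -AdM mulgV Ad1 id_lfunE.
  by rewrite -Ad_bracket Hz ?linear0 // Ad_parity.
have [|W [GW ZW ZW0]] := G_qred (Ad_rational G) (U := Z).
  by move=> a; apply/subvP=> _ /memv_imgP [z zZ ->]; apply: AdZ.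
have adW u w : u \in part g false -> w \in W -> br u w \in W.
  have := @group_stable_even_stable k G (adjoint_module g) (@Ad k G) (@Ad_differential k G) W GW.
  by apply.
have AdW a w : w \in W -> Ad a w \in W.
  by move=> wW; apply: (subvP (GW a)); apply: memv_img.
pose p := daddv_pi Z W; pose q := parity_proj g true.
have pZ z : z \in Z -> p z = z by apply: daddv_pi_id.
have pW w : w \in W -> p w = 0.
  move=> wW; have : w \in (Z + W)%VS by rewrite ZW memvf.
  have WZ : daddv_pi W Z w = w by apply: daddv_pi_id; rewrite // capvC.
  move/(daddv_pi_add ZW0); rewrite WZ => E.
  by apply: (addIr w); rewrite E add0r.
have dec w : exists z w', [/\ z \in Z, w' \in W & w = z + w'].
  have /memv_addP [z zZ [w' w'W ->]] : w \in (Z + W)%VS by rewrite ZW memvf.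
  by exists z, w'.
have pw z w : z \in Z -> w \in W -> p (z + w) = z.
  by move=> zZ wW; rewrite linearD /= pZ // pW // addr0.
pose pi : 'End(g) := (p \o q)%VF.
have piE w : pi w = p (q w) by rewrite comp_lfunE.
have piZ w : pi w \in Z by rewrite piE memv_pi.
have qT w : w \in part g true -> q w = w by apply: parity_proj_id.
have qF w : w \in part g false -> q w = 0 by apply: (@parity_proj_eq0 k g true).
have qdec w : exists w0, w0 \in part g false /\ w = w0 + q w.
  exists (parity_proj g false w); split; first exact: parity_proj_mem.
  by rewrite (parity_projD false).
have pi_odd w : pi w \in part g true by have /ZP [] := piZ w.
have pi_even w : w \in part g false -> pi w = 0 by move=> /qF; rewrite piE => ->; rewrite linear0.
have pi_idem w : pi (pi w) = pi w by rewrite piE qT // pZ.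
have pi_Ad a w : pi (Ad a w) = Ad a (pi w).
  have [w0 [w0g Dw]] := qdec w; rewrite {1}Dw !linearD /= pi_even ?Ad_parity // add0r.
  rewrite !piE qT ?Ad_parity ?parity_proj_mem //.
  have [z [w' [zZ w'W ->]]] := dec (q w); rewrite linearD /= !pw ?AdZ ?AdW //.
have pi_ad u w : u \in part g false -> br u (pi w) = 0.
  by have /ZP [_] := piZ w; apply.
have pi_br u w : u \in part g false -> pi (br u w) = 0.
  move=> ug; have [w0 [w0g Dw]] := qdec w; rewrite Dw !linearD /= pi_even ?add0r; last first.
    exact: (bracket_parity ug w0g).
  have := bracket_parity ug (parity_proj_mem true w); rewrite /= => brq.
  rewrite piE qT //; have [z [w' [zZ w'W ->]]] := dec (q w).
  have /ZP [_ uz] := zZ.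
  by rewrite linearD /= uz // add0r pW // adW.
have yZ : y \in Z.
  apply/ZP; split=> // u ug; have E := act0 _ adjoint_in_Rep.
  by rewrite (bracket_anti ug y1) -[bracket g y]/(act (adjoint_module g) y) E lfunE scaler0 oppr0.
have := act0 _ (extension_in_Rep pi_odd pi_even pi_idem pi_Ad pi_ad pi_br).
move/lfunP/(_ ((1, 0) : (k^o * g)%type)) => E.
have := congr1 snd (etrans (esym (ext_actE pi y (1, 0))) E).
by rewrite zero_lfunE /= scale1r piE qT // pZ.
Qed.

End FaithfulModules.

(** * Exponentials of weight vectors *)

Section Comultiplication.
Variables (k : closedFieldType) (G : affineGroup k).

(* The functions on G x G in the image of k[G] (x) k[G]. *)
Definition split_function (F : G -> G -> k) := exists n (u v : 'I_n -> G -> k),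
  [/\ forall i, regular (u i), forall i, regular (v i) &
      forall a b, F a b = \sum_i u i a * v i b].

Lemma split_mul u v : regular u -> regular v -> split_function (fun a b => u a * v b).
Proof.
move=> ru rv; exists 1%N, (fun=> u), (fun=> v); split=> // a b.
by rewrite big_ord1.
Qed.

Lemma splitD F1 F2 : split_function F1 -> split_function F2 ->
  split_function (fun a b => F1 a b + F2 a b).
Proof.
move=> [m [u1 [v1 [ru1 rv1 E1]]]] [n [u2 [v2 [ru2 rv2 E2]]]].
exists (m + n)%N.
exists (fun i => match split i with inl j => u1 j | inr j => u2 j end).
exists (fun i => match split i with inl j => v1 j | inr j => v2 j end).
split=> [i|i|a b]; try by case: (split i).
rewrite big_split_ord /= E1 E2; congr (_ + _); apply: eq_bigr => i _.
  by rewrite (unsplitK (inl i)).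
by rewrite (unsplitK (inr i)).
Qed.

Lemma splitM F1 F2 : split_function F1 -> split_function F2 ->
  split_function (fun a b => F1 a b * F2 a b).
Proof.
move=> [m [u1 [v1 [ru1 rv1 E1]]]] [n [u2 [v2 [ru2 rv2 E2]]]].
pose p (i : 'I_#|{: 'I_m * 'I_n}|) : 'I_m * 'I_n := enum_val i.
exists #|{: 'I_m * 'I_n}|.
exists (fun i a => u1 (p i).1 a * u2 (p i).2 a), (fun i b => v1 (p i).1 b * v2 (p i).2 b).
split=> [i|i|a b]; [exact: regularM | exact: regularM |].
rewrite E1 E2 mulr_suml; under eq_bigr do rewrite mulr_sumr.
rewrite pair_big /= (reindex _ (onW_bij _ (enum_val_bij _))) /=.
by apply: eq_bigr => i _; rewrite mulrACA.
Qed.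

Lemma split_cst c : split_function (fun _ _ => c).
Proof.
have := split_mul (regular_cst G c) (regular_cst G 1).
by case=> n [u [v [ru rv E]]]; exists n, u, v; split=> // a b; rewrite -E mulr1.
Qed.

Lemma split_ext F1 F2 : (forall a b, F1 a b = F2 a b) ->
  split_function F1 -> split_function F2.
Proof. by move=> E [n [u [v [? ? E1]]]]; exists n, u, v; split=> // a b; rewrite -E. Qed.

Lemma split_meval m (P : {mpoly k[m]}) (F : 'I_m -> G -> G -> k) :
  (forall i, split_function (F i)) -> split_function (fun a b => P.@[fun i => F i a b]).
Proof.
move=> HF; apply: (@split_ext (fun a b => \sum_(q <- msupp P) P@_q * \prod_i F i a b ^+ q i)).
  by move=> a b; rewrite mevalE.
elim: (msupp P : seq _) => [|q s IHs].
  by apply: split_ext (split_cst 0) => a b; rewrite big_nil.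
apply: split_ext => [a b|]; first by rewrite big_cons.
apply: splitD IHs; apply: splitM; first exact: split_cst.
elim: (index_enum _) => [|i r IHr].
  by apply: split_ext (split_cst 1) => a b; rewrite big_nil.
apply: split_ext => [a b|]; first by rewrite big_cons.
apply: splitM IHr; elim: (q i) => [|e IHe]; first by apply: split_ext (split_cst 1).
by apply: split_ext (splitM (HF i) IHe) => a b; rewrite exprS.
Qed.

Lemma split_comul (f : G -> k) : regular f -> split_function (fun a b => f (a * b)%g).
Proof.
case=> P HP; apply: (@split_ext (fun a b => P.@[fun i => coord (a * b)%g i])).
  by move=> a b; rewrite HP.
apply: split_meval => i; have [Q HQ] := @coord_mul k G i.
pose F (j : 'I_(adim G + adim G)) (a b : G) :=
  match split j with inl j1 => coord a j1 | inr j2 => coord b j2 end.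
apply: (@split_ext (fun a b => Q.@[fun j => F j a b]) (fun a b => coord (a * b)%g i)).
  by move=> a b; rewrite HQ.
apply: split_meval => j; rewrite /F; case: (split j) => l.
  have := split_mul (regular_coord l) (regular_cst G 1).
  by apply: split_ext => a b; rewrite mulr1.
have := split_mul (regular_cst G 1) (regular_coord l).
by apply: split_ext => a b; rewrite mul1r.
Qed.

Lemma regular_lmul (f : G -> k) (a : G) : regular f -> regular (fun b => f (a * b)%g).
Proof.
case/split_comul=> n [u [v [ru rv E]]].
have -> : (fun b => f (a * b)%g) = (fun b => \sum_i u i a * v i b).
  by apply: functional_extensionality => b; rewrite E.
by apply: regular_sum => i; apply: regularM; [apply: regular_cst | apply: rv].
Qed.

Lemma regular_rmul (f : G -> k) (b : G) : regular f -> regular (fun a => f (a * b)%g).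
Proof.
case/split_comul=> n [u [v [ru rv E]]].
have -> : (fun a => f (a * b)%g) = (fun a => \sum_i u i a * v i b).
  by apply: functional_extensionality => a; rewrite E.
by apply: regular_sum => i; apply: regularM; [apply: ru | apply: regular_cst].
Qed.

(* The left translates of a regular function span a finite-dimensional space;
   a nonzero minor (f (a_i b_j)) of maximal size gives a basis of it. *)
Lemma matrix_coefficients (f : G -> k) : regular f ->
  exists r (gv : G -> 'rV[k]_r) (m : G -> 'M[k]_r) (w : 'cV[k]_r),
    [/\ forall a, f a = (gv a *m w) 0 0,
        forall a b, gv (a * b)%g = gv a *m m b,
        forall a b, m (a * b)%g = m a *m m b,
        forall l, regular (fun a => gv a 0 l) &
        forall i j, regular (fun a => m a i j)].
Proof.
move=> rf; have [n [u [v [ru rv E]]]] := split_comul rf.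
pose mat r (x y : 'I_r -> G) : 'M[k]_r := \matrix_(i, j) f (x i * y j)%g.
pose good r := exists x y : 'I_r -> G, \det (mat r x y) != 0.
(* Such a matrix factors through k^n, with n the number of terms in the comultiplication of [f]. *)
have bound r : good r -> (r <= n)%N.
  move=> [x [y dxy]]; have Dm : mat r x y = (\matrix_(i, j) u j (x i)) *m (\matrix_(i, j) v i (y j)).
    by apply/matrixP=> i j; rewrite !mxE E; apply: eq_bigr => l _; rewrite !mxE.
  have : row_free (mat r x y) by rewrite row_free_unit unitmxE unitfE.
  rewrite /row_free => /eqP <-; rewrite Dm.
  exact: leq_trans (mxrankM_maxl _ _) (rank_leq_col _).
have [r [x [y dxy]] rmax] : exists2 r, good r & ~ good r.+1.
  apply: NNPP => N; have good_all r : good r.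
    elim: r => [|r IHr]; first by exists (fun=> 1%g), (fun=> 1%g); rewrite det_mx00 oner_eq0.
    by apply: NNPP => Nr; apply: N; exists r.
  by have := bound _ (good_all n.+1); rewrite ltnn.
pose M := mat r x y; have uM : M \in unitmx by rewrite unitmxE unitfE.
pose gv a : 'rV[k]_r := \row_l f (a * y l)%g.
pose hv b : 'cV[k]_r := \col_i f (x i * b)%g.
(* Bordering the maximal minor by a row for [a] and a column for [b] gives determinant 0; the Schur
   complement then expresses f(a b). *)
have fE a b : f (a * b)%g = (gv a *m invmx M *m hv b) 0 0.
  pose x' (i : 'I_(r + 1)) := match split i with inl j => x j | inr _ => a end.
  pose y' (i : 'I_(r + 1)) := match split i with inl j => y j | inr _ => b end.
  have Dxy : mat _ x' y' = block_mx M (hv b) (gv a) (f (a * b)%g)%:M.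
    apply/matrixP=> i j; rewrite !mxE /x' /y'.
    case: (split i) => i'; rewrite !mxE; case: (split j) => j'; rewrite !mxE //.
    by rewrite !ord1 eqxx mulr1n.
  have d0 : \det (mat _ x' y') = 0.
    apply/eqP; apply: contraT => d; case: rmax; rewrite -addn1; by exists x', y'.
  pose L : 'M[k]_(r + 1) := block_mx 1%:M 0 (- (gv a *m invmx M)) 1%:M.
  have : \det (L *m mat _ x' y') = 0 by rewrite det_mulmx d0 mulr0.
  rewrite Dxy mulmx_block !mul1mx !mul0mx !addr0 !mulNmx mulmxKV //.
  rewrite addNr det_ublock => /eqP; rewrite mulf_eq0 (negPf dxy) /= det_mx11 !mxE.
  by rewrite eqxx mulr1n addrC subr_eq0 => /eqP ->.
pose mb b : 'M[k]_r := \matrix_(i, l) f (x i * (b * y l))%g.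
pose m b := invmx M *m mb b.
have gvM a b : gv (a * b)%g = gv a *m m b.
  apply/rowP=> l; rewrite /m mulmxA [LHS]mxE -mulgA fE !mxE.
  by apply: eq_bigr => i _; rewrite !mxE.
exists r, gv, m, (invmx M *m hv 1%g); split=> //.
- by move=> a; rewrite mulmxA -fE mulg1.
- move=> a b; have mbE c : mb c = \matrix_(i < r) gv (x i * c)%g.
    by apply/matrixP=> i l; rewrite !mxE mulgA.
  have : mb (a * b)%g = mb a *m m b.
    by apply/row_matrixP => i; rewrite row_mul !mbE !rowK mulgA (gvM (x i * a)%g b).
  by move=> Hm; rewrite [m (a * b)%g]/m Hm mulmxA.
- move=> l; have -> : (fun a => gv a 0 l) = (fun a => f (a * y l)%g).
    by apply: functional_extensionality => a; rewrite mxE.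
  exact: regular_rmul.
move=> i j; have -> : (fun a => m a i j) =
    (fun a => \sum_l invmx M i l * f (x l * (a * y j))%g).
  by apply: functional_extensionality => a; rewrite mxE; apply: eq_bigr => l _; rewrite mxE.
apply: regular_sum => l; apply: regularM; first exact: regular_cst.
exact: (regular_rmul (f := fun c => f (x l * c)%g) _ (regular_lmul _ rf)).
Qed.

End Comultiplication.

Section Exponential.
Variable k : closedFieldType.
Hypothesis char_k : [pchar k] =i pred0.
Variable G : supergroup k.
Local Notation g := (lie G).
Local Notation G0 := (even_group G).
Local Notation br := (bracket g).

(** The left-invariant derivation of k[G_0] whose value at 1 is [tangent u]. *)
Definition translate (u : g) (f : G0 -> k) : G0 -> k :=
  fun a => tangent u (fun b => f (a * b)%g).

Section Translate.
Variable z : g.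
Hypothesis z_even : z \in part g false.
Local Notation D := (translate z).

Lemma regular_translate f : regular f -> regular (D f).
Proof.
move=> rf; have [n [u [v [ru rv E]]]] := split_comul rf.
have -> : D f = (fun a => \sum_i u i a * tangent z (v i)).
  apply: functional_extensionality => a; rewrite /translate.
  have -> : (fun b => f (a * b)%g) = (fun b => \sum_i u i a * v i b).
    by apply: functional_extensionality => b; rewrite E.
  have td := tangent_derivation z_even.
  rewrite (der_sum td) => [|i]; last by apply: regularM; [apply: regular_cst | apply: rv].
  by apply: eq_bigr => i _; rewrite (derZ td).
by apply: regular_sum => i; apply: regularM; [apply: ru | apply: regular_cst].
Qed.

Lemma regular_iter_translate n f : regular f -> regular (iter n D f).
Proof. by move=> rf; elim: n => //= n; apply: regular_translate. Qed.

Lemma translateD f1 f2 : regular f1 -> regular f2 ->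
  D (fun a => f1 a + f2 a) = (fun a => D f1 a + D f2 a).
Proof.
move=> r1 r2; apply: functional_extensionality => a.
by rewrite /translate (derD (tangent_derivation z_even)) //; apply: regular_lmul.
Qed.

Lemma translateM f1 f2 : regular f1 -> regular f2 ->
  D (fun a => f1 a * f2 a) = (fun a => f1 a * D f2 a + D f1 a * f2 a).
Proof.
move=> r1 r2; apply: functional_extensionality => a; rewrite /translate.
have := (tangent_derivation z_even).2 _ _ (regular_lmul a r1) (regular_lmul a r2).
by rewrite /= mulg1.
Qed.

Lemma translate_cst c : D (fun=> c) = (fun=> 0).
Proof.
apply: functional_extensionality => a.
by rewrite /translate (der_cst (tangent_derivation z_even)).
Qed.

Lemma iter_translateD n f1 f2 : regular f1 -> regular f2 ->
  iter n D (fun a => f1 a + f2 a) = (fun a => iter n D f1 a + iter n D f2 a).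
Proof.
move=> r1 r2; elim: n => //= n ->.
by rewrite translateD //; apply: regular_iter_translate.
Qed.

(* [p] is the restriction t |-> f (exp (t z)) of f to the one-parameter
   subgroup generated by [z]. *)
Definition expansion (f : G0 -> k) (p : {poly k}) :=
  regular f /\ forall n, p`_n * n`!%:R = iter n D f 1%g.

Lemma expansion_cst c : expansion (fun=> c) c%:P.
Proof.
split; first exact: regular_cst.
case=> [|n]; first by rewrite coefC eqxx mulr1.
rewrite coefC mul0r; suff -> : iter n.+1 D (fun=> c) = (fun=> 0) by [].
by elim: n => [|n IHn]; [exact: translate_cst | rewrite iterS IHn translate_cst].
Qed.

Lemma expansionD f1 f2 p q : expansion f1 p -> expansion f2 q ->
  expansion (fun a => f1 a + f2 a) (p + q).
Proof.
move=> [r1 E1] [r2 E2]; split; first exact: regularD.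
by move=> n; rewrite iter_translateD // -E1 -E2 coefD mulrDl.
Qed.

Lemma expansion_deriv f p : expansion f p -> expansion (D f) p^`().
Proof.
move=> [rf E]; split; first exact: regular_translate.
by move=> n; rewrite -iterSr -E coef_deriv -[_ *+ n.+1]mulr_natr factS natrM mulrA.
Qed.

Lemma expansionM f1 f2 p q : expansion f1 p -> expansion f2 q ->
  expansion (fun a => f1 a * f2 a) (p * q).
Proof.
move=> E1 E2; split; first by apply: regularM; [case: E1 | case: E2].
move=> n; elim: n f1 f2 p q E1 E2 => [|n IHn] f1 f2 p q E1 E2.
  have [[_ /(_ 0%N) /= <-] [_ /(_ 0%N) /= <-]] := (E1, E2).
  by rewrite !mulr1 coef0M.
have [r1 r2] : regular f1 /\ regular f2 by case: E1; case: E2.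
rewrite iterSr translateM // iter_translateD; last 2 first.
- by apply: regularM => //; apply: regular_translate.
- by apply: regularM => //; apply: regular_translate.
rewrite -(IHn _ _ _ _ E1 (expansion_deriv E2)) -(IHn _ _ _ _ (expansion_deriv E1) E2).
by rewrite -mulrDl -coefD addrC -derivM coef_deriv -[_ *+ n.+1]mulr_natr factS natrM mulrA.
Qed.

End Translate.

Variables (h z : g) (c : k).
Hypothesis h_even : h \in part g false.
Hypothesis z_even : z \in part g false.
Hypothesis c0 : c != 0.
Hypothesis hz : br h z = c *: z.
Local Notation D := (translate z).

(** [f] is a coefficient of a finite-dimensional representation, where z acts by [Zm z]. This matrix
    is an eigenvector of the commutator with [Zm h] for a nonzero eigenvalue, hence nilpotent, so
    the Taylor series of [f] along z is a polynomial. *)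
Lemma expansion_exists f : regular f -> exists p, expansion z f p.
Proof.
move=> rf; have [r [gv [m [w [fE gvM mM rg rm]]]]] := matrix_coefficients rf.
pose Zm (u : g) : 'M[k]_r := \matrix_(i, j) tangent u (fun a => m a i j).
have ZmM u v : u \in part g false -> v \in part g false ->
    Zm (br u v) = Zm u *m Zm v - Zm v *m Zm u.
  move=> ug vg; apply/matrixP=> i j; rewrite !mxE tangent_bracket //.
  have conv u' v' : u' \in part g false -> v' \in part g false ->
      convolution (tangent u') (tangent v') (fun a => m a i j) = (Zm u' *m Zm v') i j.
    move=> u'g v'g; rewrite /convolution mxE.
    have [tu tv] := (tangent_derivation u'g, tangent_derivation v'g).
    have -> : (fun a => tangent v' (fun b => m (a * b)%g i j)) =
              (fun a => \sum_l (Zm v') l j * m a i l).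
      apply: functional_extensionality => a.
      have -> : (fun b => m (a * b)%g i j) = (fun b => \sum_l m a i l * m b l j).
        by apply: functional_extensionality => b; rewrite mM mxE.
      rewrite (der_sum tv) => [|l]; last by apply: regularM; [exact: regular_cst|].
      by apply: eq_bigr => l _; rewrite (derZ tv) // mxE mulrC.
    rewrite (der_sum tu) => [|l]; last by apply: regularM; [exact: regular_cst|].
    by apply: eq_bigr => l _; rewrite (derZ tu) // [in RHS]mxE mulrC.
  by rewrite !conv // !mxE.
have Zc : Zm (c *: z) = c *: Zm z.
  apply/matrixP=> i j; rewrite !mxE -[c *: z]addr0 tangent_linear ?mem0v //.
  have -> : tangent 0 (fun a => m a i j) = 0; last by rewrite addr0.
  have := tangent_linear (-1) (mem0v (part g false)) (mem0v (part g false)) (rm i j).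
  by rewrite scaler0 addr0 mulN1r addNr.
pose NZ := linfun (mulmxr (Zm z) : 'rV[k]_r -> 'rV[k]_r).
pose HZ := linfun (mulmxr (Zm h) : 'rV[k]_r -> 'rV[k]_r).
have [N NZ0] : exists N, forall v, iter N NZ v = 0.
  apply: (weight_nilpotent char_k (H := HZ) (c := - c)); first by rewrite oppr_eq0.
  move=> v; rewrite !lfunE /= -!mulmxA.
  have := ZmM _ _ h_even z_even; rewrite hz Zc => /eqP.
  rewrite eq_sym subr_eq => /eqP ->.
  by rewrite mulmxDr -scalemxAr scaleNr addrC addKr.
have NZE v : NZ v = v *m Zm z by rewrite lfunE.
have tz := tangent_derivation z_even.
have Dlin a (u : 'cV[k]_r) : tangent z (fun b => (gv a *m m b *m u) 0 0) = (NZ (gv a) *m u) 0 0.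
  have -> : (fun b => (gv a *m m b *m u) 0 0) =
      (fun b => \sum_l \sum_i (gv a 0 i * u l 0) * m b i l).
    apply: functional_extensionality => b; rewrite mxE; apply: eq_bigr => l _.
    by rewrite mxE mulr_suml; apply: eq_bigr => i _; rewrite mulrAC.
  rewrite NZE mxE (der_sum tz) => [|l].
    apply: eq_bigr => l _; rewrite (der_sum tz) => [|i].
      rewrite mxE mulr_suml; apply: eq_bigr => i _.
      by rewrite (derZ tz) // mxE mulrAC.
    by apply: regularM; [exact: regular_cst|].
  by apply: regular_sum => i; apply: regularM; [exact: regular_cst|].
have Df n a : iter n D f a = (iter n NZ (gv a) *m w) 0 0.
  have pw j (v : 'rV[k]_r) : iter j NZ v *m w = v *m iter j (mulmx (Zm z)) w.
    by elim: j v => //= j IHj v; rewrite -iterS iterSr IHj NZE -mulmxA.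
  elim: n a => [//|n IHn] a; rewrite iterS /translate.
  have -> : (fun b => iter n D f (a * b)%g) =
      (fun b => (gv a *m m b *m iter n (mulmx (Zm z)) w) 0 0).
    by apply: functional_extensionality => b; rewrite IHn pw gvM.
  by rewrite Dlin -pw -iterSr.
exists (\poly_(i < N) (iter i D f 1%g / i`!%:R)); split=> // n.
have nf : n`!%:R != 0 :> k by rewrite natr_neq0 // fact_gt0.
rewrite coef_poly; case: ltnP => nN; first by rewrite divfK.
by rewrite mul0r Df -(subnKC nN) iterD NZ0 mul0mx mxE.
Qed.

(** The coordinates of the point are the values at t = 1 of the expansions of the coordinate
    functions. An equation of the group is the zero function on it, so its expansion is zero and the
    point satisfies it. *)
Theorem exponential : exists a : G0, forall N v,
  (forall v, iter N (br z) v = 0) ->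
  Ad a v = \sum_(i < N) (i`!%:R)^-1 *: iter i (br z) v.
Proof.
have [q Hq] := fin_all_exists (fun i => expansion_exists (regular_coord (G := G0) i)).
pose c1 i := (q i).[1].
have Hmp (P : {mpoly k[adim G0]}) : exists p, expansion z (fun a => P.@[coord a]) p /\ p.[1] = P.@[c1].
  pose good (f : G0 -> k) x := exists p, expansion z f p /\ p.[1] = x.
  have gcst x : good (fun=> x) x by exists x%:P; rewrite hornerC; split=> //; apply: expansion_cst.
  have gD f1 f2 x1 x2 : good f1 x1 -> good f2 x2 -> good (fun a => f1 a + f2 a) (x1 + x2).
    by move=> [p1 [E1 <-]] [p2 [E2 <-]]; exists (p1 + p2); rewrite hornerD; split=> //; apply: expansionD.
  have gM f1 f2 x1 x2 : good f1 x1 -> good f2 x2 -> good (fun a => f1 a * f2 a) (x1 * x2).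
    by move=> [p1 [E1 <-]] [p2 [E2 <-]]; exists (p1 * p2); rewrite hornerM; split=> //; apply: expansionM.
  have gext f1 f2 x1 x2 : (forall a, f1 a = f2 a) -> x1 = x2 -> good f1 x1 -> good f2 x2.
    by move=> /functional_extensionality -> ->.
  rewrite -/(good _ _); apply: (gext (fun a => \sum_(t <- msupp P) P@_t * \prod_i coord a i ^+ t i)
      _ (\sum_(t <- msupp P) P@_t * \prod_i c1 i ^+ t i)).
  - by move=> a; rewrite mevalE.
  - by rewrite mevalE.
  elim: (msupp P : seq _) => [|t s IHs].
    by apply: (gext) (gcst 0) => [a|]; rewrite big_nil.
  apply: (gext) => [a||]; [by rewrite big_cons | by rewrite big_cons |].
  apply: (gD) IHs; apply: (gM); first exact: gcst.
  elim: (index_enum _) => [|i s' IHs'].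
    by apply: (gext) (gcst 1) => [a|]; rewrite big_nil.
  apply: (gext) => [a||]; [by rewrite big_cons | by rewrite big_cons |].
  apply: (gM) IHs'; elim: (t i) => [|e IHe]; first by apply: (gext) (gcst 1).
  have gi : good (fun a => coord a i) (c1 i) by exists (q i).
  by apply: (gext) (gM _ _ _ _ gi IHe) => [a|]; rewrite exprS.
have coef0 p f : expansion z f p -> forall n, p`_n = (iter n D f 1%g) / n`!%:R.
  move=> [_ E] n; rewrite -E mulfK //.
  by rewrite natr_neq0 // fact_gt0.
have [a Da] : exists a : G0, coord a =1 c1.
  apply/coord_closed => P HP; have [p [Ep <-]] := Hmp P.
  have P0 : (fun a : G0 => P.@[coord a]) = (fun=> 0).
    apply: functional_extensionality => a.
    by apply: (iffLR (coord_closed _)) HP; exists a.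
  rewrite P0 in Ep; have E0 := expansion_cst z_even 0.
  suff -> : p = 0 by rewrite horner0.
  apply/polyP => n; rewrite (coef0 _ _ Ep) -(coef0 _ _ E0) //.
exists a => N v zN; apply: eq_by_functionals => phi.
have [Ad1 AdM Adreg] := Ad_rational G.
have [P HP] := Adreg phi v; have [p [Ep p1]] := Hmp P.
have Df n b : iter n D (fun a => phi (Ad a v)) b = phi (Ad b (iter n (br z) v)).
  elim: n b => [//|n IHn] b; rewrite iterS /translate.
  have -> : (fun b0 => iter n D (fun a0 => phi (Ad a0 v)) (b * b0)%g) =
     (fun b0 => [the {linear g -> k^o} of phi \o Ad b] (Ad b0 (iter n (br z) v))).
    by apply: functional_extensionality => b0; rewrite IHn AdM comp_lfunE.
  by rewrite -(Ad_differential z_even).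
have {}Df n : iter n D (fun a0 => P.@[coord a0]) 1%g = phi (iter n (br z) v).
  have -> : (fun a0 => P.@[coord a0]) = (fun a => phi (Ad a v)).
    by apply: functional_extensionality => b; rewrite HP.
  by rewrite Df Ad1 id_lfunE.
rewrite HP (meval_eq _ Da) -p1 (@horner_coef_wide _ N).
  rewrite linear_sum; apply: eq_bigr => i _.
  by rewrite (coef0 _ _ Ep) Df expr1n mulr1 linearZ /= mulrC.
apply/leq_sizeP => j Nj; rewrite (coef0 _ _ Ep) Df -(subnK Nj) iterD zN.
have -> : iter (j - N) (br z) 0 = 0 by elim: (_ - _)%N => //= l ->; rewrite linear0.
by rewrite linear0 mul0r.
Qed.

End Exponential.

(** * Triples in the even part *)

Section SuperBracket.
Variables (k : closedFieldType) (g : lieSuperalgebra k).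
Local Notation br := (bracket g).
Local Notation g0 := (part g false).
Local Notation g1 := (part g true).

Lemma brDl u v w : br (u + v) w = br u w + br v w.
Proof. by rewrite linearD add_lfunE. Qed.

Lemma brZl c u w : br (c *: u) w = c *: br u w.
Proof. by rewrite linearZ scale_lfunE. Qed.

Lemma brNl u w : br (- u) w = - br u w.
Proof. by rewrite linearN opp_lfunE. Qed.

Lemma br0l w : br 0 w = 0.
Proof. by rewrite linear0 lfunE. Qed.

Lemma even_anti u v : u \in g0 -> br u v = - br v u.
Proof.
move=> ug; rewrite -(parity_projD false v) linearD brDl opprD /=.
by congr (_ + _); rewrite (bracket_anti ug (parity_proj_mem _ v)) scale1r.
Qed.

Lemma even_jacobi u v w : u \in g0 -> br u (br v w) = br (br u v) w + br v (br u w).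
Proof.
move=> ug; rewrite -(parity_projD false v) !(linearD, brDl) /= addrACA.
by congr (_ + _); rewrite (bracket_jacobi w ug (parity_proj_mem _ v)) scale1r.
Qed.

Lemma odd_sym u v : u \in g1 -> v \in g1 -> br u v = br v u.
Proof. by move=> ug vg; rewrite (bracket_anti ug vg) expr1 scaleN1r opprK. Qed.

Lemma odd_jacobi u v w : u \in g1 -> v \in g1 ->
  br u (br v w) = br (br u v) w - br v (br u w).
Proof. by move=> ug vg; rewrite (bracket_jacobi w ug vg) expr1 scaleN1r. Qed.

Lemma parity_proj_br b u w : u \in g0 -> parity_proj g b (br u w) = br u (parity_proj g b w).
Proof.
move=> ug; rewrite -{1}(parity_projD b w) !linearD /=.
have := bracket_parity ug (parity_proj_mem b w) => /= E1.
have := bracket_parity ug (parity_proj_mem (~~ b) w) => /= E2.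
by rewrite (parity_proj_id E1) (parity_proj_eq0 E2) addr0.
Qed.

End SuperBracket.

Section JacobsonMorozov.
Variable k : closedFieldType.
Hypothesis char_k : [pchar k] =i pred0.
Variable G : supergroup k.
Hypothesis G_qred : quasi_reductive G.
Local Notation g := (lie G).
Local Notation br := (bracket g).
Local Notation g0 := (part g false).

Let even_closed u v : u \in g0 -> v \in g0 -> br u v \in g0.
Proof. by move=> ug vg; apply: bracket_parity ug vg. Qed.

Lemma even_self u : u \in g0 -> br u u = 0.
Proof.
move=> ug; have /eqP := even_anti u ug; rewrite -addr_eq0 -mulr2n -scaler_nat.
by rewrite scaler_eq0 (negPf (natr_neq0 char_k _)) //= => /eqP.
Qed.

Section EvenPart.
Let L := subvs_of g0.
Let ad (u : L) : 'End(L) := (linfun (vsproj g0) \o br (vsval u) \o linfun vsval)%VF.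

Let adE u v : vsval (ad u v) = br (vsval u) (vsval v).
Proof. by rewrite !comp_lfunE !lfunE /= vsprojK // even_closed ?subvsP. Qed.

Lemma even_square_surj f : nilpotent_element f ->
  exists2 z, z \in g0 & br f (br f z) = f.
Proof.
move=> [fD [N fN]].
have ad_linear c u v : ad (c *: u + v) = c *: ad u + ad v.
  apply/lfunP=> w; apply: subvs_inj; rewrite add_lfunE scale_lfunE adE [RHS]linearP /= !adE.
  by rewrite brDl brZl.
have ad_anti u v : ad u v = - ad v u.
  by apply: subvs_inj; rewrite linearN /= !adE even_anti ?subvsP.
have ad_jacobi u v w : ad u (ad v w) = ad (ad u v) w + ad v (ad u w).
  by apply: subvs_inj; rewrite linearD /= !adE even_jacobi ?subvsP.
pose vl : 'Hom(L, g) := linfun vsval.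
have vlE v : vl v = vsval v by rewrite lfunE.
have complement (Z : {vspace L}) : ideal ad Z -> exists W : {vspace L},
    [/\ ideal ad W, (Z + W)%VS = fullv & (Z :&: W)%VS = 0%VS].
  move=> Zid; pose U := (vl @: Z)%VS.
  have sU : even_stable (M := adjoint_module g) U.
    move=> u m ug /memv_imgP [z zZ ->]; rewrite vlE.
    have -> : act (adjoint_module g) u (vsval z) = vl (ad (vsproj g0 u) z).
      by rewrite vlE adE vsprojK.
    by rewrite memv_img // Zid.
  have sg0 : even_stable (M := adjoint_module g) g0 by move=> u m; apply: even_closed.
  have Ug0 : (U <= g0)%VS by apply/subvP=> _ /memv_imgP [z _ ->]; rewrite vlE subvsP.
  have [W [sW UW UW0]] := even_complement_of G_qred (Ad_rational G) (M := adjoint_module g)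
    (@Ad_differential k G) (@Ad_bracket k G) sg0 Ug0 sU.
  have WgP m : m \in W -> m \in g0 by rewrite -UW; apply: (subvP (addvSr _ _)).
  exists (vl @^-1: W)%VS; split.
  - by move=> u v; rewrite -!memv_preim !vlE adE; apply: sW; apply: subvsP.
  - apply/eqP; rewrite eqEsubv subvf; apply/subvP=> v _.
    have : vsval v \in (U + W)%VS by rewrite UW subvsP.
    case/memv_addP=> _ /memv_imgP [z zZ ->] [w wW Dv].
    have -> : v = z + vsproj g0 w.
      by apply: subvs_inj; rewrite Dv vlE linearD /= vsprojK // WgP.
    by apply: memv_add => //; rewrite -memv_preim vlE vsprojK // WgP.
  apply/eqP; rewrite -subv0; apply/subvP=> v; rewrite memv_cap -memv_preim vlE.
  move=> /andP [vZ vW]; have : vsval v \in (U :&: W)%VS.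
    by rewrite memv_cap vW -vlE memv_img.
  by rewrite UW0 !memv0 => /eqP v0; apply/eqP; apply: subvs_inj; rewrite v0.
pose P w := w \in g0 /\ in_derived ad (vsproj g0 w).
have Pl : lin_closed P.
  apply: lin_closed_and; first exact: lin_closed_vspace.
  have [d0 dD] := in_derived_closed ad_linear.
  by split=> [|c u v Hu Hv]; rewrite ?linear0 ?linearP //; apply: dD.
have [D DP] := vspace_of_pred Pl.
have /DP [fg Df] : f \in D.
  apply: subvP fD; apply/span_subvP=> _ /allpairsP [[u v] /= [/vbasis_mem ug /vbasis_mem vg ->]].
  apply/DP; split; first exact: even_closed.
  exists [:: (vsproj g0 u, vsproj g0 v)]; rewrite big_seq1 /=.
  by apply: subvs_inj; rewrite adE !vsprojK // even_closed.
have fnil : exists N, forall v, iter N (ad (vsproj g0 f)) v = 0.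
  exists N => v; apply: subvs_inj; rewrite linear0 -[RHS](fN (vsval v)) ?subvsP //.
  by elim: (N) => //= j IHj; rewrite adE IHj vsprojK.
have [z fz] := jacobson_morozov_square char_k ad_linear ad_anti ad_jacobi complement Df fnil.
exists (vsval z); first exact: subvsP.
by have := congr1 vsval fz; rewrite !adE !vsprojK.
Qed.

End EvenPart.

Lemma adjoint_semisimple s : semisimple_element s ->
  forall m, br s (br s m) = 0 -> br s m = 0.
Proof.
move=> ss m; have := @semisimple_act k G G_qred (adjoint_module g) _ (Ad_rational G)
  (@Ad_differential k G) (@Ad_bracket k G) s ss m.
exact.
Qed.

(** g_0 is the direct sum of the kernel and the image of ad s, both preserved by ad f; the component
    in the kernel of any solution is again a solution. *)
Lemma centralizing_square_surj s f : semisimple_element s -> nilpotent_element f ->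
  f \in g0 -> br s f = 0 ->
  exists z, [/\ z \in g0, br s z = 0 & br f (br f z) = f].
Proof.
move=> ss nf fg sf; have [sg _] := ss.
have [z zg fz] := even_square_surj nf.
pose P := (g0 :&: lker (br s))%VS; pose Q := (br s @: g0)%VS.
have Qg : (Q <= g0)%VS by apply/subvP=> _ /memv_imgP [v vg ->]; apply: even_closed.
have PQ0 : (P :&: Q = 0)%VS.
  apply/eqP; rewrite -subv0; apply/subvP=> v; rewrite !memv_cap memv_ker memv0.
  by move=> /andP [/andP [_ /eqP sv] /memv_imgP [q _ Dv]];
    rewrite Dv adjoint_semisimple // -Dv.
have PQ : (P + Q)%VS = g0.
  apply/eqP; rewrite eqEdim subv_add capvSl Qg /=.
  by rewrite dimv_disjoint_sum // limg_ker_dim.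
have sF v : br s (br f v) = br f (br s v) by rewrite even_jacobi // sf br0l add0r.
have : z \in (P + Q)%VS by rewrite PQ.
case/memv_addP=> p; rewrite memv_cap memv_ker => /andP [pg /eqP sp].
case=> _ /memv_imgP [q qg ->] Dz; exists p; split=> //.
apply/eqP; rewrite -subr_eq0 -memv0 -PQ0 memv_cap; apply/andP; split.
  by rewrite memv_cap memv_ker memvB ?even_closed // linearB /= !sF sp sf !linear0 ?addr0.
have -> : br f (br f p) - f = - br s (br f (br f q)).
  have Df : f = br f (br f p) + br f (br f (br s q)) by rewrite -{1}fz Dz !linearD.
  by rewrite {3}Df opprD addrA subrr sub0r !sF.
by rewrite memvN memv_img // !even_closed.
Qed.

(** [h, z] - 2z commutes with f, and ad h - 2 is invertible on the centralizer of f in g_0, whose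
    weights are at most 0. Subtracting the preimage from z gives weight 2. *)
Lemma morozov z h f : nilpotent_element f -> f \in g0 -> z \in g0 -> h \in g0 ->
  br z f = h -> br h f = - (2%:R *: f) -> exists e, sl2_triple e h f.
Proof.
move=> [_ [N fN]] fg zg hg zf hf.
have HF v : v \in g0 -> br h (br f v) = br f (br h v) - 2%:R *: br f v.
  by move=> _; rewrite even_jacobi // hf brNl brZl addrC.
have ZF v : v \in g0 -> br z (br f v) = br f (br z v) + br h v.
  by move=> _; rewrite even_jacobi // zf addrC.
pose t := br h z - 2%:R *: z.
have tg : t \in g0 by rewrite memvB ?memvZ ?even_closed.
have ft : br f t = 0.
  have fz : br f z = - h by rewrite even_anti // zf.
  have fh : br f h = 2%:R *: f by rewrite even_anti // hf opprK.
  rewrite linearB linearZ /= even_jacobi // fh brZl fz.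
  by rewrite [br h (- h)]linearN /= even_self // oppr0 addr0 subrr.
have c2 (i : nat) : 2%:R != - i%:R :> k by rewrite -addr_eq0 -natrD natr_neq0.
have [u [ug fu _] Hu] := ker_weight_surj char_k (Z := br z) (H := br h)
  (fun v => even_closed zg (v := v)) (fun v => even_closed hg (v := v))
  (fun v => even_closed fg (v := v)) HF ZF fN (c := 2%:R)
  c2 tg ft.
exists (z - u); split; first by rewrite memvB.
split=> //.
- have Hz : br h z = t + 2%:R *: z by rewrite subrK.
  apply: (addIr (br h u)); rewrite linearB /= subrK Hz -Hu scalerBr.
  by rewrite [LHS]addrC addrA addrAC.
- by rewrite linearB add_lfunE opp_lfunE zf (even_anti f ug) fu oppr0 oppr0 addr0.
Qed.

End JacobsonMorozov.

(* An identity between sums holds after applying any linear functional, where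
   [ring] decides it. *)
Ltac additive_ring := apply: eq_by_functionals => phi; rewrite !(linearD, linearN) /=; ring.

Section Triples.
Variable k : closedFieldType.
Hypothesis char_k : [pchar k] =i pred0.
Variable G : supergroup k.
Hypothesis G_qred : quasi_reductive G.
Local Notation g := (lie G).
Local Notation br := (bracket g).
Local Notation g0 := (part g false).
Local Notation g1 := (part g true).

Lemma triple_exists s f : semisimple_element s -> nilpotent_element f ->
  f \in g0 -> br s f = 0 -> exists e h, sl2_triple e h f /\ br s h = 0.
Proof.
move=> ss nf fg sf; have [sg _] := ss.
have [p [pg sp fp]] := centralizing_square_surj char_k G_qred ss nf fg sf.
(* The factor -2 turns [f, [f, p]] = f into [h, f] = -2f. *)
pose z := - (2%:R *: p); pose h := br z f.
have zg : z \in g0 by rewrite memvN memvZ.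
have hg : h \in g0 := bracket_parity zg fg.
have hf : br h f = - (2%:R *: f).
  have -> : h = 2%:R *: br f p by rewrite /h brNl brZl (even_anti f pg) scalerN opprK.
  by rewrite brZl even_anti ?fp ?scalerN //; apply: (bracket_parity fg pg).
have [e he] := morozov char_k nf fg zg hg erefl hf.
exists e, h; split=> //; rewrite /h even_jacobi // sf linear0 addr0.
by rewrite /z linearN linearZ /= sp scaler0 oppr0 br0l.
Qed.

Section SquareExpansion.

Lemma square_sub (u v : g) : br u u - br v v = br u (u - v) + br (u - v) v.
Proof. by rewrite [br u (u - v)]linearB brDl brNl addrA subrK. Qed.

Lemma odd_square_add (u v : g) : u \in g1 -> v \in g1 ->
  br (u + v) (u + v) = br u u + 2%:R *: br u v + br v v.
Proof.
by move=> ug vg; rewrite brDl !linearD /= (odd_sym vg ug) scaler_nat mulr2n !addrA.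
Qed.

End SquareExpansion.

Section OneTriple.
Variables e h f : g.
Hypothesis triple : sl2_triple e h f.

Let eg : e \in g0. Proof. by case: triple => [[]]. Qed.
Let hg : h \in g0. Proof. by case: triple => [[]]. Qed.
Let fg : f \in g0. Proof. by case: triple => [[]]. Qed.
Let he : br h e = 2%:R *: e. Proof. by case: triple => _ []. Qed.
Let hf : br h f = - (2%:R *: f). Proof. by case: triple => _ []. Qed.
Let ef : br e f = h. Proof. by case: triple => _ []. Qed.

Section OnModule.
Variable M : superModule g.

Lemma act_hf v : act M h (act M f v) = act M f (act M h v) - 2%:R *: act M f v.
Proof.
have := act_even_bracket v hg fg; rewrite hf linearN linearZ opp_lfunE scale_lfunE.
by move=> ->; rewrite addrC subrK.
Qed.

Lemma act_ef v : act M e (act M f v) = act M f (act M e v) + act M h v.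
Proof. by have := act_even_bracket v eg fg; rewrite ef => ->; rewrite addrC subrK. Qed.

Lemma act_he v : act M h (act M e v) = act M e (act M h v) + 2%:R *: act M e v.
Proof.
have := act_even_bracket v hg eg; rewrite he linearZ scale_lfunE => ->.
by rewrite addrC subrK.
Qed.

Lemma act_f_nilpotent : exists N, forall v, iter N (act M f) v = 0.
Proof.
apply: (weight_nilpotent char_k (H := act M h) (c := - 2%:R)).
  by rewrite oppr_eq0 natr_neq0.
by move=> v; rewrite act_hf scaleNr.
Qed.

End OnModule.

Let Mg := adjoint_module g.

Lemma ad_hf v : br h (br f v) = br f (br h v) - 2%:R *: br f v.
Proof. exact: (act_hf (M := Mg) v). Qed.

Lemma ad_ef v : br e (br f v) = br f (br e v) + br h v.
Proof. exact: (act_ef (M := Mg) v). Qed.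

Lemma ad_he v : br h (br e v) = br e (br h v) + 2%:R *: br e v.
Proof. exact: (act_he (M := Mg) v). Qed.

Local Notation low := (low fullv (br f)).

Let S T : forall v : g, v \in fullv -> br T v \in fullv.
Proof. by move=> v _; apply: memvf. Qed.
Let HF v (_ : v \in fullv) := ad_hf v.
Let ZF v (_ : v \in fullv) := ad_ef v.
Let HZ v (_ : v \in fullv) := ad_he v.

Lemma ad_f_nilpotent : exists N, forall v, v \in fullv -> iter N (br f) v = 0.
Proof. by have [N fN] := act_f_nilpotent Mg; exists N => v _; apply: fN. Qed.

Lemma ad_weight_low i u : br f u = 0 -> br h u = - i%:R *: u -> low i u.
Proof. exact: (weight_low char_k (S e) (S h) (S f) HF ZF (memvf u)). Qed.

Lemma ad_low_weight_eq0 j c u : low j u -> br h u = c *: u ->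
  (forall l, (j <= l)%N -> c != - l%:R) -> u = 0.
Proof.
have [N fN] := ad_f_nilpotent.
exact: (low_weight_eq0 char_k (S e) (S h) (S f) HF ZF fN).
Qed.

Lemma ad_low_decompose m w : low m w -> exists N (ws : nat -> g),
  [/\ forall i, low i (ws i) /\ br h (ws i) = - i%:R *: ws i,
      forall i, (i < m)%N -> ws i = 0 & w = \sum_(i < N) ws i].
Proof.
have [N fN] := ad_f_nilpotent => lw.
have [ws [? ? ?]] := low_decompose char_k (S e) (S h) (S f) HF ZF fN lw.
by exists N, ws.
Qed.

Lemma ad_low_h j u : low j u -> low j (br h u).
Proof. exact: (low_H char_k (S e) (S h) (S f) HF ZF). Qed.

Lemma ad_decomposition_exists u : br f u = 0 -> exists us, ad_decomposition h u us.
Proof.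
move=> fu; have [N [us [usP _ Du]]] := ad_low_decompose (low0 (memvf u) fu).
exists (mkseq us N); split=> [|i].
  rewrite -(big_mkord xpredT (fun i => (mkseq us N)`_i)) size_mkseq big_mkord Du.
  by apply: eq_bigr => i _; rewrite nth_mkseq.
case: (ltnP i N) => iN; last by rewrite nth_default ?size_mkseq // linear0 scaler0 oppr0.
by rewrite nth_mkseq // (usP i).2 scaleNr.
Qed.

Lemma ad_invariant u : br f u = 0 -> br h u = 0 -> br e u = 0.
Proof.
move=> fu hu; have h0 : br h u = - 0%:R *: u by rewrite hu oppr0 scale0r.
apply: (ad_low_weight_eq0 (j := 0) (c := 2%:R)).
- apply: low0; first exact: memvf.
  have := lower_raised (S e) ZF HZ 0 (memvf _) fu h0.
  by rewrite /= subrr mulr0 scale0r.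
- by rewrite ad_he hu linear0 add0r.
by move=> l _; rewrite -addr_eq0 -natrD natr_neq0.
Qed.

(** The filtration is multiplicative: brackets of lowest weight vectors are killed by f and their
    weights add. Quadratic identities can thus be compared term by term. *)
Lemma low_bracket i j u v : low i u -> low j v -> low (i + j) (br u v).
Proof.
have lc := low_closed (@fullv _ g) (br f).
move=> lu lv; have [m [us [usP us0 ->]]] := ad_low_decompose lu.
have [n [vs [vsP vs0 ->]]] := ad_low_decompose lv.
rewrite linear_sum; apply: (lin_closed_sum (lc _)) => b _.
rewrite linear_sum /= sum_lfunE; apply: (lin_closed_sum (lc _)) => a _.
case: (leqP i a) => ia; last by rewrite us0 // br0l; apply: (lin_closed0 (lc _)).
case: (leqP j b) => jb; last by rewrite vs0 // linear0; apply: (lin_closed0 (lc _)).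
apply: (low_le (S f) (leq_add ia jb)).
have [[_ fu _] hu] := usP a; have [[_ fv _] hv] := vsP b.
apply: ad_weight_low.
  by rewrite even_jacobi // fu fv br0l linear0 addr0.
by rewrite even_jacobi // hu hv brZl linearZ /= -scalerDl natrD opprD.
Qed.

Lemma low_parity_proj b m v : low m v -> low m (parity_proj g b v).
Proof.
move=> [_ fv [u _ Dv]]; split; rewrite ?memvf //.
  by rewrite -parity_proj_br // fv linear0.
exists (parity_proj g b u); rewrite ?memvf // Dv; elim: (m) => //= j <-.
by rewrite parity_proj_br.
Qed.

(** The component of weight -m comes without a parity, hence the projection to the odd part. *)
Lemma low_leading_odd m d : d \in g1 -> low m d -> exists w,
  [/\ w \in g1, low m w, br h w = - m%:R *: w & low m.+1 (d - w)].
Proof.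
move=> dg ld; have lc := low_closed (@fullv _ g) (br f).
have [N [ws [wsP ws0 Dd]]] := ad_low_decompose ld.
have [w [lw hw ldw]] : exists w, [/\ low m w, br h w = - m%:R *: w & low m.+1 (d - w)].
  case: (ltnP m N) => mN; last first.
    exists 0; split; rewrite ?linear0 ?scaler0 //; first exact: (lin_closed0 (lc m)).
    by rewrite Dd big1 ?addr0 => [|i _]; [apply: (lin_closed0 (lc _)) | rewrite ws0 // (leq_trans _ mN)].
  exists (ws m); have [lw hw] := wsP m; split=> //.
  rewrite Dd (bigD1 (Ordinal mN)) //= addrAC subrr add0r.
  apply: (lin_closed_sum (lc _)) => i im; case: (ltnP i m) => ltim.
    by rewrite ws0 //; exact: (lin_closed0 (lc m.+1)).
  apply: (low_le (S f) _ (wsP i).1); rewrite ltn_neqAle ltim andbT.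
  by rewrite eq_sym (_ : (_ == _) = (i == Ordinal mN)).
exists (parity_proj g true w); split; first exact: parity_proj_mem.
- exact: low_parity_proj.
- by rewrite -parity_proj_br // hw linearZ.
have -> : d - parity_proj g true w = parity_proj g true (d - w).
  by rewrite linearB /= (parity_proj_id dg).
exact: low_parity_proj.
Qed.

Section Decomposition.
Variable s : g.
Hypothesis sg : s \in g0.
Hypothesis sh : br s h = 0.
Hypothesis sf : br s f = 0.

(** [s, e] is killed by f and has weight 2, while weights on Ker f are at most 0. *)
Lemma centralizes_e : br s e = 0.
Proof.
apply: (ad_low_weight_eq0 (j := 0) (c := 2%:R)).
- apply: low0; rewrite ?memvf // even_jacobi // (even_anti s fg) sf oppr0 br0l add0r.
  rewrite (even_anti e fg) ef linearN /= sh oppr0 //.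
- by rewrite even_jacobi // (even_anti s hg) sh oppr0 br0l add0r he linearZ.
by move=> l _; rewrite -addr_eq0 -natrD natr_neq0.
Qed.

Variables (x : g) (xs : seq g).
Hypothesis xg : x \in g1.
Hypothesis sx : br s x = 0.
Hypothesis fx : br f x = 0.
Hypothesis xsP : ad_decomposition h x xs.

(** Being odd, commuting with f and commuting with s are linear conditions stable under ad h, so
    they pass from x to its components. *)
Let component (P : g -> Prop) : lin_closed P -> (forall w, P w -> P (br h w)) -> P x ->
  forall i, P xs`_i.
Proof.
move=> Pl Ph Px i; case: (ltnP i (size xs)) => ix; last first.
  by rewrite nth_default //; apply: lin_closed0 Pl.
have [Dx hxs] := xsP; rewrite Dx in Px.
apply: (@lin_closed_components _ _ (br h) P (fun i => - i%:R) _ _ Pl Ph _ _ Px) => //.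
- by move=> a b /oppr_inj /eqP; rewrite (natr_eq_nat char_k) => /eqP.
- by move=> j; rewrite hxs scaleNr.
Qed.

Lemma component_odd i : xs`_i \in g1.
Proof.
apply: (component (P := fun w => w \in g1)) => //; first exact: lin_closed_vspace.
by move=> w wg; apply: (bracket_parity hg wg).
Qed.

Lemma component_f i : br f xs`_i = 0.
Proof.
apply: (component (P := fun w => br f w = 0)) => //.
  by split=> [|c u v fu fv]; rewrite ?linear0 // linearP /= fu fv scaler0 addr0.
by move=> w fw; have := ad_hf w; rewrite fw linear0 scaler0 subr0 => <-.
Qed.

Lemma component_s i : br s xs`_i = 0.
Proof.
apply: (component (P := fun w => br s w = 0)) => //.
  by split=> [|c u v fu fv]; rewrite ?linear0 // linearP /= fu fv scaler0 addr0.
by move=> w sw; rewrite even_jacobi // sh br0l sw linear0 addr0.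
Qed.

Lemma component_h i : br h xs`_i = - i%:R *: xs`_i.
Proof. by have [_ ->] := xsP; rewrite scaleNr. Qed.

Lemma component_low i : low i xs`_i.
Proof. exact: ad_weight_low (component_f i) (component_h i). Qed.

Lemma component_tail n : low n (x - \sum_(i < n) xs`_i).
Proof.
have -> : x = \sum_(i < n + size xs) xs`_i.
  rewrite addnC big_split_ord /= [X in _ + X]big1 ?addr0; first by case: xsP.
  by move=> i _; rewrite nth_default // leq_addr.
rewrite big_split_ord /= addrAC subrr add0r.
apply: (lin_closed_sum (low_closed _ _ n)) => i _.
exact: (low_le (S f) (leq_addr _ _) (component_low _)).
Qed.

End Decomposition.
End OneTriple.
End Triples.

(** * The odd element x on Ker s in a module *)

Section OddElementOnModules.
Variable k : closedFieldType.
Hypothesis char_k : [pchar k] =i pred0.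
Variable G : supergroup k.
Hypothesis G_qred : quasi_reductive G.
Local Notation g := (lie G).
Local Notation br := (bracket g).
Local Notation g0 := (part g false).
Local Notation g1 := (part g true).
Variables x s f : g.
Hypothesis xg : x \in g1.
Hypothesis x_jordan : jordan_decomposition (2%:R^-1 *: br x x) s f.

Let two0 : 2%:R != 0 :> k. Proof. exact: natr_neq0. Qed.

Let ss : semisimple_element s. Proof. by case: x_jordan. Qed.
Let nf : nilpotent_element f. Proof. by case: x_jordan. Qed.
Let sf : br s f = 0. Proof. by case: x_jordan. Qed.
Let sg : s \in g0. Proof. by case: ss. Qed.

Lemma square_decomposition : br x x = 2%:R *: (s + f).
Proof. by case: x_jordan => <- _ _ _; rewrite scalerA mulfV // scale1r. Qed.

Lemma nilpotent_part_even : f \in g0.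
Proof.
have -> : f = 2%:R^-1 *: br x x - s by case: x_jordan => -> _ _ _; rewrite addrC addKr.
by rewrite memvB // memvZ // (bracket_parity xg xg).
Qed.
Let fg := nilpotent_part_even.

(** [nilpotent_element] concerns ad f on g_0; on a module, nilpotency comes from a triple, in which
    f has weight -2. *)
Lemma nilpotent_part_act (M : superModule g) :
  exists N, forall v, iter N (act M f) v = 0.
Proof.
case: (eqVneq f 0) => [->|_]; first by exists 1%N => v; rewrite /= linear0 lfunE.
have [e [h [tr _]]] := triple_exists char_k G_qred ss nf fg sf.
exact: act_f_nilpotent tr M.
Qed.

Lemma odd_square_act (M : superModule g) v :
  act M x (act M x v) = act M s v + act M f v.
Proof.
have := act_bracket v xg xg; rewrite square_decomposition expr1 scaleN1r opprK.
rewrite linearZ linearD scale_lfunE add_lfunE -mulr2n -scaler_nat.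
by move/(scalerI two0).
Qed.

Lemma iter_semisimple (V : vectType k) (T : 'End(V)) n v :
  (forall m, T (T m) = 0 -> T m = 0) -> iter n.+1 T v = 0 -> T v = 0.
Proof. by move=> HT; elim: n => // n IHn /HT /IHn. Qed.

Lemma odd_cube : br x (br x x) = 0.
Proof.
have := odd_jacobi x xg xg; rewrite (even_anti x (bracket_parity xg xg)) => /eqP.
rewrite -subr_eq0 opprB opprK addrA addrC => /eqP E.
have : 3%:R *: br x (br x x) = 0 by rewrite -[RHS]E scaler_nat !mulrS mulr0n addr0.
by move/eqP; rewrite scaler_eq0 (negPf (natr_neq0 char_k _)) //= => /eqP.
Qed.

Let square_parts : br s x + br f x = 0.
Proof.
have := even_anti x (bracket_parity xg xg : br x x \in g0).
rewrite odd_cube oppr0 square_decomposition brZl brDl => /eqP.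
by rewrite scaler_eq0 (negPf two0) => /eqP.
Qed.

(* Here br s x = - br f x, where br f is nilpotent and br s is semisimple. *)
Lemma semisimple_part_commutes : br s x = 0.
Proof.
have [N fN] := nilpotent_part_act (adjoint_module g).
apply: (iter_semisimple (n := N) (adjoint_semisimple G_qred ss)).
have sF v : br s (br f v) = br f (br s v) by rewrite even_jacobi // sf br0l add0r.
suff E n : iter n (br s) x = (-1) ^+ n *: iter n (br f) x.
  rewrite E iterS -[iter N _ _]/(iter N (act (adjoint_module g) f) x) fN.
  by rewrite linear0 scaler0.
elim: n => [|n IHn]; first by rewrite scale1r.
rewrite iterS IHn linearZ /= (_ : br s (iter n (br f) x) = iter n (br f) (br s x)).
  move/eqP: square_parts; rewrite addr_eq0 => /eqP ->.
  rewrite exprSr mulrN1 scaleNr -scalerN; congr (_ *: _).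
  by elim: (n) => //= j ->; rewrite linearN.
by elim: (n) => //= j IHj; rewrite sF IHj.
Qed.
Let sx := semisimple_part_commutes.

Lemma nilpotent_part_commutes : br f x = 0.
Proof. by rewrite -[RHS]square_parts sx add0r. Qed.
Let fx := nilpotent_part_commutes.

Lemma ker_s_stable (M : superModule g) b u v : u \in part g b -> br s u = 0 ->
  v \in lker (act M s) -> act M u v \in lker (act M s).
Proof.
rewrite !memv_ker => ug su /eqP sv; have := act_even_bracket v sg ug.
by rewrite su linear0 lfunE /= sv linear0 subr0 => <-.
Qed.

Lemma odd_nilpotent_on_ker (M : superModule g) :
  exists N, forall v, v \in lker (act M s) -> iter N (act M x) v = 0.
Proof.
have [N fN] := nilpotent_part_act M; exists N.*2 => v vU.
suff -> : iter N.*2 (act M x) v = iter N (act M f) v by [].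
have fU w : w \in lker (act M s) -> act M f w \in lker (act M s).
  exact: (ker_s_stable fg sf).
have : forall j, iter j (act M f) v \in lker (act M s) by elim=> //= j; apply: fU.
move=> jU; elim: (N) => //= j ->; rewrite odd_square_act.
by have := jU j; rewrite memv_ker => /eqP ->; rewrite add0r.
Qed.

Section WithTriple.
Variables (e h : g) (xs : seq g).
Hypothesis tr : sl2_triple e h f.
Hypothesis sh : br s h = 0.
Hypothesis xsP : ad_decomposition h x xs.
Variable M : superModule g.
Local Notation U := (lker (act M s)).

Let eg : e \in g0. Proof. by case: tr => [[]]. Qed.
Let hg : h \in g0. Proof. by case: tr => [[]]. Qed.
Let se : br s e = 0. Proof. exact: (centralizes_e char_k tr sh sf). Qed.
Let xsg i : xs`_i \in g1. Proof. exact: (component_odd char_k tr xg xsP). Qed.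
Let xss i : br s xs`_i = 0. Proof. exact: (component_s char_k sg sh sx xsP). Qed.
Let xsf i : br f xs`_i = 0. Proof. exact: (component_f char_k tr fx xsP). Qed.

Let ZU v : v \in U -> act M e v \in U. Proof. exact: (ker_s_stable eg se). Qed.
Let HU v : v \in U -> act M h v \in U. Proof. exact: (ker_s_stable hg sh). Qed.
Let FU v : v \in U -> act M f v \in U. Proof. exact: (ker_s_stable fg sf). Qed.
Let XU v : v \in U -> act M x v \in U. Proof. exact: (ker_s_stable xg sx). Qed.
Let XsU i v : v \in U -> act M xs`_i v \in U. Proof. exact: (ker_s_stable (xsg i) (xss i)). Qed.
Let HF v (_ : v \in U) := act_hf tr (M := M) v.
Let ZF v (_ : v \in U) := act_ef tr (M := M) v.
Let HZ v (_ : v \in U) := act_he tr (M := M) v.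

Let XX v : v \in U -> act M x (act M x v) = act M f v.
Proof. by rewrite memv_ker odd_square_act => /eqP ->; rewrite add0r. Qed.

Let XsF i v : v \in U -> act M f (act M xs`_i v) = act M xs`_i (act M f v).
Proof.
move=> _; have := act_even_bracket v fg (xsg i); rewrite xsf linear0 lfunE /= => /esym/eqP.
by rewrite subr_eq0 => /eqP.
Qed.

Let HXs i v : v \in U ->
  act M h (act M xs`_i v) = act M xs`_i (act M h v) - i%:R *: act M xs`_i v.
Proof.
move=> _; have := act_even_bracket v hg (xsg i).
rewrite (component_h xsP i) scaleNr linearN linearZ opp_lfunE scale_lfunE => ->.
by rewrite addrC subrK.
Qed.

Let Xsum v : v \in U -> act M x v = \sum_(i < (size xs).+2) act M xs`_i v.
Proof.
move=> _; have [Dx _] := xsP; rewrite {1}Dx linear_sum /= sum_lfunE.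
by rewrite !big_ord_recr /= !nth_default // linear0 !lfunE /= !addr0.
Qed.

Lemma neat_operator_attractor : neat_operator (act M x) U <->
  (forall v, v \in U -> act M xs`_0 v = 0).
Proof.
have [N fN] := nilpotent_part_act M; have {}fN v (_ : v \in U) := fN v.
have [N' xN] := odd_nilpotent_on_ker M.
have low0P := neat_low char_k (Z := act M e) (H := act M h) (F := act M f) (X := act M x)
  (Xs := fun i => act M xs`_i) ZU HU FU HF ZF fN XU XX XsU XsF HXs Xsum.
apply: (iff_trans (neat_operatorP XU xN)); apply: (iff_trans low0P).
split=> [X0|X0 w wU _]; last exact: X0.
apply: (intertwiner_eq0 char_k ZU HU FU HF ZF fN HZ) => // v vU.
have h0 : br h xs`_0 = 0 by rewrite (component_h xsP 0) oppr0 scale0r.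
have := act_even_bracket v eg (xsg 0); rewrite (ad_invariant char_k tr (xsf 0) h0).
by rewrite linear0 lfunE /= => /esym/eqP; rewrite subr_eq0 => /eqP ->.
Qed.

Lemma balanced_operator_of_component : xs`_1 = 0 -> balanced_operator (act M x) U.
Proof.
move=> x1; have [N fN] := nilpotent_part_act M; have {}fN v (_ : v \in U) := fN v.
have [N' xN] := odd_nilpotent_on_ker M.
apply/(balanced_operatorP XU xN).
apply: (balanced_of_low char_k (Xs := fun i => act M xs`_i) ZU HU FU HF ZF fN XU XX XsU XsF HXs Xsum).
by move=> w _ _; rewrite x1 linear0 lfunE.
Qed.

Lemma balanced_operator_exact i w : balanced_operator (act M x) U ->
  w \in U -> act M f w = 0 -> act M h w = - i%:R *: w -> act M xs`_0 w = 0 ->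
  exists t, [/\ t \in U, act M f t = 0, act M h t = - i.+1%:R *: t &
                act M xs`_1 w = act M xs`_0 t].
Proof.
have [N fN] := nilpotent_part_act M; have {}fN v (_ : v \in U) := fN v.
have [N' xN] := odd_nilpotent_on_ker M.
move/(balanced_operatorP XU xN) => bal.
exact: (balanced_low_exact char_k (Xs := fun i => act M xs`_i) ZU HU FU HF ZF fN XU XX XsU XsF HXs Xsum bal).
Qed.

End WithTriple.
End OddElementOnModules.

(** * The components of an odd element *)

Section ConjugacyToLeadingTerm.
Variable k : closedFieldType.
Hypothesis char_k : [pchar k] =i pred0.
Variable G : supergroup k.
Local Notation g := (lie G).
Local Notation br := (bracket g).
Local Notation g0 := (part g false).
Local Notation g1 := (part g true).
Local Notation low f := (low fullv (br f)).

Variables e h f y : g.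
Hypothesis tr : sl2_triple e h f.
Hypothesis yg : y \in g1.
Hypothesis fy : br f y = 0.
Hypothesis hy : br h y = - 1%:R *: y.
Hypothesis yy : br y y = 2%:R *: f.

Let eg : e \in g0. Proof. by case: tr => [[]]. Qed.
Let hg : h \in g0. Proof. by case: tr => [[]]. Qed.
Let fg : f \in g0. Proof. by case: tr => [[]]. Qed.
Let he : br h e = 2%:R *: e. Proof. by case: tr => _ []. Qed.
Let ef : br e f = h. Proof. by case: tr => _ []. Qed.
Let lc m := low_closed (@fullv _ g) (br f) m.
Let fS v (_ : v \in fullv) := memvf (br f v).

Let ly : low f 1 y. Proof. exact: (ad_weight_low char_k tr fy hy). Qed.

(* The vector w is the leading term of x' - y, and z is the even element of
   weight 1 - m with [z, y] = - w provided by [y, [e, y]] = h. *)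
Lemma conjugacy_step m x' : (1 < m)%N -> x' \in g1 -> br x' x' = 2%:R *: f ->
  low f m (x' - y) -> exists a : even_group G,
    [/\ Ad a x' \in g1, br (Ad a x') (Ad a x') = 2%:R *: f & low f m.+1 (Ad a x' - y)].
Proof.
move=> m1 xg xx; move Dd: (x' - y) => d ld.
have Dx : x' = y + d by rewrite -Dd addrC subrK.
have dg : d \in g1 by rewrite -Dd memvB.
have m0 : m%:R != 0 :> k by case: (m) m1 => // j _; apply: natr_neq0.
have [w [wg lw hw ldw]] := low_leading_odd char_k tr dg ld.
have yw : br y w = 0.
  have wyw : br h (br y w) = - m.+1%:R *: br y w.
    rewrite even_jacobi // hy hw brZl linearZ /= -scalerDl -opprD -natrD add1n //.
  apply: (ad_low_weight_eq0 char_k tr (j := m.+2) _ wyw) => [|l ml]; last first.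
    by rewrite eqr_opp (natr_eq_nat char_k) ltn_eqF.
  (* x' and y have the same square, so [y, d] = - [d, d] / 2 is in [low (m + m)], and m + m >= m +
     2. Hence [y, w], of weight -(m+1), is in [low m.+2]. *)
  have -> : br y w = - (2%:R^-1 *: br d d) - br y (d - w).
    suff yd : br y d = - (2%:R^-1 *: br d d) by rewrite -yd [br y (d - w)]linearB /= opprB addrC subrK.
    apply/eqP; rewrite -addr_eq0.
    suff /eqP : 2%:R *: (br y d + 2%:R^-1 *: br d d) = 0.
      by rewrite scaler_eq0 (negPf (natr_neq0 char_k _)).
    rewrite scalerDr scalerA mulfV ?(natr_neq0 char_k) // scale1r.
    apply: (addrI (br y y)); rewrite addr0 [RHS]yy -xx Dx brDl !linearD /=.
    by rewrite (odd_sym dg yg) scaler_nat mulr2n !addrA.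
  apply: (lin_closedB (lc _)); last first.
    exact: (low_bracket char_k tr ly ldw).
  apply: (lin_closedN (lc _)); apply: (lin_closedZ (lc _)).
  apply: (low_le fS _ (low_bracket char_k tr ld ld)).
  by rewrite -addn2 leq_add2l.
pose Y := br e y; have Yg : Y \in g1 := bracket_parity eg yg.
have fY : br f Y = y.
  by rewrite even_jacobi // fy linear0 addr0 (even_anti e fg) ef brNl hy scaleN1r opprK.
have hY : br h Y = Y.
  by rewrite even_jacobi // he hy brZl scaleN1r linearN /= scaler_nat mulr2n addrK.
have yY : br y Y = h.
  have := even_jacobi y y eg; rewrite yy linearZ /= ef (odd_sym _ yg) // -mulr2n -scaler_nat.
  by move/(scalerI (natr_neq0 char_k (isT : 0 < 2)%N)) => <-.
(* From [y, Y] = h and [y, w] = 0 one gets [y, [Y, w]] = [h, w] = - m w, which fixes the factor. The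
   weight 1 - m is nonzero for m > 1, as [exponential] requires. *)
pose z := - (m%:R^-1 *: br Y w).
have zg : z \in g0 by rewrite memvN memvZ // (bracket_parity Yg wg).
have [_ fw _] := lw.
have fz : br f z = 0.
  by rewrite linearN linearZ /= even_jacobi // fY yw fw linear0 addr0 scaler0 oppr0.
have hz : br h z = - m.-1%:R *: z.
  have hYw : br h (br Y w) = - m.-1%:R *: br Y w.
    rewrite even_jacobi // hY hw [br Y (_ *: _)]linearZ /= -{1}[br Y w]scale1r -scalerDl.
    by congr (_ *: _); case: (m) m1 => // j _; rewrite mulrS opprD addrA subrr add0r.
  by rewrite [br h z]linearN /= [br h (_ *: _)]linearZ /= hYw scalerN scalerA mulrC -scalerA.
have zy : br z y = - w.
  rewrite even_anti // linearN linearZ /= odd_jacobi // yY yw linear0 subr0 hw.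
  by rewrite opprK scalerA mulrN mulVf // scaleN1r.
have lz : low f m.-1 z := ad_weight_low char_k tr fz hz.
have c0 : - m.-1%:R != 0 :> k.
  by rewrite oppr_eq0; case: (m) m1 => [|[|j]] // _; apply: natr_neq0.
have [N zN] : exists N, forall v, iter N (br z) v = 0.
  apply: (weight_nilpotent char_k c0 (H := br h)) => v.
  by rewrite even_jacobi // hz brZl addrC.
have [a aP] := exponential char_k hg zg c0 hz; exists a.
have zf0 j : br z (iter j (br z) f) = 0.
  by elim: j => [|j /= ->]; rewrite ?linear0 //= even_anti // fz oppr0.
(* Fixing f keeps the square of the new element equal to f, so that the step can be repeated. *)
have Df : Ad a f = f.
  rewrite (aP N.+1) => [|v]; last by rewrite iterS zN linear0.
  rewrite big_ord_recl big1 /= ?invr1 ?scale1r ?addr0 // => i _.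
  by rewrite zf0 scaler0.
split; first exact: Ad_parity.
  by rewrite -Ad_bracket xx linearZ /= Df.
have zx : br z x' = - w + br z d by rewrite Dx linearD /= zy.
have lzd : low f m.+1 (br z d).
  apply: (low_le fS _ (low_bracket char_k tr lz ld)).
  by case: (m) m1 => [|[|j]] // _; rewrite /= addSn ltnS leq_addl.
(* Already the second iterate is in [low (m.-1 + m)], and 2m - 1 >= m + 1. *)
have lzz i : low f m.+1 (iter i.+2 (br z) x').
  elim: i => [|i IHi].
    rewrite /= zx; apply: (low_le fS _ (low_bracket char_k tr lz (_ : low f m _))).
      by case: (m) m1 => [|[|j]] // _; rewrite /= addSn ltnS leq_addl.
    apply: (lin_closedD (lc _)); first exact: (lin_closedN (lc _)).
    exact: (low_le fS (leqnSn _) lzd).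
  by rewrite iterS; apply: (low_le fS (leq_addl _ _) (low_bracket char_k tr lz IHi)).
rewrite (aP N.+2) => [|v]; last by rewrite !iterS zN !linear0.
rewrite 2!big_ord_recl /= invr1 !scale1r zx.
have -> t : x' + (- w + br z d + t) - y = (d - w) + br z d + t.
  by rewrite -Dd; additive_ring.
apply: (lin_closedD (lc _)); first exact: (lin_closedD (lc _) ldw lzd).
by apply: (lin_closed_sum (lc _)) => i _; apply: (lin_closedZ (lc _)); apply: lzz.
Qed.

Lemma conjugate_leading m x' : (1 < m)%N -> x' \in g1 -> br x' x' = 2%:R *: f ->
  low f m (x' - y) -> exists a : even_group G, Ad a x' = y.
Proof.
have [N fN] := ad_f_nilpotent char_k tr; have [Ad1 AdM _] := Ad_rational G.
have [n] : exists n, (N <= m + n)%N by exists N; rewrite leq_addl.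
elim: n m x' => [|n IHn] m x' Nm m1 xg xx ld.
  exists 1%g; rewrite Ad1 lfunE; apply/eqP; rewrite -subr_eq0 /=.
  by rewrite (low_vanish fS fN _ ld) // -(addn0 m).
have [a [xg' xx' ld']] := conjugacy_step m1 xg xx ld.
have [b Db] := IHn m.+1 _ (etrans (congr1 _ (addSnnS _ _)) Nm) (ltnW m1) xg' xx' ld'.
by exists (b * a)%g; rewrite AdM comp_lfunE.
Qed.

End ConjugacyToLeadingTerm.

(** * Attractors, conjugacy and balancedness of x *)

Section OddElement.
Variable k : closedFieldType.
Hypothesis char_k : [pchar k] =i pred0.
Variable G : supergroup k.
Hypothesis G_qred : quasi_reductive G.
Local Notation g := (lie G).
Local Notation br := (bracket g).
Local Notation g0 := (part g false).
Local Notation g1 := (part g true).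
Variables x s f : g.
Hypothesis xg : x \in g1.
Hypothesis x_jordan : jordan_decomposition (2%:R^-1 *: br x x) s f.
Local Notation low := (low fullv (br f)).

Let two0 : 2%:R != 0 :> k. Proof. exact: natr_neq0. Qed.
Let ss : semisimple_element s. Proof. by case: x_jordan. Qed.
Let nf : nilpotent_element f. Proof. by case: x_jordan. Qed.
Let sf : br s f = 0. Proof. by case: x_jordan. Qed.
Let sg : s \in g0. Proof. by case: ss. Qed.
Let xx : br x x = 2%:R *: (s + f). Proof. exact: square_decomposition x_jordan. Qed.
Let fg : f \in g0. Proof. exact: nilpotent_part_even xg x_jordan. Qed.
Let sx : br s x = 0. Proof. exact: (semisimple_part_commutes char_k G_qred xg x_jordan). Qed.
Let fx : br f x = 0. Proof. exact: (nilpotent_part_commutes char_k G_qred xg x_jordan). Qed.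
Let lc m := low_closed (@fullv _ g) (br f) m.
Let fS v (_ : v \in fullv) := memvf (br f v).

Lemma decomposed_triple_exists : exists e h xs,
  [/\ sl2_triple e h f, br s h = 0 & ad_decomposition h x xs].
Proof.
have [e [h [tr sh]]] := triple_exists char_k G_qred ss nf fg sf.
have [xs xsP] := ad_decomposition_exists char_k tr fx.
by exists e, h, xs.
Qed.

Lemma attractor_exists : exists y, attractor s f x y.
Proof.
case: (eqVneq f 0) => [f0|/eqP f0]; first by exists x; left.
by have [e [h [xs [tr sh xsP]]]] := decomposed_triple_exists; exists xs`_0; right;
  split=> //; exists e, h, xs.
Qed.

Section WithTriple.
Variables (e h : g) (xs : seq g).
Hypothesis tr : sl2_triple e h f.
Hypothesis sh : br s h = 0.
Hypothesis xsP : ad_decomposition h x xs.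

Let eg : e \in g0. Proof. by case: tr => [[]]. Qed.
Let hg : h \in g0. Proof. by case: tr => [[]]. Qed.
Let he : br h e = 2%:R *: e. Proof. by case: tr => _ []. Qed.
Let hf : br h f = - (2%:R *: f). Proof. by case: tr => _ []. Qed.
Let ef : br e f = h. Proof. by case: tr => _ []. Qed.
Let xsg i : xs`_i \in g1. Proof. exact: (component_odd char_k tr xg xsP). Qed.
Let xss i : br s xs`_i = 0. Proof. exact: (component_s char_k sg sh sx xsP). Qed.
Let xsf i : br f xs`_i = 0. Proof. exact: (component_f char_k tr fx xsP). Qed.
Let xsh i : br h xs`_i = - i%:R *: xs`_i. Proof. exact: (component_h xsP). Qed.
Let xsl i : low i xs`_i. Proof. exact: (component_low char_k tr fx xsP). Qed.

Let lf : low 2 f.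
Proof.
apply: (ad_weight_low char_k tr); first exact: (even_self char_k fg).
by rewrite hf scaleNr.
Qed.

Let lx : low 0 x. Proof. exact: low0 (memvf _) fx. Qed.

Let tail1 : low 1 (x - xs`_0).
Proof. by have := component_tail char_k tr fx xsP 1; rewrite big_ord1. Qed.

Let tail2 : low 2 (x - (xs`_0 + xs`_1)).
Proof. by have := component_tail char_k tr fx xsP 2; rewrite !big_ord_recl big_ord0 addr0. Qed.

Let tail3 : low 3 (x - (xs`_0 + xs`_1 + xs`_2)).
Proof.
by have := component_tail char_k tr fx xsP 3; rewrite !big_ord_recl big_ord0 addr0 addrA.
Qed.

Let component_bracket_h i j :
  br h (br xs`_i xs`_j) = - (i + j)%:R *: br xs`_i xs`_j.
Proof.
by rewrite even_jacobi // !xsh brZl linearZ /= -scalerDl -opprD -natrD.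
Qed.

Let low_weight0 j c u : low j u -> br h u = - c%:R *: u -> (c < j)%N -> u = 0.
Proof.
move=> lu hu cj; apply: (ad_low_weight_eq0 char_k tr lu hu) => l jl.
by rewrite eqr_opp (natr_eq_nat char_k) ltn_eqF // (leq_trans cj).
Qed.

Let hs : br h s = 0. Proof. by rewrite even_anti // sh oppr0. Qed.

Let square_tail j b : low j (x - b) -> low j (br x x - br b b).
Proof.
move=> lb; rewrite square_sub; have lb0 : low 0 b.
  have := lin_closedB (lc 0) lx (low_le fS (leq0n j) lb).
  by rewrite opprB addrC subrK.
apply: (lin_closedD (lc _)); first exact: (low_bracket char_k tr lx lb).
by rewrite -[j]addn0; apply: (low_bracket char_k tr lb lb0).
Qed.

(** The weight 0 part of [x, x] = 2(s + f), s having weight 0 and f weight -2; the next two lemmas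
    are the weights -1 and -2. Each difference of the two sides lies one step too deep in the
    filtration for its weight. *)
Lemma component_zero_square : br xs`_0 xs`_0 = 2%:R *: s.
Proof.
apply/eqP; rewrite -subr_eq0; apply/eqP.
apply: (low_weight0 (j := 1) (c := 0)) => //; last first.
  by rewrite linearB linearZ /= hs component_bracket_h !oppr0 !scale0r scaler0 subr0.
have -> : br xs`_0 xs`_0 - 2%:R *: s = 2%:R *: f - (br x x - br xs`_0 xs`_0).
  by rewrite xx scalerDr; additive_ring.
apply: (lin_closedB (lc _)); last exact: square_tail.
by apply: (lin_closedZ (lc _)); apply: (low_le fS _ lf).
Qed.

Lemma component_zero_one : br xs`_0 xs`_1 = 0.
Proof.
apply: (low_weight0 (j := 2) (c := 1)) => //.
suff : low 2 (2%:R *: br xs`_0 xs`_1).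
  by move/(lin_closedZ (lc 2) 2%:R^-1); rewrite scalerA mulVf // scale1r.
have -> : 2%:R *: br xs`_0 xs`_1 = 2%:R *: f -
    (br x x - br (xs`_0 + xs`_1) (xs`_0 + xs`_1)) - br xs`_1 xs`_1.
  rewrite xx odd_square_add // component_zero_square scalerDr.
  by additive_ring.
apply: (lin_closedB (lc _)); last exact: (low_bracket char_k tr (xsl 1) (xsl 1)).
apply: (lin_closedB (lc _)); last exact: square_tail.
exact: (lin_closedZ (lc _)).
Qed.

Lemma component_one_square : f = br xs`_0 xs`_2 + 2%:R^-1 *: br xs`_1 xs`_1.
Proof.
pose D := 2%:R *: f - 2%:R *: br xs`_0 xs`_2 - br xs`_1 xs`_1.
suff D0 : D = 0.
  apply: (scalerI two0); rewrite scalerDr scalerA mulfV // scale1r.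
  by apply/eqP; rewrite -subr_eq0 opprD addrA -/D D0.
apply: (low_weight0 (j := 3) (c := 2)) => //; last first.
  have wl : lin_closed (fun v => br h v = - 2%:R *: v).
    split=> [|c u v hu hv]; first by rewrite linear0 scaler0.
    by rewrite linearP /= hu hv scalerDr !scalerA mulrC.
  apply: (lin_closedB wl); last exact: component_bracket_h.
  apply: (lin_closedB wl); apply: (lin_closedZ wl); last exact: component_bracket_h.
  by rewrite hf scaleNr.
have -> : D = (br x x - br (xs`_0 + xs`_1 + xs`_2) (xs`_0 + xs`_1 + xs`_2)) +
    2%:R *: br xs`_1 xs`_2 + br xs`_2 xs`_2.
  rewrite xx odd_square_add ?memvD // odd_square_add // component_zero_square.
  rewrite component_zero_one scaler0 addr0 !scalerDr brDl scalerDr /D.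
  by additive_ring.
apply: (lin_closedD (lc _)); last first.
  by apply: (low_le fS _ (low_bracket char_k tr (xsl 2) (xsl 2))).
apply: (lin_closedD (lc _)); first exact: square_tail.
by apply: (lin_closedZ (lc _)); apply: (low_bracket char_k tr (xsl 1) (xsl 2)).
Qed.

Lemma attractor_eq0_semisimple : xs`_0 = 0 -> s = 0.
Proof.
move=> x0; have := component_zero_square; rewrite x0 linear0 => /esym/eqP.
by rewrite scaler_eq0 (negPf two0) => /eqP.
Qed.

(** Once x_0 and s vanish, x_(-1) has the same square f as x, and x - x_(-1) is in [low 2], where
    [conjugate_leading] starts. *)
Lemma attractor_eq0_conjugate : xs`_0 = 0 -> exists a : even_group G, Ad a x = xs`_1.
Proof.
move=> x0; have s0 := attractor_eq0_semisimple x0.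
have yy : br xs`_1 xs`_1 = 2%:R *: f.
  by rewrite component_one_square x0 br0l add0r scalerA mulfV // scale1r.
apply: (conjugate_leading char_k tr (xsg 1) (xsf 1) (xsh 1) yy (m := 2)) => //.
  by rewrite xx s0 add0r.
by have := tail2; rewrite x0 add0r.
Qed.

(* Exactness on the adjoint module provides v with [x_0, v] = f, whence an
   even z of weight -1 with [x_0, z] = - 3 x_1; then x has no component of
   weight -1 with respect to h + z / 3. *)
Lemma component_one_removal : (exists2 t, br s t = 0 &
    [/\ br f t = 0, br h t = - 2%:R *: t & br xs`_1 xs`_1 = br xs`_0 t]) ->
  exists e' h' xs', [/\ sl2_triple e' h' f, br s h' = 0,
                        ad_decomposition h' x xs' & xs'`_1 = 0].
Proof.
move=> [t st [ft ht Dt]].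
(* [t] need not be homogeneous; its odd part satisfies the same equations. The factor 1/2 is that of
   f = [x_0, x_2] + [x_1, x_1] / 2, where [x_1, x_1] = [x_0, t]. *)
pose t1 := parity_proj g true t; pose v := xs`_2 + 2%:R^-1 *: t1.
have t1g : t1 \in g1 := parity_proj_mem true t.
have vg : v \in g1 by rewrite memvD ?memvZ.
have fv : br f v = 0.
  by rewrite linearD linearZ /= -parity_proj_br // ft xsf linear0 scaler0 addr0.
have sv : br s v = 0.
  by rewrite linearD linearZ /= -parity_proj_br // st xss linear0 scaler0 addr0.
have hv : br h v = - 2%:R *: v.
  rewrite linearD linearZ /= -parity_proj_br // ht xsh [parity_proj _ _ _]linearZ /=.
  by rewrite scalerDr !scalerA mulrC.
have x0t : br xs`_0 t1 = br xs`_1 xs`_1.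
  have x11 : br xs`_1 xs`_1 \in part g false := bracket_parity (xsg 1) (xsg 1).
  have x0t1 : br xs`_0 t1 \in part g false := bracket_parity (xsg 0) t1g.
  have x0t0 := bracket_parity (xsg 0) (parity_proj_mem false t).
  rewrite -[RHS](parity_proj_id x11) Dt -{1}(parity_projD true t) linearD linearD /=.
  by rewrite (parity_proj_id x0t1) (parity_proj_eq0 x0t0) addr0.
have x0v : br xs`_0 v = f by rewrite linearD linearZ /= x0t -component_one_square.
clearbody v; have x0e : br e xs`_0 = 0.
  by apply: (ad_invariant char_k tr (xsf 0)); rewrite xsh oppr0 scale0r.
have fe w : br f w = 0 -> br f (br e w) = - br h w.
  by move=> fw; rewrite even_jacobi // fw linear0 addr0 (even_anti e fg) ef brNl.
pose u := br e v; pose y := br e xs`_1.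
have ug : u \in g1 := bracket_parity eg vg.
have yg : y \in g1 := bracket_parity eg (xsg 1).
have fu : br f u = 2%:R *: v by rewrite fe // hv scaleNr opprK.
have fy : br f y = xs`_1 by rewrite fe // xsh scaleN1r opprK.
have hu : br h u = 0 by rewrite even_jacobi // he hv brZl linearZ /= scaleNr subrr.
have hy : br h y = y.
  by rewrite even_jacobi // he xsh brZl scaleN1r linearN /= scaler_nat mulr2n addrK.
have x0u : br xs`_0 u = h.
  by have := even_jacobi xs`_0 v eg; rewrite x0v ef x0e br0l add0r => <-.
have x0y : br xs`_0 y = 0.
  by have := even_jacobi xs`_0 xs`_1 eg; rewrite component_zero_one x0e br0l add0r linear0.
have se : br s e = 0 := centralizes_e char_k tr sh sf.
have scomm a b : br s a = 0 -> br s b = 0 -> br s (br a b) = 0.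
  by move=> sa sb; rewrite even_jacobi // sa sb br0l linear0 addr0.
have [su sy] : br s u = 0 /\ br s y = 0 by rewrite !scomm.
(* As [f, u] = 2v and [f, y] = x_1, the coefficient 2 makes z commute with f. *)
clearbody u y; pose z := br u xs`_1 - 2%:R *: br v y.
have zg : z \in g0.
  by rewrite memvB ?memvZ // ?(bracket_parity ug (xsg 1)) ?(bracket_parity vg yg).
have fz : br f z = 0.
  rewrite /z linearB linearZ /= (even_jacobi _ _ fg) (even_jacobi v y fg) fu xsf fv fy.
  by rewrite br0l linear0 addr0 add0r brZl subrr.
have sz : br s z = 0.
  by rewrite /z linearB /= [br s (_ *: _)]linearZ /= !scomm // scaler0 oppr0 addr0.
have hz : br h z = - 1%:R *: z.
  rewrite /z linearB linearZ /= (even_jacobi _ _ hg) (even_jacobi v y hg) hu hv hy xsh.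
  rewrite br0l add0r !scaleN1r linearN /= brZl scaleNr !scaler_nat !mulr2n.
  by additive_ring.
(* The two terms of z contribute [h, x_1] = - x_1 and - 2 [f, y] = - 2 x_1. *)
have x0z : br xs`_0 z = - (3%:R *: xs`_1).
  rewrite /z linearB linearZ /= (odd_jacobi _ (xsg 0) ug) (odd_jacobi y (xsg 0) vg).
  rewrite x0u x0v component_zero_one x0y !linear0 !addr0.
  by rewrite xsh fy scaleN1r !scaler_nat !mulrS mulr0n; additive_ring.
clearbody z; have lz : low 1 z := ad_weight_low char_k tr fz hz.
(* z has weight -1 and so is in the image of ad f. Then [e - v0 / 3, f] = h + z / 3, and [morozov]
   completes the new triple. *)
have [v0 v0g zv0] : exists2 v0, v0 \in g0 & z = br f v0.
  have [_ _ [v0 _ Dz]] := lz; exists (parity_proj g false v0); first exact: parity_proj_mem.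
  by rewrite -parity_proj_br // -[br f v0]Dz parity_proj_id.
have three0 : 3%:R != 0 :> k by apply: natr_neq0.
pose h' := h + 3%:R^-1 *: z; pose z' := e - 3%:R^-1 *: v0.
have h'g : h' \in g0 by rewrite memvD ?memvZ.
have z'g : z' \in g0 by rewrite memvB ?memvZ.
have z'f : br z' f = h'.
  by rewrite brDl brNl brZl ef (even_anti f v0g) -zv0 scalerN opprK.
have h'f : br h' f = - (2%:R *: f).
  by rewrite brDl brZl (even_anti f zg) fz oppr0 scaler0 addr0.
have sh' : br s h' = 0 by rewrite linearD linearZ /= sh sz scaler0 addr0.
have h'E w : br h' w = br h w + 3%:R^-1 *: br z w by rewrite brDl brZl.
have [e' tr'] := morozov char_k nf fg z'g h'g z'f h'f.
have [xs' xsP'] := ad_decomposition_exists char_k tr' fx.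
exists e', h', xs'; split=> //.
clearbody h'; have lzx1 : low 2 (br z xs`_1) := low_bracket char_k tr lz (xsl 1).
(* In weight -1 the contributions [h, x_1] = - x_1 and [z, x_0] / 3 = x_1 cancel. *)
have h'x : low 2 (br h' x).
  have -> : x = xs`_0 + xs`_1 + (x - (xs`_0 + xs`_1)) by rewrite addrC subrK.
  move: (x - _) tail2 => r lr.
  have -> : br h' (xs`_0 + xs`_1 + r) = 3%:R^-1 *: br z xs`_1 + (br h r + 3%:R^-1 *: br z r).
    have x0z' : br z xs`_0 = 3%:R *: xs`_1 by rewrite even_anti // x0z opprK.
    rewrite !linearD /= !h'E x0z' scalerA mulVf // !xsh oppr0 scale0r scale1r scaleN1r.
    by additive_ring.
  apply: (lin_closedD (lc _)); first exact: (lin_closedZ (lc _)).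
  apply: (lin_closedD (lc _)); first exact: (ad_low_h char_k tr lr).
  apply: (lin_closedZ (lc _)).
  by apply: (low_le fS _ (low_bracket char_k tr lz lr)).
have x1h : br h' xs'`_1 = - 1%:R *: xs'`_1 := component_h xsP' 1.
apply: (ad_low_weight_eq0 char_k tr' (j := 2) _ x1h) => [|l l2]; last first.
  by rewrite eqr_opp (natr_eq_nat char_k) ltn_eqF.
have := component_tail char_k tr' fx xsP' 2; rewrite !big_ord_recl big_ord0 addr0 /= => lr.
(* h' kills the new component of weight 0 and negates that of weight -1. The filtration depends on f
   only, so the bound found with h serves for h'. *)
have -> : xs'`_1 = br h' (x - (xs'`_0 + xs'`_1)) - br h' x.
  by rewrite !linearB linearD /= x1h (component_h xsP' 0) oppr0 scale0r scaleN1r; additive_ring.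
by apply: (lin_closedB (lc _)) => //; apply: (ad_low_h char_k tr').
Qed.

End WithTriple.

Lemma square_act_eq0 (M : superModule g) : f = 0 -> forall v, v \in lker (act M s) ->
  act M x (act M x v) = 0.
Proof.
move=> f0 v; rewrite memv_ker (odd_square_act char_k xg x_jordan) f0 linear0 lfunE addr0.
by move=> /eqP.
Qed.

Lemma lker_act0 (M : superModule g) : s = 0 -> lker (act M s) = fullv.
Proof. by move=> ->; apply/vspaceP=> v; rewrite memv_ker linear0 lfunE eqxx memvf. Qed.

Lemma neat_attractor y : neat s x -> attractor s f x y -> y = 0.
Proof.
move=> [s0 neatM] [[f0 ->]|[_ [e [h [xs [tr sh xsP ->]]]]]].
  apply: (faithful_odd G_qred xg) => M /neatM.
  rewrite -(lker_act0 M s0).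
  have [N xN] := odd_nilpotent_on_ker char_k G_qred xg x_jordan M.
  have XU v : v \in lker (act M s) -> act M x v \in lker (act M s).
    exact: (ker_s_stable x_jordan xg sx).
  move/(neat_operatorP XU xN) => neat_x; apply/lfunP=> v; rewrite zero_lfunE.
  have vU : v \in lker (act M s) by rewrite lker_act0 ?memvf.
  (* [x] squares to zero here, and a neat operator has no block of size 2. *)
  have /memv_imgs [u uU ->] : act M x v \in imgs (act M x) 2 (lker (act M s)).
    apply: (neat_x 0); last exact: square_act_eq0.
    by apply/memv_imgs; exists v.
  exact: square_act_eq0.
apply: (faithful_odd G_qred (component_odd char_k tr xg xsP 0)) => M /neatM.
rewrite -(lker_act0 M s0).
move/(neat_operator_attractor char_k G_qred xg x_jordan tr sh xsP M) => x0.
by apply/lfunP=> v; rewrite zero_lfunE x0 // lker_act0 ?memvf.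
Qed.

Lemma attractor_neat : (forall y, attractor s f x y -> y = 0) -> neat s x.
Proof.
move=> att0; case: (eqVneq f 0) => [f0|/eqP f0].
  have x0 : x = 0 by apply: att0; left.
  have s0 : s = 0.
    by move/eqP: xx; rewrite f0 addr0 x0 linear0 eq_sym scaler_eq0 (negPf two0) => /eqP.
  split=> // M _; rewrite x0 linear0.
  have N1 (v : M) : v \in fullv -> iter 1 (0 : 'End(M)) v = 0 by rewrite /= lfunE.
  apply/(neat_operatorP (fun v _ => memvf _) N1) => j w /memv_imgs [v _ ->] _.
  by rewrite iterS lfunE mem0v.
have [e [h [xs [tr sh xsP]]]] := decomposed_triple_exists.
have x0 : xs`_0 = 0 by apply: att0; right; split=> //; exists e, h, xs.
have s0 : s = 0 := attractor_eq0_semisimple tr sh xsP x0.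
split=> // M _; rewrite -(lker_act0 M s0).
apply/(neat_operator_attractor char_k G_qred xg x_jordan tr sh xsP M) => v _.
by rewrite x0 linear0 lfunE.
Qed.

Lemma balanced_strongly : balanced s x -> strongly_balanced s f x.
Proof.
move=> bal; case: (eqVneq f 0) => [f0|/eqP f0].
  left; rewrite /homological xx f0 addr0; have [_ [b bB bs]] := ss.
  split; first by rewrite memvZ.
  by exists b => // v /bs [c sv]; exists (2%:R * c); rewrite brZl sv scalerA.
right; split=> //; have [e [h [xs [tr sh xsP]]]] := decomposed_triple_exists.
apply: (component_one_removal tr sh xsP).
have x1s : xs`_1 \in lker (act (adjoint_module g) s).
  by rewrite memv_ker; apply/eqP; apply: (component_s char_k sg sh sx xsP).
have [t [st ft ht Dt]] := balanced_operator_exact char_k G_qred xg x_jordan tr sh xsP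
  (bal _ (adjoint_in_Rep G)) x1s (component_f char_k tr fx xsP 1) (component_h xsP 1)
  (component_zero_one tr sh xsP).
by exists t => //; apply/eqP; rewrite -memv_ker.
Qed.

(** [homological] says that [x, x] is semisimple, which is not literally f = 0. On Ker s it acts by
    2f, both nilpotent and semisimple, hence by zero. *)
Lemma homological_act (M : superModule g) v : in_Rep M -> homological x ->
  v \in lker (act M s) -> act M x (act M x v) = 0.
Proof.
move=> [rho [rho_rat _ rho_diff rho_act]] xxs vU.
have [N fN] := nilpotent_part_act char_k G_qred xg x_jordan M.
have fU w : w \in lker (act M s) -> act M f w \in lker (act M s).
  exact: (ker_s_stable x_jordan fg sf).
have cE w : w \in lker (act M s) -> act M (br x x) w = 2%:R *: act M f w.
  by rewrite memv_ker xx linearZ linearD scale_lfunE add_lfunE /= => /eqP ->; rewrite add0r.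
have iU n : iter n (act M f) v \in lker (act M s) by elim: n => //= n; apply: fU.
have iE n : iter n (act M (br x x)) v = 2%:R ^+ n *: iter n (act M f) v.
  elim: n => [|n IHn]; first by rewrite scale1r.
  by rewrite iterS IHn linearZ /= cE // scalerA -exprSr.
have c0 : act M (br x x) v = 0.
  apply: (iter_semisimple (n := N)).
    exact: (semisimple_act G_qred rho_rat rho_diff rho_act xxs).
  by rewrite iterS iE fN scaler0 linear0.
rewrite (odd_square_act char_k xg x_jordan); move: vU; rewrite memv_ker => sv.
by rewrite (eqP sv) add0r; apply: (scalerI two0); rewrite scaler0 -cE // memv_ker.
Qed.

Lemma strongly_balanced_balanced : strongly_balanced s f x -> balanced s x.
Proof.
move=> sbal M MRep; case: sbal => [xxs|[_ [e [h [xs [tr sh xsP x1]]]]]].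
  have [N xN] := odd_nilpotent_on_ker char_k G_qred xg x_jordan M.
  have XU v : v \in lker (act M s) -> act M x v \in lker (act M s).
    exact: (ker_s_stable x_jordan xg sx).
  (* [x] squares to zero on Ker s, so only blocks of sizes 1 and 2 occur. *)
  apply/(balanced_operatorP XU xN) => j w /memv_imgs [v vU ->] _.
  rewrite !iterS homological_act ?mem0v //.
  by elim: j.*2 => //= n; apply: XU.
exact: (balanced_operator_of_component char_k G_qred xg x_jordan tr sh xsP M x1).
Qed.

End OddElement.

Theorem proposition2 (k : closedFieldType) (char_k : [pchar k] =i pred0)
    (G : supergroup k) (G_qred : quasi_reductive G) (x s f : lie G)
    (x_odd : x \in part (lie G) true)
    (x_jordan : jordan_decomposition (2%:R^-1 *: bracket (lie G) x x) s f) :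
  ((neat s x <-> (forall y : lie G, attractor s f x y <-> y = 0)) /\
   (neat s x -> f <> 0 ->
      forall e h : lie G, sl2_triple e h f -> bracket (lie G) s h = 0 ->
      exists xs : seq (lie G), ad_decomposition h x xs /\
        exists a : even_group G, Ad a x = xs`_1)) /\
  (balanced s x <-> strongly_balanced s f x).
Proof.
have to_att := neat_attractor char_k G_qred x_odd x_jordan.
have fx := nilpotent_part_commutes char_k G_qred x_odd x_jordan.
split; last first.
  split; first exact: (balanced_strongly char_k G_qred x_odd x_jordan).
  exact: (strongly_balanced_balanced char_k G_qred x_odd x_jordan).
split=> [|neat_x f0 e h tr sh].
  split=> [neat_x y|att0].
    split=> [/(to_att _ neat_x)//|->].
    (* The equality att(x) = {0} also asserts that att(x) is nonempty. *)
    have [z z_att] := attractor_exists char_k G_qred x_odd x_jordan.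
    by rewrite -(to_att _ neat_x z_att).
  by apply: (attractor_neat char_k G_qred x_odd x_jordan) => y /att0.
have [xs xsP] := ad_decomposition_exists char_k tr fx.
exists xs; split=> //.
apply: (attractor_eq0_conjugate char_k G_qred x_odd x_jordan tr sh xsP).
by apply: (to_att _ neat_x); right; split=> //; exists e, h, xs.
Qed.
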